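(* Let $d\ge1$ and let $\Delta$ be a random variable in $\mathbb R^d$ having exponential moments in a neighbourhood of $0$, i.e. there exists $r_1>0$ such that $\mathbb E[\exp(\theta\cdot\Delta)]<+\infty$ for every $\theta\in\mathbb R^d$ in the closed ball of radius $r_1$ centred at the origin. Denote by $m$ the mean of $\Delta$ (written as a row vector) and by $\Sigma^2$ its covariance matrix. For every $x\in\mathbb R^d$ let $\mathcal R_x$ be the law of $x+\Delta$. Then, for every finite measure $\mathcal M_0$ on $\mathbb R^d$ with $0<\mathcal M_0(\mathbb R^d)<+\infty$, the $(\mathcal M_0,(\mathcal R_x,x\in\mathbb R^d))$-measure-valued Pólya process $(\mathcal M_n)_{n\ge0}$ satisfies, almost surely as $n\to\infty$, $$\Theta_{\sqrt{\log n},\,m\log n}\left(n^{-1}\mathcal M_n\right)\longrightarrow \mathcal N(0,\Sigma^2+m^Tm)$$ for the topology of weak convergence, where $m^T$ is the transpose of $m$ (so $m^Tm$ is a $d\times d$ matrix).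
   Context: Measure-valued Pólya process (MVPP): given a finite non-negative Borel measure $\mathcal M_0$ on $\mathcal P=\mathbb R^d$ with $0<\mathcal M_0(\mathcal P)<\infty$ and a kernel $(\mathcal R_x,x\in\mathcal P)$ of Borel probability measures, the $(\mathcal M_0,(\mathcal R_x))$-MVPP is the Markov chain $(\mathcal M_n)_{n\ge0}$ of measures defined as follows: given $\mathcal M_n$, draw a random colour $C_n$ with law $\mathcal M_n/\mathcal M_n(\mathcal P)$, and, conditionally on $C_n=C$, set $\mathcal M_{n+1}=\mathcal M_n+\mathcal R_C$. For a measure $\mu$ on $\mathbb R^d$, a scalar $a\neq0$ and $b\in\mathbb R^d$, $\Theta_{a,b}(\mu)$ is the measure defined by $\int f\,d\Theta_{a,b}(\mu)=\int f(a^{-1}(x-b))\,d\mu(x)$ for all measurable $f$. *)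

(* Defs.v *)
From HB Require Import structures.
From mathcomp Require Import all_boot all_order all_algebra.
From mathcomp Require Import all_classical all_reals all_analysis.
From mathcomp Require Import measurable_realfun.

Set Implicit Arguments.
Unset Strict Implicit.
Unset Printing Implicit Defensive.

Import Order.TTheory GRing.Theory Num.Theory.
Import numFieldNormedType.Exports.

Local Open Scope classical_set_scope.
Local Open Scope ring_scope.

(* Borel sigma-algebra on R^d; the topology of 'rV[R]_d is the usual one
   (the library's norm on matrices is the sup norm). *)
HB.instance Definition _ (R : realType) (d : nat) :=
  @isMeasurable.Build (sigma_display (@open 'rV[R]_d)) 'rV[R]_d
    <<s @open 'rV[R]_d >> (@sigma_algebra0 _ setT (@open 'rV[R]_d))
    (@sigma_algebraC _ (@open 'rV[R]_d))
    (@sigma_algebra_bigcup _ setT (@open 'rV[R]_d)).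

Section borel_rV.
Context {R : realType} {d : nat}.

Lemma open_measurable_rV (U : set 'rV[R]_d) : open U -> measurable U.
Proof. exact: sub_sigma_algebra. Qed.

Lemma measurable_coord (i : 'I_d) :
  measurable_fun [set: 'rV[R]_d] (fun x : 'rV[R]_d => x ord0 i).
Proof.
apply: (measurability _ (RGenOpens.measurableE R)).
move=> _ [_ [a [b ->]] <-]; rewrite setTI; apply: open_measurable_rV.
have := @interval_open R (BRight a) (BLeft b) isT isT.
by move/continuousP: (@coord_continuous R 1 d ord0 i); exact.
Qed.

Lemma measurable_fun_rV dS (S : measurableType dS) (g : S -> 'rV[R]_d) :
  (forall i, measurable_fun [set: S] (fun s => g s ord0 i)) ->
  measurable_fun [set: S] g.
Proof.
move=> mg; apply: (@measurability _ _ _ _ _ _ (@open 'rV[R]_d)) => //.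
move=> _ [U oU <-]; rewrite setTI.
pose box (qn : 'rV[rat]_d * nat) :=
  [set x : 'rV[R]_d | forall i, `|x ord0 i - ratr (qn.1 ord0 i)| < qn.2.+1%:R^-1].
have -> : U = \bigcup_(qn in [set qn | box qn `<=` U]) box qn.
  apply/seteqP; split=> [x Ux|x [qn /= sub]]; last exact: sub.
  have /nbhs_ballP[e /= e0 xeU] : nbhs x U by exact: open_nbhs_nbhs.
  have [n ne] : exists n : nat, n.+1%:R^-1 + n.+1%:R^-1 < e.
    have e20 : 0 < e / 2 by rewrite divr_gt0.
    have [n _ /(_ n (leqnn n)) ne] := near_infty_natSinv_lt (PosNum e20).
    by exists n; rewrite [e]splitr ltrD.
  have /choice[q Hq] : forall i, exists q : rat, `|x ord0 i - ratr q| < n.+1%:R^-1.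
    move=> i; have [|q] := @rat_in_itvoo R (x ord0 i - n.+1%:R^-1) (x ord0 i + n.+1%:R^-1).
      by rewrite ltrBlDr -addrA ltrDl addr_gt0 // invr_gt0 ltr0n.
    by rewrite in_itv/= => xq; exists q; rewrite distrC ltr_distl.
  exists (\row_i q i, n) => /= [y /= yq|i /=]; last by rewrite mxE.
  apply: xeU; split=> // j i; rewrite (ord1 j); apply: le_lt_trans ne.
  rewrite -(subrK (ratr (q i)) (x ord0 i)) -addrA.
  apply: le_trans (ler_normD _ _) _; rewrite lerD ?ltW//.
  by have := yq i; rewrite mxE distrC.
rewrite preimage_bigcup; rewrite bigcup_mkcond.
apply: countable_bigcupT_measurable => // qn; case: ifPn => // _.
have -> : g @^-1` box qn = \bigcap_(i in [set: 'I_d])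
    ((fun s => g s ord0 i) @^-1` [set r | `|r - ratr (qn.1 ord0 i)| < qn.2.+1%:R^-1]).
  by apply/seteqP; split=> s /= H i; [move=> _; exact: H|exact: H].
apply: fin_bigcap_measurable => // i _.
rewrite -[X in measurable X]setTI; apply: mg => //.
apply: open_measurable.
rewrite (_ : [set _ | _] = ball (ratr (qn.1 ord0 i) : R) qn.2.+1%:R^-1); last first.
  by apply/seteqP; split=> r; rewrite /ball/= distrC.
exact: ball_open.
Qed.

End borel_rV.

Section linear.
Context {R : realType} {d : nat}.

Definition dotrv (u v : 'rV[R]_d) : R := (u *m v^T) ord0 ord0.

Definition rescale (a : R) (b : 'rV[R]_d) (x : 'rV[R]_d) : 'rV[R]_d :=
  a^-1 *: (x - b).

Lemma measurable_rescale a b : measurable_fun [set: 'rV[R]_d] (rescale a b).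
Proof.
apply: measurable_fun_rV => i.
rewrite (_ : (fun _ => _) = (fun x : 'rV[R]_d => a^-1 * (x ord0 i - b ord0 i))).
  apply: measurable_funM => //; apply: measurable_funB => //.
  exact: measurable_coord.
by apply/funext => x; rewrite !mxE.
Qed.

(* the image of mu by rescale a b, i.e. the measure whose integral against f is
   the integral of f (a^-1 (x - b)) against mu *)
Definition Theta (a : R) (b : 'rV[R]_d) (mu : {measure set 'rV[R]_d -> \bar R})
  : set 'rV[R]_d -> \bar R := pushforward mu (rescale a b).

HB.instance Definition _ a b (mu : {measure set 'rV[R]_d -> \bar R}) :=
  Measure.copy (Theta a b mu)
    (measure_function_pushforward__canonical__measure_function_Measure
       mu (measurable_rescale a b)).

Definition weak_cvg (mu : nat -> {measure set 'rV[R]_d -> \bar R})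
    (nu : {measure set 'rV[R]_d -> \bar R}) :=
  forall f : 'rV[R]_d -> R, continuous f -> bounded_fun f ->
    (\int[mu n]_x (f x)%:E)%E @[n --> \oo] --> (\int[nu]_x (f x)%:E)%E.

(* The univariate normal law with mean m and standard deviation s;
   normal_prob m 0 is by convention the uniform law on [0, 1], not \d_m. *)
Definition normal_law (m s : R) (B : set R) : \bar R :=
  if s == 0 then \d_m B else normal_prob m s B.

(* Possibly degenerate Gaussian law N(m, K): every linear form t.x has the
   univariate law N(t.m, t K t^T); these marginals determine nu. *)
Definition is_gaussian (nu : probability 'rV[R]_d R) (m : 'rV[R]_d)
    (K : 'M[R]_d) :=
  forall (t : 'rV[R]_d) (B : set R), measurable B ->
    nu (dotrv t @^-1` B) =
    normal_law (dotrv t m) (Num.sqrt (dotrv (t *m K) t)) B.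

End linear.

Section moments.
Context {R : realType} {d : nat} {dO : measure_display} {O : measurableType dO}.
Variables (Q : probability O R) (X : {RV Q >-> 'rV[R]_d}).

Definition exp_moments :=
  exists r1 : R, 0 < r1 /\
    forall theta : 'rV[R]_d, Num.sqrt (dotrv theta theta) <= r1 ->
      ('E_Q[fun w => expR (dotrv theta (X w))] < +oo)%E.

Definition mean_rv : 'rV[R]_d := \row_i fine 'E_Q[fun w => X w ord0 i].

Definition cov_mx : 'M[R]_d :=
  \matrix_(i, j) fine (covariance Q (fun w => X w ord0 i) (fun w => X w ord0 j)).

Definition shift_rv (x : 'rV[R]_d) (w : O) : 'rV[R]_d := x + X w.

Lemma measurable_shift_rv2 :
  measurable_fun setT (fun xw : 'rV[R]_d * O => shift_rv xw.1 xw.2).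
Proof.
apply: measurable_fun_rV => i.
rewrite (_ : (fun _ => _) = (fun xw : 'rV[R]_d * O => xw.1 ord0 i + X xw.2 ord0 i)).
  apply: measurable_funD.
    exact: (measurableT_comp (measurable_coord i) measurable_fst).
  apply: (measurableT_comp (measurable_coord i)).
  exact: (measurableT_comp (measurable_funPT X) measurable_snd).
by apply/funext => xw; rewrite mxE.
Qed.

Lemma measurable_shift_rv x : measurable_fun setT (shift_rv x).
Proof. exact: (measurableT_comp measurable_shift_rv2 (pair1_measurable x)). Qed.

HB.instance Definition _ x := isMeasurableFun.Build _ _ O 'rV[R]_d
  (shift_rv x) (measurable_shift_rv x).

Definition walk_kernel (x : 'rV[R]_d) : {measure set 'rV[R]_d -> \bar R} :=
  distribution Q (shift_rv x).

Lemma measurable_walk_kernel U : measurable U ->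
  measurable_fun [set: 'rV[R]_d] (walk_kernel ^~ U).
Proof.
move=> mU.
pose S := (fun xw : 'rV[R]_d * O => shift_rv xw.1 xw.2) @^-1` U.
have mS : measurable S by rewrite -[S]setTI; exact: measurable_shift_rv2.
have -> : (fun x => walk_kernel x U) = Q \o xsection S.
  by apply/funext => x; rewrite /= xsectionE.
exact: measurable_fun_xsection.
Qed.

HB.instance Definition _ := isKernel.Build _ _ _ _ R walk_kernel
  measurable_walk_kernel.

Lemma walk_kernel_prob x : walk_kernel x [set: 'rV[R]_d] = 1%E.
Proof. exact: probability_setT. Qed.

HB.instance Definition _ := Kernel_isProbability.Build _ _ _ _ R walk_kernel
  walk_kernel_prob.

End moments.

Section mvpp.
Context {R : realType} {dT dO : measure_display}.
Context {T : measurableType dT} {Omega : measurableType dO}.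

(* sigma-algebra generated by M_0, ..., M_n, where the space of measures carries
   the sigma-algebra generated by the evaluations mu |-> mu B *)
Definition history (M : nat -> Omega -> {measure set T -> \bar R}) (n : nat) :
    set (set Omega) :=
  <<s \bigcup_(k in `I_n.+1) \bigcup_(B in @measurable _ T)
        preimage_set_system [set: Omega] (fun w => M k w B) measurable >>.

(* (M_n) is the measure-valued Polya process started from M0 with replacement
   kernel K, and C_n is the colour drawn at time n: the last clause says that the
   conditional law of C_n given M_0, ..., M_n is M_n / M_n(T). *)
Record is_mvpp (P : probability Omega R) (M0 : {measure set T -> \bar R})
    (K : R.-pker T ~> T) (C : nat -> {RV P >-> T})
    (M : nat -> Omega -> {measure set T -> \bar R}) : Prop := {
  mvpp_init : forall w B, measurable B -> M 0%N w B = M0 B ;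
  mvpp_step : forall n w B, measurable B ->
    M n.+1 w B = (M n w B + K (C n w) B)%E ;
  mvpp_colour : forall n A B, history M n A -> measurable B ->
    P (A `&` C n @^-1` B) =
    (\int[P]_(w in A) (M n w B * ((fine (M n w [set: T]))^-1)%:E))%E }.

End mvpp.

(* Main.v *)
Require Import Defs.
From HB Require Import structures.
From mathcomp Require Import all_boot all_order all_algebra.
From mathcomp Require Import all_classical all_reals all_analysis.
From mathcomp Require Import measurable_realfun.
From mathcomp Require Import ring lra zify.

Set Implicit Arguments.
Unset Strict Implicit.
Unset Printing Implicit Defensive.

Import Order.TTheory GRing.Theory Num.Theory.
Import numFieldNormedType.Exports.

Local Open Scope classical_set_scope.
Local Open Scope ring_scope.

(** Let q_k = 1 / (M_0(R^d) + k + 1). Given the past, the law of the colour drawn at time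
    k + 1 is a mixture, with weights 1 - q_k and q_k, of the law M_k / M_k(R^d) of the
    previous colour and of the law of the new ball R_C. In the mean, a colour therefore
    follows a lazy walk: at step k it moves by an independent copy of Delta with
    probability q_k. Such a walk makes about ln n moves up to time n, which makes
    m ln n the right centring and sqrt (ln n) the right scale. The fluctuations of the
    number of moves are of the order of sqrt (ln n) as well, and they turn the covariance
    Sigma^2 into the matrix Sigma^2 + m^T m of second moments.

    For a fixed test function h seen at time n, let g_k be the image of the rescaled h
    under the steps k, ..., n - 1 of the lazy walk, and let avg k f be the integral of f
    with respect to M_k / M_k(R^d). Then avg k (g_k) is a martingale in k
    (avg_martingale), whose final value avg n (g_n) is the integral of h that has to be
    studied. It is compared with its value at the time N, the square of the integer part
    of log_2 n.

    - After time N, the increments of the martingale are at most 2 q_k, and the sum of the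
      q_k^2 is at most 1 / N. An exponential bound (avg_tail) shows that the probability of
      a fluctuation of size eta is at most 2 exp (- eta^2 N / 32), which is summable over
      n. Borel-Cantelli gives almost sure convergence to zero (restart_fluctuation)
      although the martingale depends on n.
    - At time N the colours are typically at distance o(sqrt (ln n)) from the origin. A
      truncation of the norm divided by N^(1/8) gives a nonnegative supermartingale
      (lazy_escape), and the maximal inequality bounds it at all times simultaneously
      (no_escape). As the walk is translation invariant, g_N inherits the modulus of
      continuity of the rescaled h, hence avg N (g_N) is close to the number g_N(0).
    - The number g_N(0) is the expectation of h for the rescaled lazy walk started from the
      origin. The Lindeberg method replaces each lazy step by a Gaussian step with the same
      mean and, up to an error of order q_k^2, the same second moments (lazy_iter_gop). The
      third-order remainders are of order q_k (ln n)^(-3/2) and have a sum that tends to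
      zero, and the Gaussian steps add up exactly (restart_limit).

    The exponential moments of Delta bound its third moment, which is what the Lindeberg
    method uses. The limit law is built as the law of a sum of independent normal variables
    times the vectors of a Gram decomposition of the matrix of second moments (psd_gram);
    this covers degenerate matrices.

    To pass from one test function to weak convergence, outside of a single null set, a
    countable family of smooth functions is used: the functions hits, made from products of
    cubic splines, approximate the indicators of open sets from below, and a portmanteau
    argument concludes (weak_cvg_smooth). *)

(** * Bounded measurable functions and their integrals *)

Section bounded_measurable.
Context {d} {T : measurableType d} {R : realType}.
Implicit Types f g : T -> R.

Definition bm f := measurable_fun [set: T] f /\ exists c, forall x, `|f x| <= c.

Lemma bm_cst c : bm (cst c).
Proof. by split; [exact: measurable_cst|exists `|c|]. Qed.

Lemma bmD f g : bm f -> bm g -> bm (fun x => f x + g x).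
Proof.
move=> [mf [a fa]] [mg [b gb]]; split; first exact: measurable_funD.
by exists (a + b) => x; rewrite (le_trans (ler_normD _ _))// lerD.
Qed.

Lemma bmM f g : bm f -> bm g -> bm (fun x => f x * g x).
Proof.
move=> [mf [a fa]] [mg [b gb]]; split; first exact: measurable_funM.
by exists (a * b) => x; rewrite normrM ler_pM.
Qed.

Lemma bmZ c f : bm f -> bm (fun x => c * f x).
Proof. by move=> bf; apply: bmM => //; exact: bm_cst. Qed.

Lemma bmN f : bm f -> bm (fun x => - f x).
Proof.
move=> [mf [a fa]]; split; first exact: measurableT_comp.
by exists a => x; rewrite normrN.
Qed.

Lemma bmB f g : bm f -> bm g -> bm (fun x => f x - g x).
Proof. by move=> bf bg; apply: bmD => //; exact: bmN. Qed.

Lemma bm_indic A : measurable A -> bm (\1_A : T -> R).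
Proof.
move=> mA; split; first exact: measurable_indic.
by exists 1 => x; rewrite indicE; case: (_ \in _); rewrite ?normr1 ?normr0.
Qed.

Lemma bm_expR f : bm f -> bm (fun x => expR (f x)).
Proof.
move=> [mf [a fa]]; split; first exact: measurableT_comp.
by exists (expR a) => x; rewrite ger0_norm ?expR_ge0// ler_expR (le_trans (ler_norm _)).
Qed.

Lemma bm_comp d' (T' : measurableType d') (f : T' -> R) (h : T -> T') :
  measurable_fun setT h -> (measurable_fun [set: T'] f /\ exists c, forall x, `|f x| <= c) ->
  bm (fun x => f (h x)).
Proof.
move=> mh [mf [a fa]]; split; first exact: (measurableT_comp mf mh).
by exists a.
Qed.

Lemma bm_itv01 f : measurable_fun setT f -> (forall x, 0 <= f x <= 1) -> bm f.
Proof.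
by move=> mf f01; split => //; exists 1 => x; have /andP[f0 f1] := f01 x; rewrite ger0_norm.
Qed.

Lemma measurable_superlevel f c : measurable_fun setT f -> measurable [set x | c <= f x].
Proof.
move=> mf; have := mf measurableT `[c, +oo[%classic (measurable_itv _); rewrite setTI.
by congr measurable; apply/seteqP; split=> x /=; rewrite in_itv/= andbT.
Qed.

Variable mu : {measure set T -> \bar R}.
Hypothesis fmu : (mu setT < +oo)%E.

Lemma bm_integrable f : bm f -> mu.-integrable setT (EFin \o f).
Proof.
move=> [mf [a fa]]; apply: measurable_bounded_integrable => //.
exists a; split; first by rewrite num_real.
by move=> M aM x _ /=; rewrite (le_trans (fa x))// ltW.
Qed.

Lemma int_bm_fin f : bm f -> (\int[mu]_x (f x)%:E)%E = (\int[mu]_x f x)%:E.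
Proof.
by move=> bf; rewrite /Rintegral fineK//; apply: integrable_fin_num => //; exact: bm_integrable.
Qed.

Lemma RintD f g : bm f -> bm g ->
  \int[mu]_x (f x + g x) = \int[mu]_x f x + \int[mu]_x g x.
Proof. by move=> bf bg; apply: RintegralD => //; exact: bm_integrable. Qed.

Lemma RintB f g : bm f -> bm g ->
  \int[mu]_x (f x - g x) = \int[mu]_x f x - \int[mu]_x g x.
Proof. by move=> bf bg; apply: RintegralB => //; exact: bm_integrable. Qed.

Lemma RintZ c f : bm f -> \int[mu]_x (c * f x) = c * \int[mu]_x f x.
Proof. by move=> bf; apply: RintegralZl => //; exact: bm_integrable. Qed.

Lemma Rint_cst c : \int[mu]_x c = c * fine (mu setT).
Proof. exact: Rintegral_cst. Qed.

Lemma Rint_le f g : bm f -> bm g -> (forall x, f x <= g x) ->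
  \int[mu]_x f x <= \int[mu]_x g x.
Proof. by move=> bf bg fg; apply: le_Rintegral => //; exact: bm_integrable. Qed.

Lemma Rint_norm_le f c : bm f -> (forall x, `|f x| <= c) ->
  `|\int[mu]_x f x| <= c * fine (mu setT).
Proof.
move=> bf fc; rewrite ler_norml -mulNr -2!Rint_cst.
by apply/andP; split; apply: Rint_le => //; try exact: bm_cst;
  move=> x; have := fc x; rewrite ler_norml => /andP[].
Qed.

Lemma Rint_dist f g c : bm f -> bm g -> (forall x, `|f x - g x| <= c) ->
  `|\int[mu]_x f x - \int[mu]_x g x| <= c * fine (mu setT).
Proof. by move=> bf bg fg; rewrite -RintB//; apply: Rint_norm_le => //; exact: bmB. Qed.

Lemma Rint_indic A : measurable A -> \int[mu]_x (\1_A x) = fine (mu A).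
Proof. by move=> mA; rewrite /Rintegral integral_indic// setIT. Qed.

End bounded_measurable.

Lemma exprn_le_add1 {R : realType} (x : R) k n : 0 <= x -> (k <= n)%N -> x ^+ k <= 1 + x ^+ n.
Proof.
move=> x0 kn; have [x1|/ltW x1] := leP x 1.
  by rewrite (le_trans (exprn_ile1 k x0 x1))// lerDl exprn_ge0.
by rewrite (le_trans (ler_weXn2l x1 kn))// lerDr.
Qed.

Section integrable_toolkit.
Context {d} {T : measurableType d} {R : realType} (mu : {measure set T -> \bar R}).
Implicit Types f g : T -> R.

Lemma integrable_dom f g : measurable_fun setT f -> mu.-integrable setT (EFin \o g) ->
  (forall x, `|f x| <= g x) -> mu.-integrable setT (EFin \o f).
Proof.
move=> mf ig fg; apply: le_integrable ig => //; first exact/measurable_EFinP.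
by move=> x _ /=; rewrite lee_fin (le_trans (fg x))// ler_norm.
Qed.

Lemma integrable_addr f g : mu.-integrable setT (EFin \o f) ->
  mu.-integrable setT (EFin \o g) -> mu.-integrable setT (EFin \o (fun x => f x + g x)).
Proof. by move=> mf mg; have := integrableD measurableT mf mg. Qed.

Lemma integrable_scale c f : mu.-integrable setT (EFin \o f) ->
  mu.-integrable setT (EFin \o (fun x => c * f x)).
Proof. by move=> mf; have := integrableZl measurableT c mf. Qed.

Lemma integrable_sumr (I : Type) (s : seq I) (f : I -> T -> R) :
  (forall i, mu.-integrable setT (EFin \o f i)) ->
  mu.-integrable setT (EFin \o (fun x => \sum_(i <- s) f i x)).
Proof.
move=> mf; elim: s => [|i s IH].
  by rewrite (_ : _ \o _ = cst 0%E); [exact: integrable0|apply/funext => x /=; rewrite big_nil].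
have := integrable_addr (mf i) IH.
by congr (mu.-integrable _ _); apply/funext => x /=; rewrite big_cons.
Qed.

Lemma Rint_sum (I : Type) (s : seq I) (f : I -> T -> R) :
  (forall i, mu.-integrable setT (EFin \o f i)) ->
  \int[mu]_x (\sum_(i <- s) f i x) = \sum_(i <- s) \int[mu]_x f i x.
Proof.
move=> mf; elim: s => [|i s IH].
  rewrite big_nil; under eq_Rintegral do rewrite big_nil.
  by rewrite /Rintegral integral0.
rewrite big_cons -IH -RintegralD//; last exact: integrable_sumr.
by apply: eq_Rintegral => x _; rewrite big_cons.
Qed.

End integrable_toolkit.

Section bm_induction.
Context {d} {T : measurableType d} {R : realType}.

(** A layer-cake approximation: the sum counts the levels i / (k + 1) that y reaches. *)
Lemma step_approx (k : nat) (y : R) : 0 <= y <= 1 ->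
  `|y - \sum_(i < k.+1) k.+1%:R^-1 * (((i.+1)%:R / k.+1%:R <= y)%R : bool)%:R| <= k.+1%:R^-1.
Proof.
move=> /andP[y0 y1].
have k0 : 0 < k.+1%:R :> R by [].
rewrite -mulr_sumr.
pose n := Num.truncn (y * k.+1%:R).
have /andP[n1 n2] : n%:R <= y * k.+1%:R < n.+1%:R by apply: truncn_itv; rewrite mulr_ge0.
have nk : (n <= k.+1)%N.
  by rewrite -(ler_nat R) (le_trans n1)// ler_piMl.
have -> : \sum_(i < k.+1) (((i.+1)%:R / k.+1%:R <= y)%R : bool)%:R = n%:R :> R.
  under eq_bigr => i _.
    have -> : ((i.+1)%:R / k.+1%:R <= y) = (i < n)%N.
      rewrite ler_pdivrMr//; apply/idP/idP => [h|h].
        by rewrite -ltnS -(ltr_nat R) (le_lt_trans h).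
      by rewrite (le_trans _ n1)// ler_nat.
    over.
  rewrite -natr_sum; congr _%:R; move: nk; generalize (k.+1) => K nK.
  suff -> : (\sum_(i < K) (i < n) = minn K n)%N by apply/minn_idPr.
  elim: (K) => [|j IH]; first by rewrite big_ord0 min0n.
  by rewrite big_ord_recr/= IH; lia.
rewrite ger0_norm.
  rewrite lerBlDl -[X in _ <= _ + X]mulr1 -mulrDr -(ler_pM2r k0) mulrAC mulVf ?gt_eqF// mul1r.
  by rewrite natr1 ltW.
by rewrite subr_ge0 mulrC ler_pdivrMr.
Qed.

(** Both sides of an identity between integrals are usually linear and
    continuous for uniform convergence, so that it can be checked on indicators:
    a function with values in [0, 1] is the uniform limit of the averages of the
    indicators of its superlevel sets. *)
Lemma bm_ind (Phi : (T -> R) -> Prop) :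
  (forall A, measurable A -> Phi \1_A) ->
  (forall a f g, bm f -> bm g -> Phi f -> Phi g -> Phi (fun x => a * f x + g x)) ->
  (forall f, bm f -> (forall e, 0 < e -> exists g, [/\ bm g, Phi g & forall x, `|f x - g x| <= e]) ->
    Phi f) ->
  forall f, bm f -> Phi f.
Proof.
move=> Pi Pl Pu.
have P0 : Phi (cst 0).
  have := Pi set0 measurable0; congr Phi.
  by apply/funext => x; rewrite indicE in_set0.
have PZ a f : bm f -> Phi f -> Phi (fun x => a * f x).
  move=> bf Pf; have := Pl a f (cst 0) bf (bm_cst 0) Pf P0; congr Phi.
  by apply/funext => x; rewrite addr0.
have P01 f : bm f -> (forall x, 0 <= f x <= 1) -> Phi f.
  move=> bf f01; apply: Pu => // e e0.
  have [k _ /(_ k (leqnn k)) ke] := near_infty_natSinv_lt (PosNum e0).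
  pose A (i : nat) := [set x | (i.+1)%:R / k.+1%:R <= f x].
  have mA i : measurable (A i) by apply: measurable_superlevel; exact: bf.1.
  pose g n : T -> R := fun x => \sum_(i < n) k.+1%:R^-1 * \1_(A i) x.
  have H n : bm (g n) /\ Phi (g n).
    elim: n => [|n [IH1 IH2]].
      have -> : g 0 = cst 0 by apply/funext => x; rewrite /g big_ord0.
      by split; [exact: bm_cst|exact: P0].
    have -> : g n.+1 = (fun x => k.+1%:R^-1 * \1_(A n) x + g n x).
      by apply/funext => x; rewrite /g big_ord_recr/= addrC.
    have bi := bm_indic (R := R) (mA n).
    by split; [apply: bmD => //; exact: bmZ|apply: Pl => //; exact: Pi].
  exists (g k.+1).
  split; [exact: (H _).1|exact: (H _).2|move=> x].
  rewrite (le_trans _ (ltW ke))//; apply: le_trans (step_approx k (f01 x)).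
  rewrite le_eqVlt; apply/orP; left; apply/eqP; congr (`|_ - _|).
  apply: eq_bigr => i _; congr (_ * _); rewrite indicE; congr (_%:R); congr nat_of_bool.
  by apply/idP/idP; rewrite inE.
move=> f bf; have [c fc] := bf.2.
pose C := `|c| + 1.
have C0 : 0 < C by rewrite ltr_wpDl.
have cC : c <= C by rewrite (le_trans (ler_norm _))// lerDl.
clearbody C.
have bg : bm (fun x => (2 * C)^-1 * (f x + C)) by apply: bmZ; apply: bmD => //; exact: bm_cst.
have P1 : Phi (fun x => (2 * C)^-1 * (f x + C)).
  apply: P01 => // x; have := fc x; rewrite ler_norml => /andP[f1 f2].
  have C20 : 0 < 2 * C by rewrite mulr_gt0.
  rewrite mulrC ler_pdivrMr//; apply/andP; split; last by lra.
  by rewrite divr_ge0 ?(ltW C20)//; lra.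
have PT : Phi (fun=> -C).
  have := PZ (- C) _ (bm_indic measurableT) (Pi setT measurableT); congr Phi.
  by apply/funext => x; rewrite indicT mulr1.
have := Pl (2 * C) _ _ bg (bm_cst (- C)) P1 PT; congr Phi; apply/funext => x /=.
by rewrite mulVKf ?mulf_neq0 ?gt_eqF// addrK.
Qed.

End bm_induction.

Section bm_fubini.
Context {d1 d2} {T1 : measurableType d1} {T2 : measurableType d2} {R : realType}.
Variables (m1 : probability T1 R) (m2 : probability T2 R).

Lemma prob_fin d (T : measurableType d) (m : probability T R) : (m setT < +oo)%E.
Proof. by rewrite probability_setT ltry. Qed.

Lemma Rint_prob_cst d (T : measurableType d) (m : probability T R) (c : R) :
  \int[m]_x c = c.
Proof.
rewrite Rint_cst -[RHS]mulr1; congr (_ * _).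
by rewrite -[RHS]/(fine 1%E); congr fine; exact: probability_setT.
Qed.

Lemma bm_pair1 (F : T1 * T2 -> R) x : bm F -> bm (fun y => F (x, y)).
Proof. by move=> bF; exact: (bm_comp (pair1_measurable x) bF). Qed.

Lemma bm_pair2 (F : T1 * T2 -> R) y : bm F -> bm (fun x => F (x, y)).
Proof. by move=> bF; exact: (bm_comp (pair2_measurable y) bF). Qed.

Lemma Rint_prob_norm d (T : measurableType d) (m : probability T R) (f : T -> R) c :
  bm f -> (forall x, `|f x| <= c) -> `|\int[m]_x f x| <= c.
Proof.
move=> bf fc; have := Rint_norm_le (prob_fin m) bf fc.
by move/le_trans; apply; rewrite -[leLHS]Rint_cst Rint_prob_cst.
Qed.

Lemma Rint_prob_dist d (T : measurableType d) (m : probability T R) (f g : T -> R) c :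
  bm f -> bm g -> (forall x, `|f x - g x| <= c) ->
  `|\int[m]_x f x - \int[m]_x g x| <= c.
Proof.
move=> bf bg fg; have := Rint_dist (prob_fin m) bf bg fg.
by move/le_trans; apply; rewrite -[leLHS]Rint_cst Rint_prob_cst.
Qed.

Lemma bm_param (F : T1 * T2 -> R) : bm F -> bm (fun x => \int[m2]_y F (x, y)).
Proof.
move=> bF; have [mF [c Fc]] := bF; split; last first.
  by exists c => x; apply: Rint_prob_norm => //; exact: bm_pair1.
have bFc : bm (fun z => F z + c) by apply: bmD => //; exact: bm_cst.
have -> : (fun x => \int[m2]_y F (x, y)) =
          (fun x => fine (\int[m2]_y (F (x, y) + c)%:E)%E - c).
  apply/funext => x; rewrite (int_bm_fin (prob_fin m2) (bm_pair1 x bFc))/=.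
  rewrite RintD; [|exact: prob_fin|exact: bm_pair1|exact: bm_cst].
  by rewrite Rint_prob_cst addrK.
apply: measurable_funB => //; apply: measurableT_comp => //.
apply: (measurable_fun_fubini_tonelli_F (fun z => (F z + c)%:E)).
  by apply/measurable_EFinP; exact: bFc.1.
by move=> z; rewrite lee_fin; have := Fc z; rewrite ler_norml => /andP[]; lra.
Qed.

Lemma Rint_swap (F : T1 * T2 -> R) : bm F ->
  \int[m1]_x \int[m2]_y F (x, y) = \int[m2]_y \int[m1]_x F (x, y).
Proof.
move=> bF.
have iF : (m1 \x m2)%E.-integrable setT (EFin \o F).
  by apply: bm_integrable => //; exact: (prob_fin (m1 \x m2)%E).
have /= := Fubini iF.
under eq_integral => x _ do rewrite (int_bm_fin (prob_fin m2) (bm_pair1 x bF)).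
under [X in _ = X -> _]eq_integral => x _ do rewrite (int_bm_fin (prob_fin m1) (bm_pair2 x bF)).
by rewrite /Rintegral => ->.
Qed.

Lemma Rint_prod (F : T1 * T2 -> R) : bm F ->
  \int[(m1 \x m2)%E]_z F z = \int[m1]_x \int[m2]_y F (x, y).
Proof.
move=> bF.
have iF : (m1 \x m2)%E.-integrable setT (EFin \o F).
  by apply: bm_integrable => //; exact: (prob_fin (m1 \x m2)%E).
have /= := integral12_prod_meas1 iF.
under eq_integral => x _ do rewrite /fubini_F/= (int_bm_fin (prob_fin m2) (bm_pair1 x bF)).
by rewrite /Rintegral => ->.
Qed.

End bm_fubini.

Section image_measure.
Context {d1 d2} {T1 : measurableType d1} {T2 : measurableType d2} {R : realType}.
Variables (m1 : {measure set T1 -> \bar R}) (m2 : {measure set T2 -> \bar R}) (phi : T1 -> T2).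
Hypothesis mphi : measurable_fun setT phi.
Hypothesis m12 : forall A, measurable A -> m2 A = m1 (phi @^-1` A).

Lemma image_ge0_integral (f : T2 -> \bar R) : measurable_fun setT f -> (forall y, 0 <= f y)%E ->
  (\int[m2]_y f y = \int[m1]_x f (phi x))%E.
Proof.
move=> mf f0.
have := @ge0_integral_pushforward _ _ _ _ _ phi mphi m1 setT f measurableT mf (fun y _ => f0 y).
rewrite preimage_setT => <-; apply: eq_measure_integral => /= A mA _.
by rewrite m12.
Qed.

Lemma image_integrable (f : T2 -> R) : measurable_fun setT f ->
  m1.-integrable setT (EFin \o (f \o phi)) -> m2.-integrable setT (EFin \o f).
Proof.
move=> mf /integrableP[_ fi]; apply/integrableP; split; first exact/measurable_EFinP.
rewrite image_ge0_integral//.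
by do 2 apply: measurableT_comp => //; exact/measurable_EFinP.
Qed.

Lemma image_integral (f : T2 -> R) : measurable_fun setT f ->
  m1.-integrable setT (EFin \o (f \o phi)) ->
  \int[m2]_y f y = \int[m1]_x f (phi x).
Proof.
move=> mf fi; rewrite /Rintegral; congr fine.
have mf' : measurable_fun setT (EFin \o f) by exact/measurable_EFinP.
have h := @integral_pushforward _ _ _ _ _ phi mphi m1 setT (EFin \o f) mf'.
rewrite preimage_setT in h; rewrite -[RHS]h//.
by apply: eq_measure_integral => /= A mA _; rewrite m12.
Qed.

Lemma image_integral_bm (f : T2 -> R) : (m1 setT < +oo)%E -> bm f ->
  \int[m2]_y f y = \int[m1]_x f (phi x).
Proof.
move=> fm bf; apply: image_integral; first exact: bf.1.
by apply: bm_integrable => //; exact: bm_comp bf.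
Qed.

End image_measure.

Section borel_vectors.
Context {R : realType} {d : nat}.
Notation V := 'rV[R]_d.

Lemma continuous_measurable_rV (f : V -> R) : continuous f -> measurable_fun [set: V] f.
Proof.
move=> cf; apply: (measurability _ (RGenOpens.measurableE R)).
move=> _ [_ [a [b ->]] <-]; rewrite setTI; apply: open_measurable_rV.
have := @interval_open R (BRight a) (BLeft b) isT isT.
by move/continuousP: cf; exact.
Qed.

Lemma measurable_norm_rV : measurable_fun [set: V] (fun x : V => `|x|).
Proof. by apply: continuous_measurable_rV; exact: norm_continuous. Qed.

Lemma measurable_addrV d' (T : measurableType d') (f g : T -> V) :
  measurable_fun setT f -> measurable_fun setT g -> measurable_fun setT (fun x => f x + g x).
Proof.
move=> mf mg; apply: measurable_fun_rV => i.
rewrite (_ : (fun _ => _) = (fun x => f x ord0 i + g x ord0 i)).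
  by apply: measurable_funD; exact: (measurableT_comp (measurable_coord i)).
by apply/funext => x; rewrite mxE.
Qed.

Lemma measurable_scalerV d' (T : measurableType d') (f : T -> R) (g : T -> V) :
  measurable_fun setT f -> measurable_fun setT g -> measurable_fun setT (fun x => f x *: g x).
Proof.
move=> mf mg; apply: measurable_fun_rV => i.
rewrite (_ : (fun _ => _) = (fun x => f x * g x ord0 i)).
  by apply: measurable_funM => //; exact: (measurableT_comp (measurable_coord i)).
by apply/funext => x; rewrite mxE.
Qed.

Lemma norm_coord_le (x : V) i : `|x ord0 i| <= `|x|.
Proof.
rewrite [leRHS]/Num.norm/= mx_normrE.
by apply/bigmax_geP; right => /=; exists (ord0, i).
Qed.

End borel_vectors.

(** * The one-dimensional Gaussian law *)

Section monotone_bound.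
Context {d} {T : measurableType d} {R : realType} (mu : {measure set T -> \bar R}).

Lemma integral_truncation_bound (f : T -> R) (C : R) : measurable_fun setT f ->
  (forall x, 0 <= f x) ->
  (forall n : nat, (\int[mu]_x (Num.min (f x) n%:R)%:E <= C%:E)%E) ->
  (\int[mu]_x (f x)%:E <= C%:E)%E.
Proof.
move=> mf f0 fC.
have mfn n : measurable_fun setT (fun x => (Num.min (f x) n%:R)%:E).
  by apply/measurable_EFinP; apply: measurable_minr.
have -> : (\int[mu]_x (f x)%:E = \int[mu]_x (limn (fun n => (Num.min (f x) n%:R)%:E)))%E.
  apply: eq_integral => x _; apply/esym/cvg_lim => //.
  apply: cvg_near_cst; near=> n.
  congr EFin; apply/min_idPl.
  by near: n; exact: nbhs_infty_ger.
rewrite monotone_convergence//; last 2 first.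
- by move=> n x _; rewrite lee_fin le_min f0/=.
- by move=> x _ m n mn; rewrite lee_fin le_min2// ler_nat.
apply: lime_le; last by apply: nearW.
apply: ereal_nondecreasing_is_cvgn => m n mn; apply: ge0_le_integral => //.
- by move=> x _; rewrite lee_fin le_min f0/=.
- by move=> x _; rewrite lee_fin le_min2// ler_nat.
Unshelve. all: by end_near. Qed.

End monotone_bound.

Section gaussian1.
Context {R : realType}.
Notation leb := (@lebesgue_measure R).
Notation gamma := (@normal_prob R 0 1).
Notation TR := (measurableTypeR R).

Definition affine (m t : R) (y : TR) : TR := m + t * y.

Lemma measurable_affine m t : measurable_fun [set: TR] (affine m t).
Proof.
have h : measurable_fun [set: R] (fun y : R => m + t * y).
  by apply: measurable_funD => //; exact: measurable_funM.
exact: h.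
Qed.

(** By uniqueness of Lebesgue measure it is enough to look at half-open intervals;
    for t < 0 their preimages are closed on the left instead of on the right. *)
Lemma lebesgue_affine m t (A : set TR) : t != 0 -> measurable A ->
  leb A = (`|t|%:E * leb (affine m t @^-1` A))%E.
Proof.
move=> t0 mA.
have mt := measurable_affine m t.
pose mu : {measure set TR -> \bar R} := mscale (NngNum (normr_ge0 t))
  (measure_function_pushforward__canonical__measure_function_Measure leb mt).
suff : forall X, ocitv X -> leb X = mu X.
  by move=> H; exact: (lebesgue_measure_unique H mA).
move=> _ [[a b] _ <-].
rewrite /mu /= /mscale/= /pushforward.
have [tp|tn] : 0 < t \/ t < 0 by move: t0; case: (ltgtP t 0) => //; [right|left].
  have -> : affine m t @^-1` `]a, b] = `](a - m) / t, (b - m) / t]%classic.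
    apply/seteqP; split=> x; rewrite /affine/= !in_itv/= ltr_pdivrMr// ler_pdivlMr//;
      move=> /andP[h1 h2]; apply/andP; split; lra.
  rewrite !lebesgue_measure_itv/= !lte_fin ltr_pM2r ?invr_gt0// ltrD2r.
  case: ifP => _; rewrite ?mule0// -!EFinB -EFinM; congr EFin.
  by rewrite gtr0_norm// -mulrBl mulrC divfK//; ring.
have -> : affine m t @^-1` `]a, b] = `[(b - m) / t, (a - m) / t[%classic.
  apply/seteqP; split=> x; rewrite /affine/= !in_itv/= ltr_ndivlMr// ler_ndivrMr//;
    move=> /andP[h1 h2]; apply/andP; split; lra.
rewrite !lebesgue_measure_itv/= !lte_fin ltr_nM2r ?invr_lt0// ltrD2r.
case: ifP => _; rewrite ?mule0// -!EFinB -EFinM; congr EFin.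
by rewrite ltr0_norm// -mulrBl mulrC mulrN divfK//; ring.
Qed.

Lemma normal_pdf_affine m t y : t != 0 ->
  normal_pdf 0 1 y = `|t| * normal_pdf m t (affine m t y).
Proof.
move=> t0; rewrite !normal_pdfE ?oner_eq0// /normal_peak /normal_fun /affine.
rewrite mulrA; congr (_ * _).
  rewrite expr1n mul1r -mulrnAr sqrtrM ?sqr_ge0// sqrtr_sqr invfM mulrA divff ?mul1r//.
  by rewrite normr_eq0.
by congr expR; rewrite expr1n; field; rewrite t0.
Qed.

Lemma measurable_normal_pdfE m t : measurable_fun [set: TR] (EFin \o normal_pdf m t).
Proof. by apply/measurable_EFinP; exact: (measurable_normal_pdf m t). Qed.

(** Change of variables in the density. *)
Lemma normal_prob_affine m t (B : set TR) : t != 0 -> measurable B ->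
  gamma (affine m t @^-1` B) = normal_prob m t B.
Proof.
move=> t0 mB; rewrite /normal_prob.
have mt := measurable_affine m t.
transitivity (`|t|%:E * \int[leb]_(x in affine m t @^-1` B) (normal_pdf m t (affine m t x))%:E)%E.
  rewrite -ge0_integralZl//.
  - by apply: eq_integral => x _; rewrite (normal_pdf_affine m x t0) EFinM.
  - by rewrite -[X in measurable X]setTI; exact: mt.
  - apply: measurable_funTS; apply: (measurableT_comp (measurable_normal_pdfE m t) mt).
  - by move=> x _; rewrite lee_fin normal_pdf_ge0.
have h := @ge0_integral_pushforward _ _ _ _ R _ mt leb B _ mB
   (measurable_funTS (measurable_normal_pdfE m t)).
rewrite -[X in (_ * X)%E]h; last by move=> y _; rewrite lee_fin normal_pdf_ge0.
have -> : `|t|%:E = (NngNum (normr_ge0 t))%:num%:E by [].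
rewrite -ge0_integral_mscale//.
- apply: eq_measure_integral => A mA _; exact/esym/lebesgue_affine.
- exact: (measurable_funTS (measurable_normal_pdfE m t)).
- by move=> y _; rewrite lee_fin normal_pdf_ge0.
Qed.

Lemma integrable_bm_normal_pdf m t (f : TR -> R) : bm f ->
  leb.-integrable setT (EFin \o (fun x => f x * normal_pdf m t x)).
Proof.
move=> [mf [c fc]].
apply: (@integrable_dom _ TR R leb _ (fun x => c * normal_pdf m t x)).
- by apply: measurable_funM => //; exact: measurable_normal_pdf.
- by apply: integrable_scale; exact: integrable_normal_pdf.
- move=> x; rewrite normrM (ger0_norm (normal_pdf_ge0 _ _ _)).
  by rewrite ler_wpM2r ?normal_pdf_ge0.
Qed.

Lemma Rint_normal_prob m t (f : TR -> R) : bm f ->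
  \int[normal_prob m t]_x f x = \int[leb]_x (f x * normal_pdf m t x).
Proof.
move: f; apply: bm_ind.
- move=> A mA; rewrite Rint_indic// /normal_prob /Rintegral; congr fine.
  rewrite [LHS]integral_mkcond; apply: eq_integral => x _.
  by rewrite patchE indicE; case: ifP => _; rewrite ?mul1r ?mul0r.
- move=> a f g bf bg hf hg.
  have fp := prob_fin (normal_prob m t).
  rewrite RintD//; last exact: bmZ.
  rewrite RintZ// hf hg -RintegralZl//; last exact: integrable_bm_normal_pdf.
  rewrite -RintegralD//; first by apply: eq_Rintegral => x _; rewrite mulrDl mulrA.
  + by apply: integrable_scale; exact: integrable_bm_normal_pdf.
  + exact: integrable_bm_normal_pdf.
- move=> f bf h; apply/eqP; rewrite -subr_eq0 -normr_le0; apply/ler_addgt0Pl => e e0.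
  have [g [bg hg fg]] := h (e / 2) (divr_gt0 e0 (ltr0n _ 2)).
  rewrite addr0 (le_trans (ler_distD (\int[normal_prob m t]_x g x) _ _))// [leRHS]splitr lerD//.
    exact: (Rint_prob_dist (normal_prob m t) bf bg fg).
  rewrite {}hg -RintegralB//; [|exact: integrable_bm_normal_pdf..].
  have ifg := integrable_bm_normal_pdf m t (bmB bg bf).
  rewrite (_ : \int[leb]_x _ = \int[leb]_x ((g x - f x) * normal_pdf m t x)); last first.
    by apply: eq_Rintegral => x _; rewrite mulrBl.
  rewrite (le_trans (le_normr_Rintegral _ ifg))//.
  have -> : e / 2 = \int[leb]_x (e / 2 * normal_pdf m t x).
    rewrite RintegralZl//; last exact: integrable_normal_pdf.
    by rewrite /Rintegral integral_normal_pdf mulr1.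
  apply: le_Rintegral => //.
  + exact: integrable_norm ifg.
  + by apply: integrable_scale; exact: integrable_normal_pdf.
  + move=> x _; rewrite normrM (ger0_norm (normal_pdf_ge0 _ _ _)) distrC.
    by rewrite ler_wpM2r ?normal_pdf_ge0.
Qed.

End gaussian1.

Section standard_normal.
Context {R : realType}.
Notation leb := (@lebesgue_measure R).
Notation gamma := (@normal_prob R 0 1).
Notation TR := (measurableTypeR R).

Lemma measurable_idTR : measurable_fun [set: TR] (idfun : TR -> R).
Proof. exact: (@measurable_id _ TR setT). Qed.

HB.instance Definition _ := isMeasurableFun.Build _ _ TR R (idfun : TR -> R) measurable_idTR.

(** The standard normal law on the type R itself: normal_prob lives on a copy of R that
    is made for Lebesgue measure. *)
Definition stdn : probability R R := distribution gamma ((idfun : TR -> R) : {mfun TR >-> R}).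

Lemma stdnE (B : set R) : stdn B = normal_prob 0 1 B.
Proof. by []. Qed.

Lemma stdn_affine (m t : R) (B : set R) : t != 0 -> measurable B ->
  stdn ((fun y => m + t * y) @^-1` B) = normal_prob m t B.
Proof. by move=> t0 mB; rewrite -(normal_prob_affine m t0 mB). Qed.

Lemma Rint_stdn (f : R -> R) : bm f -> \int[stdn]_x f x = \int[leb]_x (f x * normal_pdf 0 1 x).
Proof.
move=> bf; rewrite -Rint_normal_prob//.
exact: (image_integral_bm (m1 := gamma) (phi := idfun : TR -> R) measurable_idTR _ (prob_fin _) bf).
Qed.

Lemma normal_pdf_swap (s t x u : R) : s ^+ 2 + t ^+ 2 = 1 -> t != 0 ->
  normal_pdf 0 1 x * normal_pdf (s * x) t u = normal_pdf 0 1 u * normal_pdf (s * u) t x.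
Proof.
move=> st t0; rewrite !normal_pdfE ?oner_eq0//.
rewrite mulrACA [RHS]mulrACA; congr (_ * _); rewrite /normal_fun -!expRD; congr expR.
have t2 : t ^+ 2 = 1 - s ^+ 2 by rewrite -st addrAC subrr add0r.
have s0 : 1 - s ^+ 2 != 0 by rewrite -t2 sqrf_eq0.
by rewrite !subr0 expr1n t2; field.
Qed.

Lemma measurable_normal_joint (s t : R) : t != 0 ->
  measurable_fun [set: TR * TR] (fun z : TR * TR => normal_pdf 0 1 z.1 * normal_pdf (s * z.1) t z.2 : R).
Proof.
move=> t0.
have h : measurable_fun [set: R * R] (fun z : R * R => normal_pdf 0 1 z.1 * normal_pdf (s * z.1) t z.2 : R).
  have -> : (fun z : R * R => normal_pdf 0 1 z.1 * normal_pdf (s * z.1) t z.2) =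
    (fun z : R * R => normal_pdf 0 1 z.1 *
      (normal_peak t * expR (- (z.2 - s * z.1) ^+ 2 / (t ^+ 2 *+ 2)))).
    by apply/funext => z; congr (_ * _); rewrite normal_pdfE.
  apply: measurable_funM.
    by apply: measurableT_comp => //; exact: measurable_normal_pdf.
  apply: measurable_funM => //; apply: measurableT_comp => //.
  apply: measurable_funM => //; apply: measurableT_comp => //.
  by apply: measurable_funX; apply: measurable_funB => //; apply: measurable_funM.
exact: h.
Qed.

(** The Gaussian law of the plane is invariant by rotations: the joint density of
    (x, s x + t y) is symmetric. *)
Lemma stdn_rotation (s t : R) (B : set R) : s ^+ 2 + t ^+ 2 = 1 -> t != 0 -> measurable B ->
  (\int[stdn]_x stdn ((fun y => (s * x + t * y)%R) @^-1` B) = stdn B)%E.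
Proof.
move=> st t0 mB.
have mG : measurable_fun setT (fun x => normal_prob (s * x) t B).
  have -> : (fun x => normal_prob (s * x) t B) =
      (fun x => stdn (xsection ((fun z : R * R => (s * z.1 + t * z.2)%R) @^-1` B) x)).
    by apply/funext => x; rewrite -stdn_affine// xsectionE.
  apply: measurable_fun_xsection.
  rewrite -[X in measurable X]setTI.
  have h : measurable_fun setT (fun z : R * R => s * z.1 + t * z.2).
    by apply: measurable_funD; apply: measurable_funM.
  exact: h.
have fG x : (fine (normal_prob (s * x) t B))%:E = normal_prob (s * x) t B.
  by rewrite fineK// fin_num_measure.
have bG : bm (fun x : R => fine (normal_prob (s * x) t B)).
  split; first exact: (measurableT_comp _ mG).
  exists 1 => x; rewrite ger0_norm ?fine_ge0// -lee_fin fG.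
  exact: probability_le1.
transitivity (\int[leb]_x (\int[leb]_(u in B) (normal_pdf 0 1 x * normal_pdf (s * x) t u)%:E))%E.
  under eq_integral => x _ do rewrite stdn_affine// -fG.
  rewrite (int_bm_fin (prob_fin _) bG) Rint_stdn//.
  have := integrable_bm_normal_pdf 0 1 (f := fun x : TR => fine (normal_prob (s * x) t B)) bG.
  move=> /integrable_fin_num/fineK; rewrite /Rintegral => -> //.
  apply: eq_integral => x _ /=.
  under eq_integral do rewrite EFinM.
  rewrite ge0_integralZl//.
  - by rewrite EFinM fG muleC.
  - exact: (measurable_funTS (measurable_normal_pdfE (s * x) t)).
  - by move=> u _; rewrite lee_fin normal_pdf_ge0.
  - by rewrite lee_fin normal_pdf_ge0.
under eq_integral do rewrite integral_mkcond.
pose F (z : TR * TR) := ((fun u => (normal_pdf 0 1 z.1 * normal_pdf (s * z.1) t u)%:E) \_ B) z.2.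
have F0 z : (0 <= F z)%E.
  by rewrite /F patchE; case: ifP => // _; rewrite lee_fin mulr_ge0 ?normal_pdf_ge0.
have mF : measurable_fun setT F.
  have -> : F = (fun z => (normal_pdf 0 1 z.1 * normal_pdf (s * z.1) t z.2 * \1_B z.2)%:E).
    apply/funext => z; rewrite /F patchE indicE; case: ifP => _; first by rewrite mulr1.
    by rewrite mulr0.
  apply/measurable_EFinP; apply: measurable_funM; first exact: measurable_normal_joint.
  have h : measurable_fun setT (\1_B \o snd : TR * TR -> R).
    apply: measurableT_comp; last exact: measurable_snd.
    exact: (measurable_indic (mB : measurable (B : set TR))).
  exact: h.
have := fubini_tonelli (m1 := leb) (m2 := leb) F mF F0.
rewrite /fubini_F/fubini_G => ->.
transitivity (\int[leb]_(u in B) (normal_pdf 0 1 u)%:E)%E; last by [].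
rewrite [RHS]integral_mkcond; apply: eq_integral => u _.
rewrite patchE /F; case: ifPn => uB; last first.
  by apply: integral0_eq => x _; rewrite /= patchE (negbTE uB).
under eq_integral => x _ do rewrite /= patchE uB normal_pdf_swap// EFinM.
rewrite ge0_integralZl//.
- by rewrite integral_normal_pdf mule1.
- exact: (measurable_normal_pdfE (s * u) t).
- by move=> x _; rewrite lee_fin normal_pdf_ge0.
- by rewrite lee_fin normal_pdf_ge0.
Qed.

Lemma measurable_lin2 (s t : R) : measurable_fun setT (fun z : R * R => s * z.1 + t * z.2).
Proof. by apply: measurable_funD; apply: measurable_funM. Qed.

Lemma stdn_rotation_integral (s t : R) (f : R -> R) : s ^+ 2 + t ^+ 2 = 1 -> bm f ->
  \int[stdn]_x \int[stdn]_y f (s * x + t * y) = \int[stdn]_z f z.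
Proof.
have main s' t' : s' ^+ 2 + t' ^+ 2 = 1 -> t' != 0 -> bm f ->
    \int[stdn]_x \int[stdn]_y f (s' * x + t' * y) = \int[stdn]_z f z.
  move=> st t0 bf; have mphi := measurable_lin2 s' t'.
  rewrite (@image_integral_bm _ _ _ _ _ (stdn \x stdn)%E stdn _ mphi _ f)//.
  - by rewrite Rint_prod//; exact: bm_comp bf.
  - move=> A mA; apply: (etrans (esym (stdn_rotation st t0 mA))); rewrite /= /product_measure1.
    by apply: eq_integral => x _ /=; rewrite xsectionE.
  - exact: (prob_fin (stdn \x stdn)%E).
move=> st bf; have [t0|t0] := eqVneq t 0; last exact: main.
(* when t = 0 the two variables are exchanged *)
have s0 : s != 0.
  by apply/negP => /eqP s0; move: st; rewrite s0 t0 expr0n addr0 => /eqP; rewrite eq_sym oner_eq0.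
have ts : t ^+ 2 + s ^+ 2 = 1 by rewrite addrC.
rewrite -(main t s ts s0 bf).
have bF : bm (fun z : R * R => f (s * z.1 + t * z.2)).
  exact: (bm_comp (measurable_lin2 s t) bf).
rewrite [LHS](Rint_swap stdn stdn bF).
by apply: eq_Rintegral => x _; apply: eq_Rintegral => y _ /=; rewrite addrC.
Qed.

Lemma stdn_stable (s t : R) (f : R -> R) : bm f ->
  \int[stdn]_x \int[stdn]_y f (s * x + t * y) = \int[stdn]_z f (Num.sqrt (s ^+ 2 + t ^+ 2) * z).
Proof.
move=> bf; set r := Num.sqrt _.
have [r0|r0] := eqVneq r 0.
  move/eqP: r0; rewrite sqrtr_eq0 => r0.
  have {}r0 : s ^+ 2 + t ^+ 2 == 0 by rewrite eq_le r0 addr_ge0 ?sqr_ge0.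
  move: r0; rewrite paddr_eq0 ?sqr_ge0// !sqrf_eq0 => /andP[/eqP s0 /eqP t0].
  rewrite /r s0 t0 expr0n addr0 sqrtr0.
  under eq_Rintegral => x _ do under eq_Rintegral => y _ do rewrite !mul0r addr0.
  under [RHS]eq_Rintegral => x _ do rewrite mul0r.
  by rewrite !Rint_prob_cst.
have r2 : r ^+ 2 = s ^+ 2 + t ^+ 2 by rewrite sqr_sqrtr// addr_ge0 ?sqr_ge0.
have st : (s / r) ^+ 2 + (t / r) ^+ 2 = 1.
  by rewrite !expr_div_n -mulrDl -r2 divff// sqrf_eq0.
rewrite -(stdn_rotation_integral (f := fun z => f (r * z)) st); last first.
  by apply: (bm_comp _ bf); exact: measurable_funM.
apply: eq_Rintegral => x _; apply: eq_Rintegral => y _; congr f.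
by field.
Qed.

Lemma stdn_opp (B : set R) : measurable B -> stdn B = stdn (-%R @^-1` B).
Proof.
move=> mB; have n1 : (-1 : R) != 0 by rewrite oppr_eq0 oner_eq0.
rewrite (_ : -%R @^-1` B = (fun y : R => 0 + -1 * y) @^-1` B); last first.
  by apply/funext => y /=; rewrite add0r mulN1r.
rewrite (stdn_affine 0 n1 mB) stdnE /normal_prob; apply: eq_integral => x _.
by rewrite !normal_pdfE ?oner_eq0// /normal_peak /normal_fun sqrrN.
Qed.

(** With x = 3 z^2 / 8, the ratio of the two densities is a multiple of exp (- x),
    and z^4 = 64 x^2 / 9 is at most 128/9 exp x. *)
Lemma fourth_power_normal_bound (z : R) :
  z ^+ 4 * normal_pdf 0 1 z <= (128 / 9 * (normal_peak 1 / normal_peak 2)) * normal_pdf 0 2 z.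
Proof.
have p2 : 0 < normal_peak (2:R) by rewrite normal_peak_gt0// pnatr_eq0.
have p1 : 0 < normal_peak (1:R) by rewrite normal_peak_gt0// oner_eq0.
rewrite !normal_pdfE ?oner_eq0 ?pnatr_eq0// /normal_fun !subr0.
set a := expR _; set b := expR _.
have -> : z ^+ 4 * (normal_peak 1 * a) = normal_peak 1 * (z ^+ 4 * a) by ring.
have -> : 128 / 9 * (normal_peak 1 / normal_peak 2) * (normal_peak 2 * b) =
    normal_peak 1 * (128 / 9 * b) by field; rewrite gt_eqF.
rewrite ler_pM2l//.
have x0 : 0 <= 3 / 8 * z ^+ 2 by rewrite mulr_ge0// sqr_ge0.
have := expR_ge1Dxn 1 x0; set x := 3 / 8 * z ^+ 2 => h.
have ab : b = a * expR x.
  by rewrite /a /b /x -expRD; congr expR; field.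
rewrite ab mulrCA mulrC ler_pM2l ?expR_gt0//.
have -> : z ^+ 4 = 64 / 9 * x ^+ 2 by rewrite /x; field.
have f2 : (2`!)%:R = 2 :> R by [].
by rewrite f2 in h; lra.
Qed.

Lemma stdn_fourth_moment : stdn.-integrable setT (EFin \o (fun z : R => z ^+ 4)).
Proof.
have mz : measurable_fun setT (fun z : R => z ^+ 4) by exact: measurable_funX.
have z0 (z : R) : 0 <= z ^+ 4 by rewrite exprn_even_ge0.
apply/integrableP; split; first exact/measurable_EFinP.
pose C : R := 128 / 9 * (normal_peak 1 / normal_peak 2).
apply: (@le_lt_trans _ _ C%:E); last exact: ltry.
under eq_integral do rewrite /= ger0_norm//.
apply: integral_truncation_bound => // n.
have bn : bm (fun z : R => Num.min (z ^+ 4) n%:R).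
  split; first exact: measurable_minr.
  by exists n%:R => x; rewrite ger0_norm ?ge_min ?lexx ?orbT// le_min z0/=.
rewrite (int_bm_fin (prob_fin _) bn) lee_fin Rint_stdn//.
have -> : C = \int[leb]_x (C * normal_pdf 0 2 x).
  rewrite RintegralZl//; last exact: integrable_normal_pdf.
  by rewrite /Rintegral integral_normal_pdf mulr1.
apply: le_Rintegral => //.
- exact: (integrable_bm_normal_pdf 0 1 (f := fun z : TR => Num.min (z ^+ 4) n%:R) bn).
- by apply: integrable_scale; exact: integrable_normal_pdf.
- move=> x _; apply: le_trans (fourth_power_normal_bound x).
  by rewrite ler_wpM2r ?normal_pdf_ge0// ge_min lexx.
Qed.

Lemma stdn_moments k : (k <= 4)%N -> stdn.-integrable setT (EFin \o (fun z : R => `|z| ^+ k)).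
Proof.
move=> k4; apply: (@integrable_dom _ _ _ _ _ (fun z : R => 1 + z ^+ 4)).
- by apply: measurable_funX; exact: normr_measurable.
- apply: integrable_addr; last exact: stdn_fourth_moment.
  exact: (bm_integrable (prob_fin _) (bm_cst 1)).
- move=> z; rewrite normrX normr_id.
  have -> : z ^+ 4 = `|z| ^+ 4 by rewrite -normrX ger0_norm// exprn_even_ge0.
  exact: exprn_le_add1.
Qed.

Lemma stdn_mean : \int[stdn]_z z = 0.
Proof.
have i1 : stdn.-integrable setT (EFin \o (fun z : R => z)).
  by apply: (integrable_dom _ (@stdn_moments 1 isT)) => // x; rewrite expr1.
have h : \int[stdn]_z z = \int[stdn]_z (- z).
  have mN : measurable_fun setT (-%R : R -> R) by exact: oppr_measurable.
  apply: (image_integral mN stdn_opp) => //.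
  rewrite (_ : EFin \o _ = EFin \o (fun x : R => -1 * x)); first exact: integrable_scale.
  by apply/funext => x /=; rewrite mulN1r.
have {}h : \int[stdn]_z z = - \int[stdn]_z z.
  rewrite {1}h; under eq_Rintegral do rewrite -mulN1r.
  by rewrite RintegralZl// mulN1r.
lra.
Qed.

Lemma bm_exp_sqr (t : R) : 0 <= t -> bm (fun z : R => expR (- (t * z ^+ 2))).
Proof.
move=> t0; apply: bm_itv01 => [|x].
  by do 2 apply: measurableT_comp => //; exact: measurable_funM.
by rewrite expR_ge0/= -expR0 ler_expR oppr_le0 mulr_ge0// sqr_ge0.
Qed.

Lemma stdn_exp_sqr (sigma t : R) : 0 < sigma -> 0 <= t -> 1 + 2 * t = (sigma ^+ 2)^-1 ->
  \int[stdn]_z expR (- (t * z ^+ 2)) = sigma.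
Proof.
move=> s0 t0 ts; rewrite Rint_stdn; last exact: bm_exp_sqr.
transitivity (\int[leb]_x (sigma * normal_pdf 0 sigma x)); last first.
  rewrite RintegralZl//; last exact: integrable_normal_pdf.
  by rewrite /Rintegral integral_normal_pdf mulr1.
apply: eq_Rintegral => x _.
rewrite !normal_pdfE ?oner_eq0 ?gt_eqF// /normal_peak /normal_fun !subr0 expr1n.
rewrite mulrCA -expRD [RHS]mulrA; congr (_ * _).
  rewrite mul1r -mulrnAr sqrtrM ?sqr_ge0// sqrtr_sqr gtr0_norm//.
  by rewrite invfM mulrA divff ?mul1r// gt_eqF.
congr expR; have -> : t = ((sigma ^+ 2)^-1 - 1) / 2 by rewrite -ts; field.
by field; rewrite gt_eqF.
Qed.

Lemma expRN_taylor2 (u : R) : 0 <= u -> 0 <= expR (- u) - 1 + u <= u ^+ 2.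
Proof.
move=> u0; have h1 := expR_ge1Dx (- u); have h2 := expR_ge1Dx u.
have e0 := expR_gt0 (- u).
have e1 : expR (- u) * expR u = 1 by rewrite mulrC expRxMexpNx_1.
apply/andP; split; first lra.
have : expR (- u) * (1 + u) <= 1 by rewrite -[leRHS]e1 ler_pM2l.
nra.
Qed.

(** Both sides of the identity E exp(- t Z^2) = (1 + 2 t)^(-1/2), which holds by
    scaling the density, are expanded at t = 0. *)
Lemma stdn_variance : \int[stdn]_z (z ^+ 2) = 1.
Proof.
have i4 := stdn_fourth_moment.
have i2 : stdn.-integrable setT (EFin \o (fun z : R => z ^+ 2)).
  apply: (integrable_dom _ (@stdn_moments 2 isT)); first exact: measurable_funX.
  by move=> x; rewrite normrX.
set m2 := \int[stdn]_z (z ^+ 2); set m4 := \int[stdn]_z (z ^+ 4).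
have m20 : 0 <= m2 by apply: Rintegral_ge0 => x _; exact: sqr_ge0.
have m40 : 0 <= m4 by apply: Rintegral_ge0 => x _; rewrite exprn_even_ge0.
(* s is the value of the expectation for a small t > 0; dividing by t gives the
   variance up to an error of order t *)
have key s : 2^-1 < s < 1 -> `|2 * s ^+ 2 - (1 + s) * m2| <= 8 * (1 - s) * m4.
  move=> /andP[s2 s1]; have s0 : 0 < s by lra.
  have s20 : 0 < s ^+ 2 by rewrite exprn_gt0.
  pose t := (1 - s ^+ 2) / (2 * s ^+ 2).
  have t0 : 0 <= t by rewrite /t divr_ge0//; nra.
  have ts : 1 + 2 * t = (s ^+ 2)^-1 by rewrite /t; field; rewrite gt_eqF.
  have iE := bm_integrable (prob_fin stdn) (bm_exp_sqr t0).
  have i1 := bm_integrable (prob_fin stdn) (bm_cst (1:R)).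
  have i3 := integrable_addr (integrable_addr iE (integrable_scale (-1) i1)) (integrable_scale t i2).
  have e3 : \int[stdn]_z (expR (- (t * z ^+ 2)) + -1 * 1 + t * z ^+ 2) = s - 1 + t * m2.
    rewrite RintegralD//; last exact: integrable_scale.
      rewrite RintegralD//; last exact: (integrable_scale (-1) i1).
      by rewrite (stdn_exp_sqr s0 t0 ts) Rint_prob_cst RintegralZl// mulr1.
    exact: (integrable_addr iE (integrable_scale (-1) i1)).
  have l3 : 0 <= s - 1 + t * m2.
    rewrite -e3; apply: Rintegral_ge0 => z _.
    have /expRN_taylor2/andP[h _] : 0 <= t * z ^+ 2 by rewrite mulr_ge0// sqr_ge0.
    by rewrite mulN1r.
  have u3 : s - 1 + t * m2 <= t ^+ 2 * m4.
    rewrite -e3 -RintegralZl//; apply: le_Rintegral => //; first exact: integrable_scale.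
    move=> z _; have /expRN_taylor2/andP[_] : 0 <= t * z ^+ 2 by rewrite mulr_ge0// sqr_ge0.
    by rewrite mulN1r exprMn -exprM.
  have tE : t * s ^+ 2 * 2 = 1 - s ^+ 2 by rewrite /t; field; rewrite gt_eqF.
  have a1 : (1 - s) * (2 * s ^+ 2 - (1 + s) * m2) = - (2 * s ^+ 2) * (s - 1 + t * m2).
    have -> : - (2 * s ^+ 2) * (s - 1 + t * m2) = - (2 * s ^+ 2 * (s - 1)) - (t * s ^+ 2 * 2) * m2 by ring.
    by rewrite tE; ring.
  have d0 : 0 < 1 - s by lra.
  rewrite -(ler_pM2l d0) -{1}(gtr0_norm d0) -normrM a1 normrM normrN (ger0_norm l3) gtr0_norm; last by lra.
  apply: (@le_trans _ _ (2 * s ^+ 2 * (t ^+ 2 * m4))); first by rewrite ler_pM2l// mulr_gt0.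
  rewrite [leRHS](_ : _ = (8 * (1 - s) ^+ 2) * m4); last by ring.
  rewrite mulrA ler_wpM2r//.
  have t8 : t = (1 - s) * ((1 + s) / (2 * s ^+ 2)) by rewrite /t; field; rewrite gt_eqF.
  rewrite (_ : 2 * s ^+ 2 * t ^+ 2 = (1 - s) ^+ 2 * ((1 + s) ^+ 2 / (2 * s ^+ 2))); last first.
    by rewrite t8; field; rewrite gt_eqF.
  rewrite [leRHS]mulrC ler_pM2l ?exprn_gt0// ler_pdivrMr ?mulr_gt0//.
  nra.
apply/eqP; rewrite -subr_eq0 -normr_le0; apply/ler_addgt0Pl => e e0; rewrite addr0.
pose B := 4 + m2 + 8 * m4.
have B0 : 0 < B by rewrite /B; lra.
pose dl := Num.min 4^-1 (e / B).
have dl0 : 0 < dl by rewrite lt_min divr_gt0// invr_gt0 ltr0n.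
have dl4 : dl <= 4^-1 by rewrite ge_min lexx.
have dle : dl * B <= e by rewrite -ler_pdivlMr// ge_min lexx orbT.
have /key : 2^-1 < 1 - dl < 1 by apply/andP; split; lra.
move: dle; rewrite /B; clearbody dl m2 m4.
rewrite !ler_norml => dle /andP[h1 h2]; apply/andP; split; nra.
Qed.

End standard_normal.

(** * Gaussian vectors *)

Section two_images.
Context {d1 d2 d3} {T1 : measurableType d1} {T2 : measurableType d2} {T : measurableType d3}.
Context {R : realType}.
Variables (m1 : {measure set T1 -> \bar R}) (m2 : {measure set T2 -> \bar R}).
Variables (phi1 : T1 -> T) (phi2 : T2 -> T).
Hypotheses (mphi1 : measurable_fun setT phi1) (mphi2 : measurable_fun setT phi2).
Hypothesis m12 : forall A, measurable A -> m1 (phi1 @^-1` A) = m2 (phi2 @^-1` A).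

Let m := measure_function_pushforward__canonical__measure_function_Measure m1 mphi1.

Lemma same_image_integral (f : T -> R) : measurable_fun setT f ->
  m1.-integrable setT (EFin \o (f \o phi1)) -> m2.-integrable setT (EFin \o (f \o phi2)) ->
  \int[m1]_x f (phi1 x) = \int[m2]_x f (phi2 x).
Proof.
move=> mf i1 i2.
rewrite -(@image_integral _ _ _ _ _ m1 m phi1 mphi1 _ f)//.
by rewrite -(@image_integral _ _ _ _ _ m2 m phi2 mphi2 _ f)// => A mA; exact: m12.
Qed.

Lemma same_image_integrable (f : T -> R) : measurable_fun setT f ->
  m2.-integrable setT (EFin \o (f \o phi2)) -> m1.-integrable setT (EFin \o (f \o phi1)).
Proof.
move=> mf i2.
have : m.-integrable setT (EFin \o f).
  by apply: (@image_integrable _ _ _ _ _ m2 m phi2 mphi2 _ f) => // A mA; exact: m12.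
move=> /integrableP[_ h]; apply/integrableP; split.
  by apply/measurable_EFinP; exact: measurableT_comp.
rewrite (_ : (\int[m1]_x _ = \int[m]_x `|(EFin \o f) x|)%E)//.
rewrite (@image_ge0_integral _ _ _ _ _ m1 m phi1 mphi1 _ (fun y => `|(f y)%:E|)%E)//.
by do 2 apply: measurableT_comp => //; exact/measurable_EFinP.
Qed.

End two_images.

Section gaussian_vectors.
Context {R : realType} {d : nat}.
Notation V := 'rV[R]_d.
Implicit Types (v x t : V) (vs : seq V).

Definition gauss_step v (zx : R * V) : V := zx.1 *: v + zx.2.

Lemma measurable_gauss_step v : measurable_fun setT (gauss_step v).
Proof.
apply: measurable_addrV; last exact: measurable_snd.
by apply: measurable_scalerV; [exact: measurable_fst|exact: measurable_cst].
Qed.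

HB.instance Definition _ v :=
  isMeasurableFun.Build _ _ (R * V)%type V (gauss_step v) (measurable_gauss_step v).

(** The law of the sum of the Z_j v_j, with the Z_j independent and standard
    normal. *)
Fixpoint gaussv vs : probability V R :=
  if vs is v :: vs' then distribution (stdn \x gaussv vs')%E (gauss_step v) else \d_(0 : V).

Lemma gaussv_nil (f : V -> R) : bm f -> \int[gaussv [::]]_x f x = f 0.
Proof.
move=> bf; rewrite /Rintegral /= integral_dirac//.
  by rewrite diracT mul1e.
by apply/measurable_EFinP; exact: bf.1.
Qed.

Lemma bm_gauss_step v (f : V -> R) : bm f -> bm (fun zx : R * V => f (zx.1 *: v + zx.2)).
Proof. exact: (bm_comp (measurable_gauss_step v)). Qed.

Lemma gaussv_cons v vs (f : V -> R) : bm f ->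
  \int[gaussv (v :: vs)]_x f x = \int[stdn]_z \int[gaussv vs]_x f (z *: v + x).
Proof.
move=> bf.
rewrite (@image_integral_bm _ _ _ _ _ (stdn \x gaussv vs)%E _ _ (measurable_gauss_step v) _ f)//.
  by rewrite Rint_prod//; exact: bm_gauss_step.
exact: (prob_fin (stdn \x gaussv vs)%E).
Qed.

Lemma measurable_lin2V (s t : R) : measurable_fun setT (fun z : V * V => s *: z.1 + t *: z.2).
Proof.
by apply: measurable_addrV; apply: measurable_scalerV; try exact: measurable_cst;
  [exact: measurable_fst|exact: measurable_snd].
Qed.

(** Stability under sums of independent copies: after exchanging the integrals, it is
    the one-dimensional stability along each of the directions v. *)
Lemma gaussv_stable vs (s t : R) (f : V -> R) : bm f ->
  \int[gaussv vs]_x \int[gaussv vs]_y f (s *: x + t *: y) =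
  \int[gaussv vs]_z f (Num.sqrt (s ^+ 2 + t ^+ 2) *: z).
Proof.
set r := Num.sqrt _.
have mr : measurable_fun setT (fun z : V => r *: z).
  by apply: measurable_scalerV; [exact: measurable_cst|exact: measurable_id].
elim: vs f => [|v vs IH] f bf.
  have bF : bm (fun z : V * V => f (s *: z.1 + t *: z.2)).
    exact: (bm_comp (measurable_lin2V s t) bf).
  have bG := bm_param (gaussv [::]) bF.
  rewrite [LHS](gaussv_nil bG) [LHS](gaussv_nil (bm_pair1 (0 : V) bF)) gaussv_nil; last exact: bm_comp bf.
  by rewrite !scaler0 addr0.
have bF : bm (fun z : V * V => f (s *: z.1 + t *: z.2)).
  exact: (bm_comp (measurable_lin2V s t) bf).
have bG := bm_param (gaussv (v :: vs)) bF.
rewrite [LHS](gaussv_cons v vs bG) [RHS]gaussv_cons; last exact: bm_comp bf.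
under eq_Rintegral => z _ do under eq_Rintegral => x _ do
  rewrite (gaussv_cons v vs (bm_pair1 (z *: v + x) bF))/=.
pose f4 (z : R) (x : V) (z' : R) (x' : V) := f ((s * z + t * z') *: v + (s *: x + t *: x')).
transitivity (\int[stdn]_z \int[gaussv vs]_x \int[stdn]_z' \int[gaussv vs]_x' f4 z x z' x').
  apply: eq_Rintegral => z _; apply: eq_Rintegral => x _.
  apply: eq_Rintegral => z' _; apply: eq_Rintegral => x' _; congr f.
  by rewrite !scalerDr !scalerA scalerDl addrACA.
have b4 z : bm (fun p : V * R * V => f4 z p.1.1 p.1.2 p.2).
  apply: (bm_comp _ bf); apply: measurable_addrV.
    apply: measurable_scalerV; last exact: measurable_cst.
    apply: measurable_funD => //; apply: measurable_funM => //.
    by apply: (measurableT_comp measurable_snd); exact: measurable_fst.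
  apply: measurable_addrV; apply: measurable_scalerV; try exact: measurable_cst.
    by apply: (measurableT_comp measurable_fst); exact: measurable_fst.
  exact: measurable_snd.
transitivity (\int[stdn]_z \int[stdn]_z' \int[gaussv vs]_x \int[gaussv vs]_x' f4 z x z' x').
  apply: eq_Rintegral => z _.
  exact: (Rint_swap (gaussv vs) stdn (bm_param (gaussv vs) (b4 z))).
transitivity (\int[stdn]_z \int[stdn]_z' \int[gaussv vs]_x f ((s * z + t * z') *: v + r *: x)).
  apply: eq_Rintegral => z _; apply: eq_Rintegral => z' _.
  rewrite -(IH (fun y => f ((s * z + t * z') *: v + y)))//.
  apply: (bm_comp _ bf); apply: measurable_addrV; first exact: measurable_cst.
  exact: measurable_id.
have bh : bm (fun u : R => \int[gaussv vs]_x f (u *: v + r *: x)).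
  apply: (bm_param (gaussv vs) (F := fun p : R * V => f (p.1 *: v + r *: p.2))).
  apply: (bm_comp _ bf); apply: measurable_addrV; apply: measurable_scalerV;
    by [exact: measurable_cst|exact: measurable_fst|exact: measurable_snd].
rewrite (stdn_stable s t bh); apply: eq_Rintegral => z _; apply: eq_Rintegral => x _.
by rewrite -/r scalerDr scalerA.
Qed.

Lemma dotrvE t x : dotrv t x = \sum_i t ord0 i * x ord0 i.
Proof. by rewrite /dotrv mxE; apply: eq_bigr => i _; rewrite mxE. Qed.

Lemma dotrvDr t x y : dotrv t (x + y) = dotrv t x + dotrv t y.
Proof.
by rewrite !dotrvE -big_split/=; apply: eq_bigr => i _; rewrite mxE mulrDr.
Qed.

Lemma dotrvZr t c x : dotrv t (c *: x) = c * dotrv t x.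
Proof.
by rewrite !dotrvE mulr_sumr; apply: eq_bigr => i _; rewrite mxE mulrCA.
Qed.

Lemma measurable_dotrv t : measurable_fun setT (dotrv t).
Proof.
rewrite (_ : dotrv t = (fun x => \sum_i t ord0 i * x ord0 i)); last first.
  by apply/funext => x; exact: dotrvE.
by apply: measurable_sum => i; apply: measurable_funM => //; exact: measurable_coord.
Qed.

(** The variance of the linear form t under gaussv vs. *)
Definition sqform vs t : R := \sum_(v <- vs) dotrv t v ^+ 2.

Lemma sqform_ge0 vs t : 0 <= sqform vs t.
Proof. by apply: sumr_ge0 => v _; exact: sqr_ge0. Qed.

Lemma measurable_mulr (c : R) : measurable_fun [set: R] (fun z : R => c * z).
Proof. exact: measurable_funM. Qed.

(** A linear form of the vector is a sum of independent centred normal variables,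
    which are merged one at a time by stability. *)
Lemma gaussv_linear_form_bm vs t (f : R -> R) : bm f ->
  \int[gaussv vs]_x f (dotrv t x) = \int[stdn]_z f (Num.sqrt (sqform vs t) * z).
Proof.
elim: vs f => [|v vs IH] f bf; have bft := bm_comp (measurable_dotrv t) bf.
  rewrite gaussv_nil// /sqform big_nil sqrtr0 dotrvE big1; last first.
    by move=> i _; rewrite mxE mulr0.
  by under eq_Rintegral => z _ do rewrite mul0r; rewrite Rint_prob_cst.
rewrite gaussv_cons//.
transitivity (\int[stdn]_z \int[stdn]_y f (dotrv t v * z + Num.sqrt (sqform vs t) * y)).
  apply: eq_Rintegral => z _.
  rewrite -(IH (fun u => f (dotrv t v * z + u))); last first.
    by apply: (bm_comp _ bf); exact: measurable_funD.
  by apply: eq_Rintegral => x _; rewrite dotrvDr dotrvZr mulrC.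
rewrite stdn_stable// sqr_sqrtr ?sqform_ge0//.
by rewrite /sqform big_cons.
Qed.

Lemma gaussv_linear_form vs t (B : set R) : measurable B ->
  gaussv vs (dotrv t @^-1` B) = stdn ((fun z => Num.sqrt (sqform vs t) * z) @^-1` B).
Proof.
move=> mB.
have m1 : measurable (dotrv t @^-1` B) by rewrite -[X in measurable X]setTI; exact: measurable_dotrv.
have m2 : measurable ((fun z => Num.sqrt (sqform vs t) * z) @^-1` B).
  by rewrite -[X in measurable X]setTI; exact: measurable_mulr.
rewrite -[LHS]fineK ?fin_num_measure// -[RHS]fineK ?fin_num_measure//; congr EFin.
rewrite -!Rint_indic//; exact: (gaussv_linear_form_bm vs t (bm_indic mB)).
Qed.

Lemma gaussv_is_gaussian vs (K : 'M[R]_d) :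
  (forall t, dotrv (t *m K) t = sqform vs t) -> is_gaussian (gaussv vs) 0 K.
Proof.
move=> KE t B mB; rewrite KE /normal_law gaussv_linear_form//.
have -> : dotrv t 0 = 0 by rewrite dotrvE big1// => i _; rewrite mxE mulr0.
case: ifPn => [/eqP ->|c0].
  rewrite (_ : _ @^-1` B = if 0 \in B then setT else set0); last first.
    apply/seteqP; split=> z /=; rewrite mul0r; case: ifPn; rewrite ?inE//.
      by rewrite notin_setE.
  rewrite diracE; case: ifP => _; first exact: probability_setT.
  exact: measure0.
rewrite -stdn_affine//; congr (stdn _).
by apply/funext => z /=; rewrite add0r.
Qed.

Lemma gaussv_linear_form_integral vs t (f : R -> R) : measurable_fun setT f ->
  stdn.-integrable setT (EFin \o (fun z => f (Num.sqrt (sqform vs t) * z))) ->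
  (gaussv vs).-integrable setT (EFin \o (fun x => f (dotrv t x))) /\
  \int[gaussv vs]_x f (dotrv t x) = \int[stdn]_z f (Num.sqrt (sqform vs t) * z).
Proof.
move=> mf fi; have H B mB := gaussv_linear_form vs t (B := B) mB.
have i1 := same_image_integrable (measurable_dotrv t) (measurable_mulr _) H mf fi.
split; first exact: i1.
exact: (same_image_integral (measurable_dotrv t) (measurable_mulr _) H mf i1 fi).
Qed.

Lemma gaussv_mean vs t : (gaussv vs).-integrable setT (EFin \o dotrv t) /\
  \int[gaussv vs]_x dotrv t x = 0.
Proof.
have i1 : stdn.-integrable setT (EFin \o (fun z : R => z)).
  by apply: (integrable_dom _ (@stdn_moments _ 1 isT)) => // x; rewrite expr1.
have [|h1 h2] := @gaussv_linear_form_integral vs t id (@measurable_id _ _ _).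
  exact: integrable_scale.
by split => //; rewrite h2 RintegralZl// stdn_mean mulr0.
Qed.

Lemma gaussv_second_moment vs t :
  (gaussv vs).-integrable setT (EFin \o (fun x => dotrv t x ^+ 2)) /\
  \int[gaussv vs]_x (dotrv t x ^+ 2) = sqform vs t.
Proof.
have i2 : stdn.-integrable setT (EFin \o (fun z : R => z ^+ 2)).
  apply: (integrable_dom _ (@stdn_moments _ 2 isT)); first exact: measurable_funX.
  by move=> x; rewrite normrX.
have e z : (Num.sqrt (sqform vs t) * z) ^+ 2 = sqform vs t * z ^+ 2.
  by rewrite exprMn sqr_sqrtr// sqform_ge0.
have [| |h1 h2] := @gaussv_linear_form_integral vs t (fun u => u ^+ 2).
- exact: measurable_funX.
- rewrite (_ : EFin \o _ = EFin \o (fun z => sqform vs t * z ^+ 2)).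
    exact: integrable_scale.
  by apply/funext => z /=; rewrite e.
split => //; rewrite h2; under eq_Rintegral => z _ do rewrite e.
by rewrite RintegralZl// stdn_variance mulr1.
Qed.

Lemma gaussv_third_moment vs t :
  (gaussv vs).-integrable setT (EFin \o (fun x => `|dotrv t x| ^+ 3)).
Proof.
have [| |//] := @gaussv_linear_form_integral vs t (fun u => `|u| ^+ 3).
- by apply: measurable_funX; exact: normr_measurable.
- rewrite (_ : EFin \o _ = EFin \o (fun z => `|Num.sqrt (sqform vs t)| ^+ 3 * `|z| ^+ 3)).
    by apply: integrable_scale; exact: stdn_moments.
  by apply/funext => z /=; rewrite normrM exprMn.
Qed.

End gaussian_vectors.

(** * Moments of random vectors *)

Section vector_moments.
Context {R : realType} {d : nat} {dO : measure_display} {O : measurableType dO}.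
Notation V := 'rV[R]_d.

(** The moment information about a random vector that the Lindeberg comparison
    uses; the third moment bounds the remainders of second-order expansions. *)
Record moments (Q : probability O R) (X : O -> V) (a : 'I_d -> R) (b : 'I_d -> 'I_d -> R) (k3 : R)
    : Prop := Moments {
  mom_meas : measurable_fun setT X ;
  mom_int1 : forall i, Q.-integrable setT (EFin \o (fun w => X w ord0 i)) ;
  mom_int2 : forall i j, Q.-integrable setT (EFin \o (fun w => X w ord0 i * X w ord0 j)) ;
  mom_int3 : Q.-integrable setT (EFin \o (fun w => `|X w| ^+ 3)) ;
  mom_1 : forall i, \int[Q]_w (X w ord0 i) = a i ;
  mom_2 : forall i j, \int[Q]_w (X w ord0 i * X w ord0 j) = b i j ;
  mom_3 : \int[Q]_w (`|X w| ^+ 3) <= k3 }.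

Lemma norm_cube_le (x : V) : `|x| ^+ 3 <= \sum_i `|x ord0 i| ^+ 3.
Proof.
have [->|x0] := eqVneq x 0.
  by rewrite normr0 expr0n/=; apply: sumr_ge0 => i _; rewrite exprn_ge0.
have [[j i] /= ji] : exists i, mx_norm x = `|x i.1 i.2| by apply: mx_norm_neq0; apply: contra_neq x0 => /mx_norm_eq0.
have -> : `|x| = `|x ord0 i| by move: ji; rewrite (ord1 j).
by rewrite (bigD1 i)//= lerDl sumr_ge0// => k _; rewrite exprn_ge0.
Qed.

Lemma moments_of_third (Q : probability O R) (X : O -> V) : measurable_fun setT X ->
  (forall i, Q.-integrable setT (EFin \o (fun w => `|X w ord0 i| ^+ 3))) ->
  moments Q X (fun i => \int[Q]_w (X w ord0 i))
    (fun i j => \int[Q]_w (X w ord0 i * X w ord0 j)) (\int[Q]_w (`|X w| ^+ 3)).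
Proof.
move=> mX i3.
have mXi i : measurable_fun setT (fun w => X w ord0 i) by exact: (measurableT_comp (measurable_coord i) mX).
have i0 := bm_integrable (prob_fin Q) (bm_cst (1:R)).
have i13 i := integrable_addr i0 (i3 i).
split => //.
- by move=> i; apply: (integrable_dom _ (i13 i)) => // w; exact: (@exprn_le_add1 R _ 1 3 (normr_ge0 _) isT).
- move=> i j; apply: (integrable_dom _ (integrable_addr (i13 i) (i13 j))).
    exact: measurable_funM.
  move=> w; rewrite normrM /=.
  set u := `|X w ord0 i|; set v := `|X w ord0 j|.
  have u0 : 0 <= u by exact: normr_ge0.
  have v0 : 0 <= v by exact: normr_ge0.
  have key (y : R) : 0 <= y -> y ^+ 2 <= 1 + y ^+ 3 by move=> y0; exact: exprn_le_add1.
  by have := key u u0; have := key v v0; nra.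
- have mn : measurable_fun setT (fun w => `|X w|) by exact: (measurableT_comp measurable_norm_rV mX).
  apply: (integrable_dom _ (integrable_sumr (index_enum 'I_d) i3)); first exact: measurable_funX.
  by move=> w; rewrite ger0_norm ?exprn_ge0//; exact: norm_cube_le.
Qed.

Lemma moments_norm (Q : probability O R) (X : O -> V) a b k3 : moments Q X a b k3 ->
  Q.-integrable setT (EFin \o (fun w => `|X w|)) /\ \int[Q]_w `|X w| <= 1 + k3.
Proof.
move=> [mX _ _ i3 _ _ e3].
have ic := bm_integrable (prob_fin Q) (bm_cst (1 : R)).
have i13 := integrable_addr ic i3.
have h w : `|X w| <= 1 + `|X w| ^+ 3 by have := @exprn_le_add1 R `|X w| 1 3 (normr_ge0 _) isT.
have i1 : Q.-integrable setT (EFin \o (fun w => `|X w|)).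
  apply: (integrable_dom _ i13); first exact: (measurableT_comp measurable_norm_rV mX).
  by move=> w; rewrite normr_id.
split => //; apply: (@le_trans _ _ (\int[Q]_w (1 + `|X w| ^+ 3))).
  exact: le_Rintegral.
by rewrite (RintegralD measurableT ic i3) Rint_prob_cst lerD2l.
Qed.

End vector_moments.

(** * Factorization of covariance matrices *)

Section gram_decomposition.
Context {R : realType} {d : nat}.
Notation V := 'rV[R]_d.
Implicit Types (K : 'M[R]_d) (s t v : V).

Definition bil K s t : R := (s *m K *m t^T) ord0 ord0.

Lemma bilDl K s s' t : bil K (s + s') t = bil K s t + bil K s' t.
Proof. by rewrite /bil !mulmxDl mxE. Qed.

Lemma bilZl K c s t : bil K (c *: s) t = c * bil K s t.
Proof. by rewrite /bil -!scalemxAl mxE. Qed.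

Lemma bil_sym K s t : K^T = K -> bil K s t = bil K t s.
Proof.
move=> KT; rewrite /bil -[in LHS](trmxK (s *m K *m t^T)) mxE.
by rewrite trmx_mul trmxK trmx_mul KT mulmxA.
Qed.

Lemma bil_delta K i t : bil K (delta_mx ord0 i) t = dotrv (row i K) t.
Proof. by rewrite /bil -rowE. Qed.

Lemma bil_delta2 K i j : bil K (delta_mx ord0 i) (delta_mx ord0 j) = K i j.
Proof.
rewrite bil_delta dotrvE (bigD1 j)//= !mxE !eqxx/= mulr1 big1 ?addr0// => k kj.
by rewrite !mxE (negbTE kj) andbF mulr0.
Qed.

Lemma dotrvC s t : dotrv s t = dotrv t s.
Proof. by rewrite !dotrvE; apply: eq_bigr => i _; rewrite mulrC. Qed.

Lemma bil_gram v s t : bil (v^T *m v) s t = dotrv s v * dotrv t v.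
Proof.
rewrite /bil mulmxA -mulmxA mxE big_ord1; congr (_ * _); exact: dotrvC.
Qed.

Lemma bilB K K' s t : bil (K - K') s t = bil K s t - bil K' s t.
Proof. by rewrite /bil mulmxBr mulmxBl !mxE. Qed.

(** One step of the Cholesky elimination: subtracting a square of a linear form
    clears one more row and keeps the form nonnegative. *)
Lemma psd_eliminate K (i : 'I_d) : K^T = K -> (forall t, 0 <= bil K t t) ->
  (forall j k : 'I_d, (j < i)%N -> K j k = 0) ->
  exists v, let K' := K - v^T *m v in
    [/\ K'^T = K', forall t, 0 <= bil K' t t & forall j k : 'I_d, (j <= i)%N -> K' j k = 0].
Proof.
move=> KT K0 Ki.
have Ksym j k : K j k = K k j by rewrite -{1}KT mxE.
have a0 : 0 <= K i i by rewrite -bil_delta2.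
have gT v : (v^T *m v)^T = v^T *m v by rewrite trmx_mul trmxK.
have [ai|ai] := eqVneq (K i i) 0.
  exists 0; rewrite /= mulmx0 subr0; split => // j k.
  rewrite leq_eqVlt => /orP[/eqP ji|]; last exact: Ki.
  have {ji} -> : j = i by exact: val_inj.
  have h c : 0 <= 2 * c * K i k + K k k.
    have := K0 (c *: delta_mx ord0 i + delta_mx ord0 k).
    rewrite bilDl bilZl !(bil_sym _ (c *: _ + _) KT) !bilDl !bilZl !bil_delta2 ai (Ksym k i).
    by rewrite (_ : _ + _ = 2 * c * K i k + K k k) //; ring.
  apply/eqP/negPn/negP => Kik.
  have := h (- (K k k + 1) / (2 * K i k)).
  by rewrite (_ : _ + _ = -1) ?ler0N1//; field.
have ap : 0 < K i i by rewrite lt_neqAle eq_sym ai.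
pose v := (Num.sqrt (K i i))^-1 *: row i K.
have vE j k : (v^T *m v) j k = K i j * K i k / K i i.
  rewrite mxE big_ord1 !mxE -[in RHS](sqr_sqrtr a0); field.
  by rewrite gt_eqF// sqrtr_gt0.
exists v; split.
- by rewrite linearB/= gT KT.
- move=> t; rewrite bilB bil_gram.
  set b := bil K (delta_mx ord0 i) t.
  have -> : dotrv t v = b / Num.sqrt (K i i).
    rewrite /b bil_delta /v dotrvZr mulrC; congr (_ / _).
    by rewrite !dotrvE; apply: eq_bigr => k _; rewrite mulrC.
  have -> : b / Num.sqrt (K i i) * (b / Num.sqrt (K i i)) = b ^+ 2 / K i i.
    rewrite -[in RHS](sqr_sqrtr a0); field.
    by rewrite gt_eqF// sqrtr_gt0.
  have := K0 (t + (- (b / K i i)) *: delta_mx ord0 i).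
  rewrite bilDl bilZl !(bil_sym _ (t + _) KT) !bilDl !bilZl bil_delta2.
  rewrite -/b (bil_sym t (delta_mx _ _) KT) -/b.
  by rewrite (_ : _ + _ = bil K t t - b ^+ 2 / K i i) //; field.
- move=> j k; rewrite leq_eqVlt => /orP[/eqP ji|ji].
    have {ji} -> : j = i by exact: val_inj.
    by rewrite [LHS]mxE [X in _ + X]mxE vE; field.
  by rewrite [LHS]mxE [X in _ + X]mxE vE (Ki j)// (Ksym i j) Ki// !mul0r subrr.
Qed.

(** The vectors v are the directions of the independent normal variables whose sum has
    covariance matrix K. *)
Lemma psd_gram K : K^T = K -> (forall t, 0 <= bil K t t) ->
  exists vs : seq V, forall s t, bil K s t = \sum_(v <- vs) dotrv s v * dotrv t v.
Proof.
move=> KT K0.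
have step k : (k <= d)%N -> exists vs : seq V, let K' := K - \sum_(v <- vs) v^T *m v in
    [/\ K'^T = K', forall t, 0 <= bil K' t t & forall i j : 'I_d, (i < k)%N -> K' i j = 0].
  elim: k => [|k IH] kd.
    by exists [::]; rewrite /= big_nil subr0.
  have [vs [h1 h2 h3]] := IH (ltnW kd).
  have [v [g1 g2 g3]] := psd_eliminate (i := Ordinal kd) h1 h2 h3.
  by exists (v :: vs); rewrite /= big_cons opprD addrCA addrC.
have [vs [_ _ h]] := step d (leqnn d).
exists vs => s t.
have -> : K = \sum_(v <- vs) v^T *m v.
  by apply/eqP; rewrite -subr_eq0; apply/eqP/matrixP => i j; rewrite h// mxE.
elim: vs {h} => [|v vs IH].
  by rewrite !big_nil /bil mulmx0 mul0mx mxE.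
rewrite !big_cons -IH -bil_gram /bil mulmxDr mulmxDl [LHS]mxE.
by [].
Qed.

End gram_decomposition.

(** * Moments of the increment and of its Gaussian counterpart *)

Section increment_moments.
Context {R : realType} {d : nat} {dO : measure_display} {O : measurableType dO}.
Variables (Q : probability O R) (X : {RV Q >-> 'rV[R]_d}).
Notation V := 'rV[R]_d.

(** (r |x|)^3 / 6 is one of the terms of the exponential series. *)
Lemma cube_le_exp (r x : R) : 0 < r ->
  `|x| ^+ 3 <= (6 / r ^+ 3) * (expR (r * x) + expR (- r * x)).
Proof.
move=> r0.
have h : `|x| ^+ 3 <= (6 / r ^+ 3) * expR (r * `|x|).
  have y0 : 0 <= r * `|x| by rewrite mulr_ge0// ltW.
  have := expR_ge1Dxn 2 y0.
  have -> : (3`!)%:R = 6 :> R by [].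
  move=> h; have {h} h : (r * `|x|) ^+ 3 <= 6 * expR (r * `|x|).
    by move: h; set a := (r * `|x|) ^+ 3; lra.
  by rewrite mulrAC ler_pdivlMr ?exprn_gt0// mulrC -exprMn.
apply: (le_trans h); apply: ler_wpM2l; first by rewrite divr_ge0// exprn_ge0// ltW.
have [x0|x0] := leP 0 x; first by rewrite ger0_norm// lerDl expR_ge0.
by rewrite ltr0_norm// mulrN -mulNr lerDr expR_ge0.
Qed.

Hypothesis hX : exp_moments X.

Lemma mX : measurable_fun setT X.
Proof. exact: measurable_funPT. Qed.

Lemma exp_moments_cube i : Q.-integrable setT (EFin \o (fun w => `|X w ord0 i| ^+ 3)).
Proof.
have [r [r0 H]] := hX.
have mXi : measurable_fun setT (fun w => X w ord0 i) by exact: (measurableT_comp (measurable_coord i) mX).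
have iE c : `|c| <= r -> Q.-integrable setT (EFin \o (fun w => expR (c * X w ord0 i))).
  move=> cr; apply/integrableP; split.
    by apply/measurable_EFinP; apply: measurableT_comp => //; exact: measurable_funM.
  have dE x : dotrv (c *: delta_mx ord0 i : V) x = c * x ord0 i.
    rewrite dotrvE (bigD1 i)//= !mxE !eqxx mulr1 big1 ?addr0// => j ji.
    by rewrite !mxE (negbTE ji) mulr0 mul0r.
  have := H (c *: delta_mx ord0 i).
  rewrite dE !mxE !eqxx mulr1 -expr2 sqrtr_sqr => /(_ cr).
  rewrite unlock; under eq_integral => w _ do rewrite dE.
  by under [X in _ -> (X < _)%E]eq_integral => w _ do rewrite /= ger0_norm ?expR_ge0//.
apply: (integrable_dom _ (integrable_scale (6 / r ^+ 3) (integrable_addr (iE r _) (iE (- r) _)))).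
- by apply: measurable_funX; apply: measurableT_comp.
- by rewrite gtr0_norm.
- by rewrite normrN gtr0_norm.
- by move=> w; rewrite ger0_norm ?exprn_ge0// cube_le_exp.
Qed.

Lemma increment_moments : moments Q X (fun i => \int[Q]_w (X w ord0 i))
    (fun i j => \int[Q]_w (X w ord0 i * X w ord0 j)) (\int[Q]_w (`|X w| ^+ 3)).
Proof. by apply: moments_of_third; [exact: mX|exact: exp_moments_cube]. Qed.

Lemma mean_rvE i : mean_rv X ord0 i = \int[Q]_w (X w ord0 i).
Proof. by rewrite mxE unlock. Qed.

Lemma second_momentE i j :
  (cov_mx X + (mean_rv X)^T *m mean_rv X) i j = \int[Q]_w (X w ord0 i * X w ord0 j).
Proof.
have [_ i1 i2 _ _ _ _] := increment_moments.
have -> : (cov_mx X + (mean_rv X)^T *m mean_rv X) i j =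
    cov_mx X i j + mean_rv X ord0 i * mean_rv X ord0 j.
  by rewrite mxE [X in _ + X]mxE big_ord1 [_^T _ _]mxE.
rewrite !mean_rvE.
set a := \int[Q]_w (X w ord0 i); set b := \int[Q]_w (X w ord0 j).
have -> : cov_mx X i j = \int[Q]_w ((X w ord0 i - a) * (X w ord0 j - b)).
  by rewrite mxE covariance.unlock expectation.unlock.
have i0 := bm_integrable (prob_fin Q) (bm_cst (1:R)).
rewrite (_ : \int[Q]_w ((X w ord0 i - a) * (X w ord0 j - b)) =
  \int[Q]_w (X w ord0 i * X w ord0 j + ((- b) * X w ord0 i + ((- a) * X w ord0 j + (a * b) * 1)))); last first.
  by apply: eq_Rintegral => w _; ring.
have j1 := integrable_scale (- b) (i1 i); have j2 := integrable_scale (- a) (i1 j).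
have j3 := integrable_scale (a * b) i0.
rewrite RintegralD//; last exact: (integrable_addr j1 (integrable_addr j2 j3)).
rewrite RintegralD//; last exact: (integrable_addr j2 j3).
rewrite RintegralD// !RintegralZl// Rint_prob_cst -/a -/b.
ring.
Qed.

(** The matrix of second moments of the increment is a nonnegative form, hence a Gram
    form, which provides a Gaussian law with the same second moments. *)
Lemma gaussian_same_second_moments : exists (vs : seq V) (k3 : R),
  is_gaussian (gaussv vs) 0 (cov_mx X + (mean_rv X)^T *m mean_rv X) /\
  moments (gaussv vs) id (fun=> 0) (fun i j => \int[Q]_w (X w ord0 i * X w ord0 j)) k3.
Proof.
have [_ i1 i2 _ _ _ _] := increment_moments.
set K := cov_mx X + _.
have KE i j : K i j = \int[Q]_w (X w ord0 i * X w ord0 j) by exact: second_momentE.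
have KT : K^T = K.
  by apply/matrixP => i j; rewrite mxE !KE; apply: eq_Rintegral => w _; rewrite mulrC.
have bilE t : bil K t t = \int[Q]_w (dotrv t (X w) ^+ 2).
  rewrite /bil mxE.
  under eq_bigr => j _ do rewrite mxE [t^T _ _]mxE mulr_suml.
  transitivity (\int[Q]_w (\sum_j \sum_i (t ord0 i * t ord0 j) * (X w ord0 i * X w ord0 j))).
    rewrite Rint_sum; last first.
      by move=> j; apply: integrable_sumr => i; exact: integrable_scale.
    apply: eq_bigr => j _; rewrite Rint_sum; last by move=> i; exact: integrable_scale.
    by apply: eq_bigr => i _; rewrite RintegralZl// KE; ring.
  apply: eq_Rintegral => w _; rewrite dotrvE expr2 mulr_sumr; apply: eq_bigr => j _.
  by rewrite mulr_suml; apply: eq_bigr => i _; ring.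
have K0 t : 0 <= bil K t t by rewrite bilE; apply: Rintegral_ge0 => w _; exact: sqr_ge0.
have [vs vsE] := psd_gram KT K0.
exists vs, (\int[gaussv vs]_x (`|x| ^+ 3)); split.
  apply: gaussv_is_gaussian => t; rewrite -[LHS]/(bil K t t) vsE.
  by apply: eq_bigr => v _; rewrite expr2.
have dE i x : dotrv (delta_mx ord0 i : V) x = x ord0 i.
  rewrite dotrvE (bigD1 i)//= !mxE !eqxx mul1r big1 ?addr0// => j ji.
  by rewrite !mxE (negbTE ji) mul0r.
have := @moments_of_third R d _ V (gaussv vs) id (@measurable_id _ _ _).
case.
  move=> i; have := gaussv_third_moment vs (delta_mx ord0 i).
  by congr (_.-integrable _ _); apply/funext => x /=; rewrite dE.
move=> h0 h1 h2 h3 h4 h5 h6; split => //.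
- move=> i; have [_] := gaussv_mean vs (delta_mx ord0 i).
  by move=> <-; apply: eq_Rintegral => x _; rewrite dE.
- move=> i j; rewrite -KE -bil_delta2 vsE.
  have key (t : V) : \int[gaussv vs]_x (dotrv t x ^+ 2) = sqform vs t by exact: (gaussv_second_moment vs t).2.
  have ij : (gaussv vs).-integrable setT (EFin \o (fun x : V => x ord0 i * x ord0 j)) by exact: h2.
  pose ei : V := delta_mx ord0 i; pose ej : V := delta_mx ord0 j.
  have [g1 _] := gaussv_second_moment vs (ei + ej).
  have [g2 _] := gaussv_second_moment vs ei.
  have [g3 _] := gaussv_second_moment vs ej.
  have pol : 2 * \int[gaussv vs]_x (x ord0 i * x ord0 j) = sqform vs (ei + ej) - sqform vs ei - sqform vs ej.
    rewrite -!key -RintegralZl// -RintegralB// -RintegralB//; last first.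
      have := integrableB measurableT g1 g2; exact.
    apply: eq_Rintegral => x _; rewrite (dotrvC (ei + ej)) dotrvDr !(dotrvC x) !dE; ring.
  have : 2 * (\sum_(v <- vs) dotrv ei v * dotrv ej v) = sqform vs (ei + ej) - sqform vs ei - sqform vs ej.
    rewrite /sqform mulr_sumr -!sumrB; apply: eq_bigr => v _.
    by rewrite (dotrvC (ei + ej)) dotrvDr !(dotrvC v); ring.
  by rewrite -pol => /mulfI <- //; rewrite pnatr_eq0.
Qed.

End increment_moments.

(** * Lindeberg comparison of a lazy random walk with a Gaussian law *)

Section taylor_expectation.
Context {R : realType} {d : nat}.
Notation V := 'rV[R]_d.
Implicit Types (f : V -> R) (x y m : V).

Definition lform (l : 'I_d -> R) (y : V) : R := \sum_i l i * y ord0 i.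
Definition qform (H : 'I_d -> 'I_d -> R) (y : V) : R :=
  \sum_i \sum_j H i j * (y ord0 i * y ord0 j).

(** The two bounds are kept apart because they have different orders at scale a, namely
    a^-2 and a^-3. *)
Definition taylor (c2 c3 : R) f := forall x, exists l H, forall y,
  `|f (x + y) - f x - lform l y - qform H y| <= c3 * `|y| ^+ 3 /\
  `|qform H y| <= c2 * `|y| ^+ 2.

Lemma bm_shift dO (O : measurableType dO) (X : O -> V) f x :
  measurable_fun setT X -> bm f -> bm (fun w => f (x + X w)).
Proof.
move=> mX bf; apply: (bm_comp _ bf); exact: measurable_addrV.
Qed.

(** Up to third order, the expectation of f only depends on the first two moments of
    the increment. *)
Lemma taylor_expect dO (O : measurableType dO) (Q : probability O R) (X : O -> V) a b k3
    c3 f x l H : moments Q X a b k3 -> bm f -> 0 <= c3 ->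
  (forall y, `|f (x + y) - f x - lform l y - qform H y| <= c3 * `|y| ^+ 3) ->
  `|\int[Q]_w f (x + X w) - (f x + \sum_i l i * a i + \sum_i \sum_j H i j * b i j)| <= c3 * k3.
Proof.
move=> [mX i1 i2 i3 e1 e2 e3] bf c30 T.
have bfx := bm_shift x mX bf.
have if0 := bm_integrable (prob_fin Q) bfx.
have ic := bm_integrable (prob_fin Q) (bm_cst (f x)).
have il : Q.-integrable setT (EFin \o (fun w => lform l (X w))).
  by apply: integrable_sumr => i; exact: integrable_scale.
have iq : Q.-integrable setT (EFin \o (fun w => qform H (X w))).
  by apply: integrable_sumr => i; apply: integrable_sumr => j; exact: integrable_scale.
have iN g : Q.-integrable setT (EFin \o g) -> Q.-integrable setT (EFin \o (fun w => - g w)).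
  move=> ig; rewrite (_ : EFin \o _ = EFin \o (fun w => -1 * g w)).
    exact: integrable_scale.
  by apply/funext => w /=; rewrite mulN1r.
have j1 := integrable_addr if0 (iN _ ic).
have j2 := integrable_addr j1 (iN _ il).
have j3 := integrable_addr j2 (iN _ iq).
have -> : \int[Q]_w f (x + X w) - (f x + \sum_i l i * a i + \sum_i \sum_j H i j * b i j) =
    \int[Q]_w (f (x + X w) - f x - lform l (X w) - qform H (X w)).
  rewrite RintegralB// RintegralB// RintegralB// Rint_prob_cst.
  have -> : \int[Q]_w lform l (X w) = \sum_i l i * a i.
    rewrite Rint_sum; last by move=> i; exact: integrable_scale.
    by apply: eq_bigr => i _; rewrite RintegralZl// e1.
  have -> : \int[Q]_w qform H (X w) = \sum_i \sum_j H i j * b i j.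
    rewrite Rint_sum; last by move=> i; apply: integrable_sumr => j; exact: integrable_scale.
    apply: eq_bigr => i _; rewrite Rint_sum; last by move=> j; exact: integrable_scale.
    by apply: eq_bigr => j _; rewrite RintegralZl// e2.
  by rewrite !opprD !addrA.
apply: (le_trans (le_normr_Rintegral _ j3)) => //.
apply: (@le_trans _ _ (\int[Q]_w (c3 * `|X w| ^+ 3))).
  apply: le_Rintegral => //; first exact: integrable_norm j3.
  exact: integrable_scale.
by rewrite RintegralZl// ler_wpM2l.
Qed.

End taylor_expectation.

Section lindeberg.
Context {R : realType} {d : nat} {dO : measure_display} {O : measurableType dO}.
Notation V := 'rV[R]_d.
Variables (Q : probability O R) (X : O -> V) (m : V) (G2 : 'I_d -> 'I_d -> R) (k3 : R).
Hypothesis mQ : moments Q X (fun i => m ord0 i) G2 k3.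
Variables (vs : seq V) (k3' : R).
Notation nu := (gaussv vs).
Hypothesis mnu : moments nu id (fun=> 0) G2 k3'.
Implicit Types (f : V -> R) (x y : V) (p : R).

Let mX : measurable_fun setT X. Proof. exact: mom_meas mQ. Qed.

(** The walk moves by X with probability p in a lazy step. The step gop has, to first
    order in p, the same mean p m and the same second moments p G2. *)
Definition Kop f x : R := \int[Q]_w f (x + X w).
Definition lazy p f x : R := (1 - p) * f x + p * Kop f x.
Definition gop p f x : R := \int[nu]_z f (x + (p *: m + Num.sqrt p *: z)).

Fixpoint lazy_iter (q : nat -> R) (k j : nat) f : V -> R :=
  if j is j'.+1 then lazy (q k) (lazy_iter q k.+1 j' f) else f.

Lemma measurable_drift p : measurable_fun setT (fun z : V => p *: m + Num.sqrt p *: z).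
Proof.
apply: measurable_addrV; first exact: measurable_cst.
by apply: measurable_scalerV; [exact: measurable_cst|exact: measurable_id].
Qed.

Lemma bm_joint dT (T : measurableType dT) (Y : T -> V) f : measurable_fun setT Y -> bm f ->
  bm (fun z : V * T => f (z.1 + Y z.2)).
Proof.
move=> mY bf; apply: (bm_comp _ bf); apply: measurable_addrV; first exact: measurable_fst.
exact: (measurableT_comp mY measurable_snd).
Qed.

Lemma bm_Kop f : bm f -> bm (Kop f).
Proof. by move=> bf; exact: (bm_param Q (bm_joint mX bf)). Qed.

Lemma bm_lazy p f : bm f -> bm (lazy p f).
Proof. by move=> bf; apply: bmD; apply: bmZ => //; exact: bm_Kop. Qed.

Lemma bm_gop p f : bm f -> bm (gop p f).
Proof. by move=> bf; exact: (bm_param nu (bm_joint (measurable_drift p) bf)). Qed.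

Lemma bm_lazy_iter q k j f : bm f -> bm (lazy_iter q k j f).
Proof. by elim: j k => //= j IH k bf; apply: bm_lazy; exact: IH. Qed.

Lemma lazy_dist p f g e x : 0 <= p <= 1 -> bm f -> bm g ->
  (forall y, `|f y - g y| <= e) -> `|lazy p f x - lazy p g x| <= e.
Proof.
move=> /andP[p0 p1] bf bg fg.
have h : `|Kop f x - Kop g x| <= e.
  by apply: Rint_prob_dist => [||w]; [exact: bm_shift|exact: bm_shift|exact: fg].
have -> : lazy p f x - lazy p g x = (1 - p) * (f x - g x) + p * (Kop f x - Kop g x).
  by rewrite /lazy; ring.
rewrite (le_trans (ler_normD _ _))// !normrM (ger0_norm p0) ger0_norm ?subr_ge0//.
have -> : e = (1 - p) * e + p * e by ring.
by rewrite lerD// ler_wpM2l// subr_ge0.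
Qed.

Lemma gop_dist p f g e x : bm f -> bm g ->
  (forall y, `|f y - g y| <= e) -> `|gop p f x - gop p g x| <= e.
Proof.
move=> bf bg fg; have md := measurable_drift p.
by apply: Rint_prob_dist => [||w]; [exact: bm_shift|exact: bm_shift|exact: fg].
Qed.

(** All steps are convolutions, hence they commute. *)
Lemma lazy_gop p p' f x : bm f -> lazy p (gop p' f) x = gop p' (lazy p f) x.
Proof.
move=> bf; have md := measurable_drift p'.
have b1 := bm_shift x md bf; have b2 := bm_shift x md (bm_Kop bf).
have fn := prob_fin nu.
rewrite /lazy /gop (RintD fn (bmZ (1 - p) b1) (bmZ p b2)) (RintZ fn (1 - p) b1) (RintZ fn p b2).
congr (_ + _ * _); rewrite /Kop.
pose F (z : O * V) := f (x + (X z.1 + (p' *: m + Num.sqrt p' *: z.2))).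
have bF : bm F.
  apply: (bm_comp _ bf); apply: measurable_addrV; first exact: measurable_cst.
  apply: measurable_addrV.
    exact: (measurableT_comp mX measurable_fst).
  exact: (measurableT_comp md measurable_snd).
transitivity (\int[Q]_w \int[nu]_z F (w, z)).
  by apply: eq_Rintegral => w _; apply: eq_Rintegral => z _; rewrite /F/= -(addrA x).
rewrite (Rint_swap Q nu bF); apply: eq_Rintegral => z _; apply: eq_Rintegral => w _.
by rewrite /F/= (addrC (X w)) (addrA x).
Qed.

Lemma gop_gop p p' f x : 0 <= p -> 0 <= p' -> bm f -> gop p (gop p' f) x = gop (p + p') f x.
Proof.
move=> p0 p'0 bf.
transitivity (\int[nu]_z \int[nu]_z' f (x + (p + p') *: m + (Num.sqrt p *: z + Num.sqrt p' *: z'))).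
  apply: eq_Rintegral => z _; apply: eq_Rintegral => z' _; congr f.
  by rewrite scalerDl -!addrA; congr (_ + (_ + _)); rewrite addrCA.
rewrite (gaussv_stable vs _ _ (f := fun y => f (x + (p + p') *: m + y))); last first.
  exact: (bm_shift (X := id) _ (@measurable_id _ _ _) bf).
by apply: eq_Rintegral => z _; rewrite addrA !sqr_sqrtr.
Qed.

Let mabs := `|m| ^+ 3 + k3'.

(** The drift adds a term of order p^2 to the second moments; this is the source of the
    quadratic error term below. *)
Lemma drift_moments p : 0 <= p <= 1 ->
  moments nu (fun z => p *: m + Num.sqrt p *: z) (fun i => p * m ord0 i)
    (fun i j => p ^+ 2 * (m ord0 i * m ord0 j) + p * G2 i j) (p * (4 * mabs)).
Proof.
move=> /andP[p0 p1]; have [_ i1 i2 i3 e1 e2 e3] := mnu.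
have ic c := bm_integrable (prob_fin nu) (bm_cst (c : R)).
have s2 : Num.sqrt p ^+ 2 = p by rewrite sqr_sqrtr.
have E1 i z : (p *: m + Num.sqrt p *: z) ord0 i = p * m ord0 i + Num.sqrt p * z ord0 i.
  by rewrite !mxE.
have E2 i j z : (p *: m + Num.sqrt p *: z) ord0 i * (p *: m + Num.sqrt p *: z) ord0 j =
    p ^+ 2 * (m ord0 i * m ord0 j) + ((p * m ord0 i * Num.sqrt p) * z ord0 j +
    ((p * m ord0 j * Num.sqrt p) * z ord0 i + p * (z ord0 i * z ord0 j))).
  rewrite !E1 -[X in _ + X * (z ord0 i * _)]s2; ring.
have j1 i : nu.-integrable setT (EFin \o (fun z : V => p * m ord0 i + Num.sqrt p * z ord0 i)).
  by apply: integrable_addr; [exact: ic|exact/integrable_scale/i1].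
have k1 i j := integrable_scale (p * m ord0 i * Num.sqrt p) (i1 j).
have k2 i j := integrable_scale p (i2 i j).
have k12 i j := integrable_addr (k1 j i) (k2 i j).
have k112 i j := integrable_addr (k1 i j) (k12 i j).
have j2 i j := integrable_addr (ic (p ^+ 2 * (m ord0 i * m ord0 j))) (k112 i j).
have j3 : nu.-integrable setT (EFin \o (fun z : V => p * (4 * (`|m| ^+ 3 + `|z| ^+ 3)))).
  by do 2 apply: integrable_scale; apply: integrable_addr; [exact: ic|exact: i3].
have n3 z : `|p *: m + Num.sqrt p *: z| ^+ 3 <= p * (4 * (`|m| ^+ 3 + `|z| ^+ 3)).
  have sp0 : 0 <= Num.sqrt p by exact: sqrtr_ge0.
  have sp1 : Num.sqrt p <= 1 by rewrite -sqrtr1 ler_wsqrtr.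
  have h1 : `|p *: m + Num.sqrt p *: z| <= Num.sqrt p * (`|m| + `|z|).
    rewrite (le_trans (ler_normD _ _))// !normrZ (ger0_norm p0) (ger0_norm sp0) mulrDr lerD//.
    rewrite ler_wpM2r// -[leLHS]s2; nra.
  apply: (@le_trans _ _ ((Num.sqrt p * (`|m| + `|z|)) ^+ 3)).
    by rewrite lerXn2r// nnegrE ?mulr_ge0 ?addr_ge0.
  rewrite exprMn -[p in leRHS]s2.
  have m0 : 0 <= `|m| by []. have z0 : 0 <= `|z| by [].
  move: m0 z0; set a := `|m|; set b := `|z| => m0 z0.
  have ab : (a + b) ^+ 3 <= 4 * (a ^+ 3 + b ^+ 3).
    have : 0 <= 3 * (a + b) * (a - b) ^+ 2 by rewrite mulr_ge0 ?sqr_ge0// mulr_ge0// addr_ge0.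
    by move=> h; rewrite -subr_ge0 (_ : _ - _ = 3 * (a + b) * (a - b) ^+ 2)//; ring.
  have q3 : 0 <= Num.sqrt p ^+ 3 by exact: exprn_ge0.
  have ab3 : 0 <= (a + b) ^+ 3 by apply: exprn_ge0; exact: addr_ge0.
  have q32 : Num.sqrt p ^+ 3 <= Num.sqrt p ^+ 2.
    by rewrite exprSr -[leRHS]mulr1; apply: ler_wpM2l => //; exact: sqr_ge0.
  exact: ler_pM.
have md := measurable_drift p.
split => //.
- by move=> i; move: (j1 i); congr (_.-integrable _ _); apply/funext => z /=; rewrite E1.
- by move=> i j; move: (j2 i j); congr (_.-integrable _ _); apply/funext => z /=; rewrite E2.
- apply: (integrable_dom _ j3); last by move=> z; rewrite ger0_norm ?exprn_ge0.
  by apply: measurable_funX; exact: (measurableT_comp measurable_norm_rV md).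
- move=> i; under eq_Rintegral => z _ do rewrite E1.
  rewrite (RintegralD measurableT (ic (p * m ord0 i)) (integrable_scale (Num.sqrt p) (i1 i))).
  by rewrite Rint_prob_cst (RintegralZl _ measurableT (i1 i)) e1 mulr0 addr0.
- move=> i j; under eq_Rintegral => z _ do rewrite E2.
  rewrite (RintegralD measurableT (ic (p ^+ 2 * (m ord0 i * m ord0 j))) (k112 i j)).
  rewrite Rint_prob_cst (RintegralD measurableT (k1 i j) (k12 i j)).
  rewrite (RintegralD measurableT (k1 j i) (k2 i j)).
  rewrite (RintegralZl _ measurableT (i1 j)) (RintegralZl _ measurableT (i1 i)).
  by rewrite (RintegralZl _ measurableT (i2 i j)) e2 !e1 !mulr0 !add0r.
- apply: (@le_trans _ _ (\int[nu]_z (p * (4 * (`|m| ^+ 3 + `|z| ^+ 3))))).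
    apply: le_Rintegral => //.
    apply: (integrable_dom _ j3); last by move=> z; rewrite ger0_norm ?exprn_ge0.
    by apply: measurable_funX; exact: (measurableT_comp measurable_norm_rV md).
  have iz := integrable_addr (ic (`|m| ^+ 3)) i3.
  rewrite (RintegralZl _ measurableT (integrable_scale 4 iz)) (RintegralZl _ measurableT iz).
  rewrite (RintegralD measurableT (ic (`|m| ^+ 3)) i3).
  by rewrite Rint_prob_cst ler_wpM2l// ler_wpM2l// /mabs lerD2l.
Qed.

Definition lind_const : R := k3 + 4 * mabs + `|m| ^+ 2.

Lemma norm_sqform_drift c2 p H : 0 <= p -> (forall y, `|qform H y| <= c2 * `|y| ^+ 2) ->
  `|\sum_i \sum_j H i j * (p ^+ 2 * (m ord0 i * m ord0 j))| <= c2 * p ^+ 2 * `|m| ^+ 2.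
Proof.
move=> p0 h.
have -> : \sum_i \sum_j H i j * (p ^+ 2 * (m ord0 i * m ord0 j)) = p ^+ 2 * qform H m.
  rewrite /qform mulr_sumr; apply: eq_bigr => i _; rewrite mulr_sumr; apply: eq_bigr => j _.
  by rewrite mulrCA.
have p2 : 0 <= p ^+ 2 by exact: sqr_ge0.
have -> : c2 * p ^+ 2 * `|m| ^+ 2 = p ^+ 2 * (c2 * `|m| ^+ 2) by ring.
by rewrite normrM (ger0_norm p2); apply: ler_wpM2l => //; exact: h.
Qed.

(** Both steps have the same expansion up to order two, except for the square of
    the drift. *)
Lemma lazy_gop_step c2 c3 p f x : 0 <= p <= 1 -> 0 <= c2 -> 0 <= c3 -> bm f -> taylor c2 c3 f ->
  `|lazy p f x - gop p f x| <= lind_const * (c3 * p + c2 * p ^+ 2).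
Proof.
move=> p01 c20 c30 bf /(_ x)[l [H T]]; have /andP[p0 p1] := p01.
have T3 y := (T y).1; have T2 y := (T y).2.
have h1 := taylor_expect mQ bf c30 T3.
have h2 := taylor_expect (drift_moments p01) bf c30 T3.
have h3 := norm_sqform_drift p0 T2.
have k30 : 0 <= k3.
  by apply: le_trans (mom_3 mQ); apply: Rintegral_ge0 => w _; rewrite exprn_ge0.
have k30' : 0 <= k3'.
  by apply: le_trans (mom_3 mnu); apply: Rintegral_ge0 => w _; rewrite exprn_ge0.
have ma0 : 0 <= mabs by rewrite addr_ge0// exprn_ge0.
have m2 : 0 <= `|m| ^+ 2 by rewrite exprn_ge0.
move: h1 h2 h3.
have -> : \sum_i l i * (p * m ord0 i) = p * \sum_i l i * m ord0 i.
  by rewrite mulr_sumr; apply: eq_bigr => i _; rewrite mulrCA.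
have -> : \sum_i \sum_j H i j * (p ^+ 2 * (m ord0 i * m ord0 j) + p * G2 i j) =
   \sum_i \sum_j H i j * (p ^+ 2 * (m ord0 i * m ord0 j)) + p * \sum_i \sum_j H i j * G2 i j.
  rewrite mulr_sumr -big_split/=; apply: eq_bigr => i _.
  by rewrite mulr_sumr -big_split/=; apply: eq_bigr => j _; ring.
rewrite -/(Kop f x) -/(gop p f x) /lazy /lind_const.
set L := \sum_i l i * m ord0 i; set B := \sum_i \sum_j H i j * G2 i j.
set D := \sum_i \sum_j H i j * (p ^+ 2 * (m ord0 i * m ord0 j)).
set A := Kop f x; set G := gop p f x; set a := mabs; rewrite -/mabs -/a in ma0 *.
move: ma0 m2; set u := `|m| ^+ 2; clearbody L B D A G a u => ma0 m2.
set F := f x => h1 h2 h3.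
have -> : (1 - p) * F + p * A - G =
   p * (A - (F + L + B)) - (G - (F + p * L + (D + p * B))) - D by ring.
rewrite (le_trans (ler_normB _ _))//.
have e1 : `|p * (A - (F + L + B))| <= p * (c3 * k3).
  by rewrite normrM ger0_norm// ler_wpM2l.
apply: (@le_trans _ _ (p * (c3 * k3) + c3 * (p * (4 * a)) + c2 * p ^+ 2 * u)).
  by rewrite lerD// (le_trans (ler_normB _ _))// lerD.
have -> : (k3 + 4 * a + u) * (c3 * p + c2 * p ^+ 2) = p * (c3 * k3) + c3 * (p * (4 * a)) + c2 * p ^+ 2 * u
   + (u * (c3 * p) + (k3 + 4 * a) * (c2 * p ^+ 2)) by ring.
by rewrite lerDl addr_ge0// !mulr_ge0// ?addr_ge0// ?mulr_ge0// sqr_ge0.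
Qed.

(** The lazy steps are replaced by Gaussian steps one at a time. As the two kinds of
    steps commute, each replacement acts on the initial function, whose expansion is
    given. *)
Lemma lazy_iter_gop c2 c3 q k j f x : (forall i, 0 <= q i <= 1) -> 0 <= c2 -> 0 <= c3 ->
  bm f -> taylor c2 c3 f ->
  `|lazy_iter q k j f x - gop (\sum_(i < j) q (k + i)%N) f x| <=
  \sum_(i < j) lind_const * (c3 * q (k + i)%N + c2 * q (k + i)%N ^+ 2).
Proof.
move=> q01 c20 c30 bf tf; elim: j k x => [|j IH] k x.
  rewrite !big_ord0 /gop /=.
  under eq_Rintegral => z _ do rewrite sqrtr0 !scale0r !addr0.
  by rewrite Rint_prob_cst subrr normr0.
have qs0 k' : 0 <= \sum_(i < j) q (k' + i)%N.
  by apply: sumr_ge0 => i _; have /andP[] := q01 (k' + i)%N.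
rewrite !big_ord_recl/= addn0.
under eq_bigr => i _ do rewrite /bump/= add1n addnS -addSn.
under [X in _ <= _ + X]eq_bigr => i _ do rewrite /bump/= add1n addnS -addSn.
set P := \sum_(i < j) q _; set E := \sum_(i < j) _.
have b1 := bm_lazy_iter q k.+1 j bf; have b2 := bm_gop P bf; have b3 := bm_lazy (q k) bf.
have b4 := bm_gop (q k) bf.
have h1 : `|lazy (q k) (lazy_iter q k.+1 j f) x - lazy (q k) (gop P f) x| <= E.
  by apply: lazy_dist => // y; exact: IH.
have h2 : `|gop P (lazy (q k) f) x - gop P (gop (q k) f) x| <= lind_const * (c3 * q k + c2 * q k ^+ 2).
  by apply: gop_dist => // y; exact: lazy_gop_step.
have P0 : 0 <= P by exact: qs0.
have qk0 : 0 <= q k by have /andP[] := q01 k.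
rewrite -(lazy_gop _ _ _ bf) (gop_gop _ P0 qk0 bf) in h2.
rewrite [q k + P]addrC [leRHS]addrC (le_trans (ler_distD (lazy (q k) (gop P f) x) _ _))//.
exact: lerD.
Qed.

End lindeberg.

(** * The martingales of a measure-valued Polya process *)

Section functionals.
Context {d} {T : measurableType d} {R : realType}.

(** Linear and Lipschitz for the uniform distance: the form, in each of their arguments,
    of the two sides of the conditional law of the colours. *)
Definition blf (L : (T -> R) -> R) :=
  (forall a f g, bm f -> bm g -> L (fun x => a * f x + g x) = a * L f + L g) /\
  exists c, forall f g e, bm f -> bm g -> (forall x, `|f x - g x| <= e) -> `|L f - L g| <= c * e.

Lemma blf_eq L1 L2 : blf L1 -> blf L2 -> (forall A, measurable A -> L1 \1_A = L2 \1_A) ->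
  forall f, bm f -> L1 f = L2 f.
Proof.
move=> [lin1 [c1 b1]] [lin2 [c2 b2]] H; apply: bm_ind => //.
  by move=> a f g bf bg hf hg; rewrite lin1// lin2// hf hg.
move=> f bf h; apply/eqP; rewrite -subr_eq0 -normr_le0; apply/ler_addgt0Pl => e e0; rewrite addr0.
pose c := `|c1| + `|c2| + 1.
have c0 : 0 < c by rewrite ltr_wpDl// addr_ge0.
have [g [bg hg fg]] := h (e / c) (divr_gt0 e0 c0).
have h1 := b1 f g _ bf bg fg.
have h2 := b2 f g _ bf bg fg.
have -> : L1 f - L2 f = (L1 f - L1 g) - (L2 f - L2 g) by rewrite hg; ring.
rewrite (le_trans (ler_normB _ _))// (le_trans (lerD h1 h2))// -mulrDl.
rewrite mulrCA ger_pMr// ler_pdivrMr// mul1r /c.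
by rewrite -addrA lerD ?ler_norm// (le_trans (ler_norm _))// lerDl.
Qed.

End functionals.

Section kernel_integral.
Context {d d'} {X : measurableType d} {T : measurableType d'} {R : realType}.
Variables (L : X -> {measure set T -> \bar R}) (c0 : R).
Hypothesis mL : forall U, measurable U -> measurable_fun setT (L ^~ U).
Hypothesis L1 : forall x, L x setT = c0%:E.

Lemma kernel_fin x : (L x setT < +oo)%E.
Proof. by rewrite L1 ltry. Qed.

Lemma kernel_Rint_cst x c : \int[L x]_y c = c * c0.
Proof. by rewrite Rint_cst L1. Qed.

Lemma kernel_Rint_norm f x c : bm f -> (forall y, `|f y| <= c) -> `|\int[L x]_y f y| <= c * c0.
Proof. by move=> bf fc; have := Rint_norm_le (kernel_fin x) bf fc; rewrite L1. Qed.

Lemma bm_kernel_Rint f : bm f -> bm (fun x => \int[L x]_y f y).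
Proof.
move=> bf; have [mf [c fc]] := bf; split; last first.
  by exists (c * c0) => x; exact: kernel_Rint_norm.
have bFc : bm (fun z => f z + c) by apply: bmD => //; exact: bm_cst.
have -> : (fun x => \int[L x]_y f y) = (fun x => fine (\int[L x]_y (f y + c)%:E)%E - c * c0).
  apply/funext => x; rewrite (int_bm_fin (kernel_fin x) bFc)/=.
  rewrite (RintD (kernel_fin x) bf (bm_cst c)).
  by rewrite kernel_Rint_cst addrK.
apply: measurable_funB => //; apply: measurableT_comp => //.
apply: (measurable_fun_integral_kernel mL).
  by move=> z; rewrite lee_fin; have := fc z; rewrite ler_norml => /andP[]; lra.
by apply/measurable_EFinP; exact: bFc.1.
Qed.

End kernel_integral.

Section polya.
Context {R : realType} {dT dW : measure_display}.
Context {T : measurableType dT} {Omega : measurableType dW}.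
Variables (P : probability Omega R) (M0 : {finite_measure set T -> \bar R}).
Variables (K : R.-pker T ~> T) (C : nat -> {RV P >-> T}).
Variable (M : nat -> Omega -> {measure set T -> \bar R}).
Hypothesis HM : is_mvpp M0 K C M.
Hypothesis M0pos : (0 < M0 setT)%E.

Definition mass (n : nat) : R := fine (M0 setT) + n%:R.

Lemma mass0_gt0 : 0 < fine (M0 setT).
Proof. by rewrite fine_gt0// M0pos/= ltey_eq fin_num_measure. Qed.

Lemma mass_ge n : n%:R < mass n.
Proof. by rewrite /mass ltrDr mass0_gt0. Qed.

Lemma mass_gt0 n : 0 < mass n.
Proof. by apply: le_lt_trans (mass_ge n). Qed.

Lemma massS n : mass n.+1 = mass n + 1.
Proof. by rewrite /mass -natr1 addrA. Qed.

Lemma mvpp_mass n w : M n w setT = (mass n)%:E.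
Proof.
elim: n => [|n IH].
  by rewrite (mvpp_init HM)// /mass addr0 fineK// fin_num_measure.
by rewrite (mvpp_step HM)// IH prob_kernel massS EFinD.
Qed.

Lemma measurable_M n B : measurable B -> measurable_fun [set: Omega] (fun w => M n w B).
Proof.
move=> mB; elim: n => [|n IH].
  rewrite (_ : (fun _ => _) = cst (M0 B)); first exact: measurable_cst.
  by apply/funext => w; rewrite (mvpp_init HM).
rewrite (_ : (fun _ => _) = (fun w => M n w B + K (C n w) B)%E).
  apply: emeasurable_funD => //.
  apply: (measurableT_comp (measurable_kernel K B mB)); exact: measurable_funPT.
by apply/funext => w; rewrite (mvpp_step HM).
Qed.

Definition hist_gen (n : nat) : set (set Omega) :=
  \bigcup_(k in `I_n.+1) \bigcup_(B in @measurable _ T)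
        preimage_set_system [set: Omega] (fun w => M k w B) measurable.

(** Omega with the sigma-algebra of the history up to time n: a function adapted to the
    history is a measurable function on this type. *)
Definition HT n := g_sigma_algebraType (hist_gen n).

Lemma hist_sub n (A : set Omega) : (measurable : set (set (HT n))) A -> measurable A.
Proof.
apply: (smallest_sub (sigma_algebra_measurable Omega)) => /= {}A [k /= kn [B mB [D mD <-]]].
exact: measurable_M.
Qed.

Lemma hist_measurable n dX (X : measurableType dX) (f : Omega -> X) :
  measurable_fun [set: HT n] f -> measurable_fun [set: Omega] f.
Proof. by move=> mf _ Y mY; have := mf measurableT Y mY; exact: hist_sub. Qed.

Lemma hist_bm n (f : Omega -> R) : bm (f : HT n -> R) -> bm f.
Proof. by move=> [mf fc]; split => //; exact: hist_measurable mf. Qed.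

Lemma measurable_M_hist n k B : (k <= n)%N -> measurable B ->
  measurable_fun [set: HT n] (fun w => M k w B).
Proof.
move=> kn mB _ Y mY; apply: sub_sigma_algebra.
by exists k; [rewrite /= ltnS|exists B => //; exists Y].
Qed.

Definition Kint (f : T -> R) (x : T) : R := \int[K x]_y f y.

Lemma kernelK_mass x : K x setT = 1%:E.
Proof. exact: prob_kernel. Qed.

Lemma bm_Kint f : bm f -> bm (Kint f).
Proof. exact: (bm_kernel_Rint (measurable_kernel K) kernelK_mass). Qed.

Lemma M_fin n w : (M n w setT < +oo)%E.
Proof. by rewrite mvpp_mass ltry. Qed.

Lemma mvpp_integral_step n w f : bm f ->
  \int[M n.+1 w]_x f x = \int[M n w]_x f x + Kint f (C n w).
Proof.
move=> bf.
have Kfin x : (K x setT < +oo)%E by rewrite kernelK_mass ltry.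
have i1 := bm_integrable (M_fin n w) bf.
have i2 := bm_integrable (Kfin (C n w)) bf.
have mf : measurable_fun setT (EFin \o f) by apply/measurable_EFinP; exact: bf.1.
have := integral_measure_add measurableT i1 i2.
rewrite /Rintegral /Kint (@eq_measure_integral _ _ _ _ (measure_add (M n w) (K (C n w))) (M n.+1 w)).
  move=> ->; rewrite fineD//; exact: integrable_fin_num.
move=> A mA _; rewrite (mvpp_step HM)//.
exact: (esym (measure_addE _ _ _)).
Qed.

(** The mean of f under the law of the next colour. *)
Definition avg n (f : T -> R) (w : Omega) : R := (\int[M n w]_x f x) / mass n.

Lemma bm_avg n k f : (k <= n)%N -> bm f -> bm (avg k f : HT n -> R).
Proof.
move=> kn bf.
have h : bm ((fun w => \int[M k w]_x f x) : HT n -> R).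
  by apply: (bm_kernel_Rint (c0 := mass k)) => // [U mU|w]; [exact: measurable_M_hist|exact: mvpp_mass].
by apply: bmM => //; exact: bm_cst.
Qed.

Lemma avg_lin n a f g w : bm f -> bm g ->
  avg n (fun x => a * f x + g x) w = a * avg n f w + avg n g w.
Proof.
move=> bf bg; rewrite /avg (RintD (M_fin n w) (bmZ a bf) bg) (RintZ (M_fin n w) a bf).
by rewrite mulrDl mulrA.
Qed.

Lemma avgZ n a f w : bm f -> avg n (fun x => a * f x) w = a * avg n f w.
Proof. by move=> bf; rewrite /avg (RintZ (M_fin n w) a bf) mulrA. Qed.

Lemma avgN n f w : bm f -> avg n (fun x => - f x) w = - avg n f w.
Proof.
by move=> bf; rewrite -mulN1r -avgZ//; congr (avg n _ w); apply/funext => x; rewrite mulN1r.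
Qed.

Lemma avgB n f g w : bm f -> bm g -> avg n (fun x => f x - g x) w = avg n f w - avg n g w.
Proof. by move=> bf bg; rewrite /avg (RintB (M_fin n w) bf bg) mulrBl. Qed.

Lemma avg_cst n c w : avg n (cst c) w = c.
Proof. by rewrite /avg Rint_cst mvpp_mass/= mulfK// gt_eqF// mass_gt0. Qed.

Lemma avg_le n f g w : bm f -> bm g -> (forall x, f x <= g x) -> avg n f w <= avg n g w.
Proof.
move=> bf bg fg; rewrite /avg ler_pM2r ?invr_gt0 ?mass_gt0//.
exact: (Rint_le (M_fin n w)).
Qed.

Lemma avg_ge0 n f w : (forall x, 0 <= f x) -> 0 <= avg n f w.
Proof. by move=> f0; rewrite divr_ge0 ?(ltW (mass_gt0 n))// Rintegral_ge0. Qed.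

Lemma avg_norm n f c w : bm f -> (forall x, `|f x| <= c) -> `|avg n f w| <= c.
Proof.
move=> bf fc; rewrite /avg normrM (ger0_norm (_ : 0 <= (mass n)^-1)); last first.
  by rewrite invr_ge0 ltW// mass_gt0.
rewrite ler_pdivrMr ?mass_gt0//; have := Rint_norm_le (M_fin n w) bf fc.
by rewrite mvpp_mass.
Qed.

Lemma avg_dist n f g c w : bm f -> bm g -> (forall x, `|f x - g x| <= c) ->
  `|avg n f w - avg n g w| <= c.
Proof.
move=> bf bg fg.
rewrite -avgB//; apply: avg_norm => //; exact: bmB.
Qed.

(** The conditional law of a colour is given on events; both sides are linear and
    continuous in F and in U, so that the identity extends to bounded functions. *)
Lemma colour_integral n (U : Omega -> R) F : bm (U : HT n -> R) -> bm F ->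
  \int[P]_w (U w * F (C n w)) = \int[P]_w (U w * avg n F w).
Proof.
have fP := prob_fin P.
have bFC (G : T -> R) : bm G -> bm (fun w => G (C n w)).
  by move=> bG; apply: (bm_comp _ bG); exact: measurable_funPT.
have bav (G : T -> R) : bm G -> bm (avg n G) by move=> bG; apply: hist_bm; exact: (bm_avg (leqnn n) bG).
have blf1 (V : Omega -> R) : bm V -> blf (fun G : T -> R => \int[P]_w (V w * G (C n w))).
  move=> bV; have [_ [c Vc]] := bV; split.
    move=> a f g bf bg; rewrite -(RintZ fP a (bmM bV (bFC _ bf))).
    rewrite -(RintD fP (bmZ a (bmM bV (bFC _ bf))) (bmM bV (bFC _ bg))).
    by apply: eq_Rintegral => w _; ring.
  exists c => f g e bf bg fg.
  apply: (Rint_prob_dist P (bmM bV (bFC _ bf)) (bmM bV (bFC _ bg))) => w.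
  by rewrite -mulrBr normrM ler_pM.
have blf2 (V : Omega -> R) : bm V -> blf (fun G : T -> R => \int[P]_w (V w * avg n G w)).
  move=> bV; have [_ [c Vc]] := bV; split.
    move=> a f g bf bg; rewrite -(RintZ fP a (bmM bV (bav _ bf))).
    rewrite -(RintD fP (bmZ a (bmM bV (bav _ bf))) (bmM bV (bav _ bg))).
    by apply: eq_Rintegral => w _; rewrite avg_lin//; ring.
  exists c => f g e bf bg fg.
  apply: (Rint_prob_dist P (bmM bV (bav _ bf)) (bmM bV (bav _ bg))) => w.
  by rewrite -mulrBr normrM ler_pM// avg_dist.
have blf3 (G : Omega -> R) : bm G -> blf (fun V : HT n -> R => \int[P]_w (V w * G w)).
  move=> bG; have [_ [c Gc]] := bG; split.
    move=> a f g /hist_bm bf /hist_bm bg; rewrite -(RintZ fP a (bmM bf bG)).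
    rewrite -(RintD fP (bmZ a (bmM bf bG)) (bmM bg bG)).
    by apply: eq_Rintegral => w _; ring.
  exists c => f g e /hist_bm bf /hist_bm bg fg.
  apply: (Rint_prob_dist P (bmM bf bG) (bmM bg bG)) => w.
  by rewrite -mulrBl normrM mulrC ler_pM.
move=> bU bF.
apply: (blf_eq (blf3 _ (bFC _ bF)) (blf3 _ (bav _ bF)) _ bU) => A mA {U bU}.
have mA' := hist_sub mA.
have bA : bm (\1_A : Omega -> R) by exact: bm_indic.
apply: (blf_eq (blf1 _ bA) (blf2 _ bA) _ bF) => B mB.
have mCB : measurable (C n @^-1` B).
  by rewrite -[X in measurable X]setTI; exact: measurable_funPT.
have e1 w : \1_A w * \1_B (C n w) = \1_(A `&` C n @^-1` B) w :> R.
  by rewrite indicI.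
under eq_Rintegral => w _ do rewrite e1.
rewrite Rint_indic; last exact: measurableI.
rewrite /Rintegral; congr fine; apply: (etrans (mvpp_colour HM mA mB)).
rewrite [LHS]integral_mkcond; apply: eq_integral => w _.
rewrite patchE indicE; case: ifP => _; last by rewrite mul0r.
rewrite mul1r /avg Rint_indic// mvpp_mass/= EFinM fineK//.
rewrite ge0_fin_numE//; apply: le_lt_trans (M_fin n w).
by apply: le_measure; rewrite ?inE.
Qed.

(** The transition operator of the law of the next colour: a colour of step n+1 is
    one of step n, moved by the kernel with probability 1 / mass n.+1. *)
Definition mstep n (f : T -> R) (x : T) : R :=
  (1 - (mass n.+1)^-1) * f x + (mass n.+1)^-1 * Kint f x.

Lemma bm_mstep n f : bm f -> bm (mstep n f).
Proof. by move=> bf; apply: bmD; apply: bmZ => //; exact: bm_Kint. Qed.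

Lemma avg_succ n f w : bm f ->
  avg n.+1 f w = (1 - (mass n.+1)^-1) * avg n f w + (mass n.+1)^-1 * Kint f (C n w).
Proof.
move=> bf; rewrite /avg mvpp_integral_step// massS; field.
by rewrite !gt_eqF ?mass_gt0// -massS mass_gt0.
Qed.

Lemma avg_mstep n f w : bm f ->
  avg n (mstep n f) w = (1 - (mass n.+1)^-1) * avg n f w + (mass n.+1)^-1 * avg n (Kint f) w.
Proof.
move=> bf; have bK := bm_Kint bf.
by rewrite /mstep avg_lin ?avgZ//; exact: bmZ.
Qed.

(** Hence avg k (g k) is a martingale as soon as g k = mstep k (g k.+1), and a
    supermartingale when g k is only an upper bound of mstep k (g k.+1). *)
Lemma avg_martingale n (U : Omega -> R) f : bm (U : HT n -> R) -> bm f ->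
  \int[P]_w (U w * avg n.+1 f w) = \int[P]_w (U w * avg n (mstep n f) w).
Proof.
move=> bU bf; have bK := bm_Kint bf; have bU' := hist_bm bU.
have fP := prob_fin P.
have ba g : bm g -> bm (avg n g) by move=> bg; apply: hist_bm; exact: (bm_avg (leqnn n) bg).
have bKC : bm (fun w => Kint f (C n w)) by apply: (bm_comp _ bK); exact: measurable_funPT.
set q := (mass n.+1)^-1.
transitivity (\int[P]_w ((1 - q) * (U w * avg n f w) + q * (U w * Kint f (C n w)))).
  by apply: eq_Rintegral => w _; rewrite avg_succ// -/q; ring.
have b1 := bmM bU' (ba f bf); have b2 := bmM bU' bKC; have b3 := bmM bU' (ba _ bK).
rewrite (RintD fP (bmZ _ b1) (bmZ _ b2)) (RintZ fP q b2) colour_integral//.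
rewrite -(RintZ fP q b3) -(RintD fP (bmZ _ b1) (bmZ _ b3)).
by apply: eq_Rintegral => w _; rewrite avg_mstep// -/q; ring.
Qed.

Section maximal_inequality.
Variables (u : nat -> T -> R) (lam : R).
Hypothesis bu : forall k, bm (u k).
Hypothesis u0 : forall k x, 0 <= u k x.
Hypothesis superu : forall k x, mstep k (u k.+1) x <= u k x.
Hypothesis lam0 : 0 < lam.

(* the supermartingale has not reached the level lam before time n *)
Let E n : set Omega := [set w | forall k, (k < n)%N -> avg k (u k) w < lam].

Let mEH k n : (k <= n.+1)%N -> measurable (E k : set (HT n)).
Proof.
elim: k n => [|k IH] n kn.
  rewrite (_ : E 0 = setT) //; apply/seteqP; split=> // w _ k; by rewrite ltn0.
have -> : E k.+1 = E k `&` [set w | avg k (u k) w < lam].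
  apply/seteqP; split=> w; rewrite /E/=.
    by move=> h; split=> [i ik|]; apply: h => //; exact: ltnW.
  by move=> [h1 h2] i; rewrite ltnS leq_eqVlt => /orP[/eqP ->|/h1].
apply: measurableI; first by apply: IH; exact: ltnW.
have [ma _] := bm_avg (kn : (k <= n)%N) (bu k).
have h := ma measurableT `]-oo, lam[%classic (measurable_itv _); rewrite setTI in h.
have <- : avg k (u k) @^-1` `]-oo, lam[ = [set w | avg k (u k) w < lam].
  by apply/seteqP; split=> w /=; rewrite in_itv.
exact: h.
Qed.

(** The maximal inequality for the nonnegative supermartingale avg k (u k): the
    mass that it puts on the event of having been stopped is controlled. *)
Lemma maximal_step c n : (forall w, avg 0 (u 0) w <= c) ->
  \int[P]_w (\1_(E n) w * avg n (u n) w) + lam * (1 - \int[P]_w \1_(E n) w) <= c.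
Proof.
move=> c0; have fP := prob_fin P.
have mE k : measurable (E k) by apply: (@hist_sub k); exact: mEH.
have bE k : bm (\1_(E k) : Omega -> R) by exact: bm_indic.
have ba k j : bm (avg k (u j)) by apply: hist_bm; exact: (bm_avg (leqnn k) (bu j)).
elim: n => [|n IH].
  have e1 w : \1_(E 0) w = 1 :> R by rewrite indicE mem_set.
  under eq_Rintegral => w _ do rewrite e1 mul1r.
  under [X in _ + lam * (1 - X)]eq_Rintegral => w _ do rewrite e1.
  rewrite Rint_prob_cst subrr mulr0 addr0 -[leRHS](Rint_prob_cst P).
  by apply: Rint_le => //; exact: bm_cst.
apply: le_trans IH.
have bEH : bm (\1_(E n.+1) : HT n -> R) by apply: bm_indic; exact: mEH.
rewrite avg_martingale//.
have b1 := bmM (bE n.+1) (ba n n).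
have ble : \int[P]_w (\1_(E n.+1) w * avg n (mstep n (u n.+1)) w) <=
    \int[P]_w (\1_(E n.+1) w * avg n (u n) w).
  apply: Rint_le => // [|w].
    apply: bmM => //; apply: hist_bm; exact: (bm_avg (leqnn n) (bm_mstep n (bu n.+1))).
  apply: ler_wpM2l; first by rewrite indicE.
  by apply: avg_le => //; exact: bm_mstep.
have b2 := bmZ lam (bE n.+1).
have b3 := bmZ lam (bE n).
have b4 := bmM (bE n) (ba n n).
have h : \int[P]_w (\1_(E n.+1) w * avg n (u n) w) + lam * \int[P]_w \1_(E n) w <=
   \int[P]_w (\1_(E n) w * avg n (u n) w) + lam * \int[P]_w \1_(E n.+1) w.
  rewrite -(RintZ fP lam (bE n)) -(RintZ fP lam (bE n.+1)) -(RintD fP b1 b3) -(RintD fP b4 b2).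
  apply: Rint_le => // [||w]; try exact: bmD.
  rewrite !indicE.
  have [wE|wE] := boolP (w \in E n.+1).
    have -> : w \in E n.
      by move: wE; rewrite !inE => wE k kn; apply: wE; exact: ltnW.
    by rewrite !mul1r.
  have [wE'|wE'] := boolP (w \in E n); last by rewrite !mul0r.
  rewrite mul0r mul1r mulr1 mulr0 add0r addr0 leNgt; apply: contra wE => wl.
  rewrite inE in wE'; rewrite inE => k.
  by rewrite ltnS leq_eqVlt => /orP[/eqP ->|/wE'].
have rearrange (x y l p q : R) : x + l * q <= y + l * p -> x + l * (1 - p) <= y + l * (1 - q) by lra.
by apply: le_trans (rearrange _ _ _ _ _ h); rewrite lerD2r.
Qed.

Lemma maximal_inequality c : (forall w, avg 0 (u 0) w <= c) ->
  measurable [set w | forall k, avg k (u k) w < lam] /\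
  (P (~` [set w | forall k, (avg k (u k) w < lam)%R]) <= (c / lam)%:E)%E.
Proof.
move=> c0.
have mE k : measurable (E k) by apply: (@hist_sub k); exact: mEH.
have EE : [set w | forall k, avg k (u k) w < lam] = \bigcap_k E k.
  apply/seteqP; split=> w /=; first by move=> h k _ j _; exact: h.
  by move=> h k; exact: (h k.+1).
split; first by rewrite EE; exact: bigcap_measurable.
rewrite EE setC_bigcap.
have mC k : measurable (~` E k) by exact: measurableC.
have nd : nondecreasing_seq (fun k => ~` E k).
  move=> k j kj; apply/subsetPset => w; apply: contra_not => h i ik.
  by apply: h; exact: leq_trans kj.
have cv := nondecreasing_cvg_mu (mu := P) mC (bigcup_measurable (fun k _ => mC k)) nd.
rewrite -(cvg_lim _ cv)//; apply: lime_le.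
  by apply/cvg_ex; eexists; exact: cv.
apply: nearW => n /=.
have h := maximal_step n c0.
have h0 : 0 <= \int[P]_w (\1_(E n) w * avg n (u n) w).
  by apply: Rintegral_ge0 => w _; rewrite mulr_ge0 ?indicE// avg_ge0.
rewrite probability_setC// -[P (E n)]fineK ?fin_num_measure//.
rewrite -Rint_indic// lee_fin ler_pdivlMr// mulrC.
lra.
Qed.

End maximal_inequality.

End polya.

(** * Concentration of the averages of a test function *)

Section exponential.
Context {R : realType}.

Lemma expR_taylor2 (u : R) : u <= 2^-1 -> expR u <= 1 + u + 2 * u ^+ 2.
Proof.
move=> u2; have h := expR_ge1Dx (- u).
have e0 := expR_gt0 u.
have e1 : expR u * expR (- u) = 1 by rewrite expRxMexpNx_1.
have {}h : expR u * (1 - u) <= 1 by rewrite -[leRHS]e1 ler_pM2l.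
have u1 : 0 < 1 - u by lra.
rewrite -(ler_pM2r u1) (le_trans h)//.
have -> : (1 + u + 2 * u ^+ 2) * (1 - u) = 1 + u ^+ 2 * (1 - 2 * u) by ring.
by rewrite lerDl mulr_ge0 ?sqr_ge0//; lra.
Qed.

End exponential.

Section concentration.
Context {R : realType} {dT dW : measure_display}.
Context {T : measurableType dT} {Omega : measurableType dW}.
Variables (P : probability Omega R) (M0 : {finite_measure set T -> \bar R}).
Variables (K : R.-pker T ~> T) (C : nat -> {RV P >-> T}).
Variable (M : nat -> Omega -> {measure set T -> \bar R}).
Hypothesis HM : is_mvpp M0 K C M.
Hypothesis M0pos : (0 < M0 setT)%E.

Notation mass := (mass M0).
Notation avg := (avg M0 M).
Notation mstep := (mstep M0 K).
Notation HT := (HT M).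

(** For u <= 1/2, exp u <= 1 + u + 2 u^2; here u = l (G - avg n G), whose mean is 0. *)
Lemma avg_hoeffding n (G : T -> R) l w : bm G -> (forall x, `|G x| <= 1) ->
  0 <= l <= 4^-1 ->
  avg n (fun x => expR (l * G x)) w * expR (- (l * avg n G w)) <= expR (8 * l ^+ 2).
Proof.
move=> bG G1 /andP[l0 l4].
set g := avg n G w.
have g1 : `|g| <= 1 by exact: (avg_norm HM M0pos).
have be : bm (fun x => expR (l * G x)) by apply: bm_expR; exact: bmZ.
have b1 : bm (fun x => expR (- (l * g)) * expR (l * G x)) by exact: bmZ.
rewrite mulrC -(avgZ HM)//.
apply: (@le_trans _ _ (avg n (fun x => l * (G x - g) + cst (1 + 8 * l ^+ 2) x) w)).
  have bGg : bm (fun x => G x - g) by apply: bmB => //; exact: bm_cst.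
  apply: (avg_le HM M0pos) => // [|x].
    by apply: bmD; [exact: bmZ|exact: bm_cst].
  rewrite -expRD /=.
  have Gg : `|G x - g| <= 2 by rewrite (le_trans (ler_normB _ _))// (_ : 2 = 1 + 1)// lerD.
  have -> : - (l * g) + l * G x = l * (G x - g) by ring.
  move: Gg; rewrite ler_norml => /andP[Gg1 Gg2].
  apply: (le_trans (expR_taylor2 _)); first by nra.
  have : (G x - g) ^+ 2 <= 4 by nra.
  have l20 : 0 <= l ^+ 2 by exact: sqr_ge0.
  by rewrite exprMn; nra.
rewrite (avg_lin HM) ?(avg_cst HM M0pos)//; [|by apply: bmB => //; exact: bm_cst|exact: bm_cst].
have -> : avg n (fun x => G x - g) w = 0.
  by rewrite (avgB HM _ _ bG (bm_cst g)) (avg_cst HM M0pos) subrr.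
by rewrite mulr0 add0r expR_ge1Dx.
Qed.

Lemma mass_inv n : 0 < (mass n.+1)^-1 <= n.+1%:R^-1.
Proof.
have := mass_gt0 M0pos n.+1; have := mass_ge M0pos n.+1 => h1 h2.
by rewrite invr_gt0 h2/= lef_pV2 ?posrE// ltW.
Qed.

(** An increment of the martingale avg k (g k) is bounded by 2 / mass k.+1, and the
    squares of these bounds have a sum that is small after a late time N: the
    fluctuations after time N are subgaussian with variance of order 1 / N. *)
Lemma exponential_moment N j (g : nat -> T -> R) lam :
  (0 < N)%N -> 0 <= lam <= N%:R / 4 ->
  (forall k, bm (g k)) -> (forall k x, `|g k x| <= 1) ->
  (forall k, (N <= k < N + j)%N -> g k = mstep k (g k.+1)) ->
  \int[P]_w expR (lam * (avg (N + j) (g (N + j)%N) w - avg N (g N) w)) <=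
  expR (8 * lam ^+ 2 * (N%:R^-1 - (N + j)%:R^-1)).
Proof.
move=> N0 /andP[l0 lN] bg g1; have fP := prob_fin P.
elim: j => [|j IH] gg.
  rewrite addn0 subrr mulr0 expR0.
  under eq_Rintegral => w _ do rewrite subrr mulr0 expR0.
  by rewrite Rint_prob_cst.
set k := (N + j)%N.
have sub i : (N <= i < N + j)%N -> (N <= i < N + j.+1)%N.
  by move=> /andP[-> h]; rewrite addnS ltnS ltnW.
have {}IH := IH (fun i ij => gg i (sub i ij)).
have gk : g k = mstep k (g k.+1) by apply: gg; rewrite /k leq_addr addnS ltnSn.
have Nk : (N <= k)%N by exact: leq_addr.
rewrite addnS -/k; rewrite -/k in IH.
set q := (mass k.+1)^-1; have /andP[q0 qk] := mass_inv k.
pose G := Kint K (g k.+1).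
have bG : bm G by exact: bm_Kint.
have G1 x : `|G x| <= 1.
  by have := kernel_Rint_norm (kernelK_mass K) x (bg k.+1) (g1 k.+1); rewrite mulr1.
have bav i f : (i <= k)%N -> bm f -> bm (avg i f : HT k -> R).
  by move=> ik bf; exact: (bm_avg HM ik bf).
pose U w := expR (lam * (avg k (g k) w - avg N (g N) w)).
pose U' w := U w * expR (- (lam * q * avg k G w)).
have bU : bm (U : HT k -> R).
  by apply: bm_expR; apply: bmZ; apply: bmB; apply: bav.
have bU' : bm (U' : HT k -> R).
  by apply: bmM => //; apply: bm_expR; apply: bmN; apply: bmZ; exact: bav.
have bF : bm (fun x => expR (lam * q * G x)) by apply: bm_expR; exact: bmZ.
have -> : \int[P]_w expR (lam * (avg k.+1 (g k.+1) w - avg N (g N) w)) =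
    \int[P]_w (U' w * expR (lam * q * G (C k w))).
  apply: eq_Rintegral => w _; rewrite /U' /U -!expRD; congr expR.
  rewrite gk (avg_succ HM M0pos)// (avg_mstep HM)// -/q -/G; ring.
rewrite (colour_integral HM M0pos bU' bF).
have lq : 0 <= lam * q <= 4^-1.
  rewrite mulr_ge0 ?(ltW q0)//=.
  have N0' : 0 < N%:R :> R by rewrite ltr0n.
  apply: (@le_trans _ _ (N%:R / 4 * N%:R^-1)); last by rewrite mulrAC divff ?mul1r// gt_eqF.
  apply: ler_pM => //; first exact: ltW.
  by rewrite (le_trans qk)// lef_pV2 ?posrE ?ltr0n// ler_nat leqW.
set b := expR (8 * (lam * q) ^+ 2).
apply: (@le_trans _ _ (\int[P]_w (b * U w))).
  apply: Rint_le => //.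
  - exact: (bmM (hist_bm HM bU') (hist_bm HM (bav _ _ (leqnn k) bF))).
  - by apply: bmZ; exact: (hist_bm HM bU).
  move=> w; rewrite /U' -mulrA mulrC; apply: ler_wpM2r; first exact: expR_ge0.
  by rewrite mulrC; exact: avg_hoeffding.
rewrite RintZ//; last exact: (hist_bm HM bU).
apply: (@le_trans _ _ (b * expR (8 * lam ^+ 2 * (N%:R^-1 - k%:R^-1)))).
  by apply: ler_wpM2l => //; exact: expR_ge0.
rewrite /b -expRD ler_expR exprMn mulrA -mulrDr.
apply: ler_wpM2l; first by rewrite mulr_ge0// sqr_ge0.
have k0 : 0 < k%:R :> R by rewrite ltr0n (leq_trans N0).
have k1 : 0 < k.+1%:R :> R by rewrite ltr0n.
(* the squares of the bounds telescope *)
have qq : q ^+ 2 <= k%:R^-1 - k.+1%:R^-1.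
  apply: (@le_trans _ _ (k.+1%:R^-1 ^+ 2)).
    have ik : 0 <= k.+1%:R^-1 :> R by rewrite invr_ge0 ltW.
    by apply: lerXn2r; rewrite ?nnegrE// ltW.
  rewrite -subr_ge0 -natr1 (_ : _ - _ = (k%:R * (k%:R + 1) ^+ 2)^-1).
    by rewrite invr_ge0 mulr_ge0// ?ltW// exprn_gt0// natr1.
  by field; rewrite !gt_eqF// natr1.
by rewrite addrCA lerD2l lerBlDr addrC.
Qed.

(** Chernoff bound for both signs of the increment, with the optimal exponent
    lam = eta N / 16. *)
Lemma avg_tail N j (g : nat -> T -> R) eta :
  (0 < N)%N -> 0 <= eta <= 1 ->
  (forall k, bm (g k)) -> (forall k x, `|g k x| <= 1) ->
  (forall k, (N <= k < N + j)%N -> g k = mstep k (g k.+1)) ->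
  (P [set w | (eta <= `|avg (N + j) (g (N + j)%N) w - avg N (g N) w|)%R] <=
  (2 * expR (- (eta ^+ 2 * N%:R / 32)))%:E)%E.
Proof.
move=> N0 /andP[e0 e1] bg g1 gg; have fP := prob_fin P.
pose D w := avg (N + j) (g (N + j)%N) w - avg N (g N) w.
have bD : bm D by apply: bmB; apply: (hist_bm HM); exact: (bm_avg HM (leqnn _)).
have N0' : 0 < N%:R :> R by rewrite ltr0n.
pose lam := eta * N%:R / 16.
have lam0 : 0 <= lam <= N%:R / 4.
  by rewrite /lam; apply/andP; split; nra.
have h1 := exponential_moment N0 lam0 bg g1 gg.
have gg' k : (N <= k < N + j)%N -> (fun x => - g k x) = mstep k (fun x => - g k.+1 x).
  move=> kj; rewrite (gg k kj) /mstep; apply/funext => x.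
  have -> : Kint K (fun x0 => - g k.+1 x0) x = - Kint K (g k.+1) x.
    have kf : (K x setT < +oo)%E by rewrite kernelK_mass ltry.
    rewrite -mulN1r -(RintZ kf (-1) (bg k.+1)).
    by apply: eq_Rintegral => y _; rewrite mulN1r.
  ring.
have h2 := exponential_moment N0 lam0 (fun k => bmN (bg k))
  (fun k x => eq_ind_r (fun z => z <= 1) (g1 k x) (normrN _)) gg'.
have bE s : bm (fun w => expR (s * D w)) by apply: bm_expR; exact: bmZ.
have {}h2 : \int[P]_w expR (- lam * D w) <= expR (8 * lam ^+ 2 * (N%:R^-1 - (N + j)%:R^-1)).
  apply: le_trans h2; rewrite le_eqVlt; apply/orP; left; apply/eqP; apply: eq_Rintegral => w _.
  by rewrite !(avgN HM)//; congr expR; rewrite /D; ring.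
have mA : measurable [set w | eta <= `|D w|].
  have mD : measurable_fun setT (fun w => `|D w|) by apply: measurableT_comp => //; exact: bD.1.
  exact: measurable_superlevel.
rewrite -[leLHS]fineK ?fin_num_measure// lee_fin -Rint_indic//.
pose B := expR (8 * lam ^+ 2 * (N%:R^-1 - (N + j)%:R^-1)).
apply: (@le_trans _ _ (\int[P]_w (expR (- (lam * eta)) * (expR (lam * D w) + expR (- lam * D w))))).
  apply: Rint_le => //; first exact: bm_indic.
    by apply: bmZ; exact: bmD.
  move=> w; rewrite mulrDr -!expRD indicE; case: (boolP (w \in _)); last first.
    by move=> _; rewrite addr_ge0// expR_ge0.
  rewrite inE/= => ew; have /andP[l00 _] := lam0.
  have [d0|d0] := leP 0 (D w).
    rewrite (le_trans _ (_ : expR (- (lam * eta) + lam * D w) <= _))//; last by rewrite lerDl expR_ge0.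
    rewrite -[leLHS]expR0 ler_expR; rewrite ger0_norm// in ew.
    by rewrite addrC subr_ge0; exact: ler_wpM2l.
  rewrite (le_trans _ (_ : expR (- (lam * eta) + - lam * D w) <= _))//; last by rewrite lerDr expR_ge0.
  rewrite -[leLHS]expR0 ler_expR; rewrite ltr0_norm// in ew.
by rewrite mulNr -mulrN addrC subr_ge0; exact: ler_wpM2l.
rewrite (RintZ fP _ (bmD (bE _) (bE _))) (RintD fP (bE _) (bE _)).
apply: (@le_trans _ _ (expR (- (lam * eta)) * (B + B))).
  by apply: ler_wpM2l; [exact: expR_ge0|exact: lerD].
have -> : B + B = 2 * B by ring.
rewrite mulrCA; apply: ler_wpM2l => //; rewrite /B -expRD ler_expR.
apply: (@le_trans _ _ (- (lam * eta) + 8 * lam ^+ 2 * N%:R^-1)).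
  rewrite lerD2l; apply: ler_wpM2l; first by rewrite mulr_ge0// sqr_ge0.
  by rewrite gerBl invr_ge0.
rewrite /lam le_eqVlt; apply/orP; left; apply/eqP; field.
by rewrite gt_eqF.
Qed.

End concentration.

(** * Smooth test functions *)

Section smooth_real.
Context {R : realType}.
Implicit Types (u e a q : R) (g : R -> R).

Definition smooth1 g := exists c : R, 0 <= c /\ forall u, `|g u| <= c /\
  exists g1 g2 : R, [/\ `|g1| <= c, `|g2| <= c &
    forall e, `|g (u + e) - g u - g1 * e - g2 * e ^+ 2| <= c * `|e| ^+ 3].

Lemma smooth1_affine g a q : smooth1 g -> smooth1 (fun u => g (a * (u - q))).
Proof.
move=> [c [c0 H]]; pose A := 1 + `|a| + `|a| ^+ 2 + `|a| ^+ 3.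
have a0 : 0 <= `|a| by [].
have [A1 Aa A2 A3] : [/\ 1 <= A, `|a| <= A, `|a| ^+ 2 <= A & `|a| ^+ 3 <= A].
  have a2 : 0 <= `|a| ^+ 2 by exact: exprn_ge0.
  have a3 : 0 <= `|a| ^+ 3 by exact: exprn_ge0.
  by rewrite /A; split; lra.
exists (c * A); split; first by rewrite mulr_ge0// (le_trans _ A1).
move=> u; have [gc [g1 [g2 [h1 h2 h3]]]] := H (a * (u - q)); split.
  by rewrite (le_trans gc)// ler_peMr.
exists (g1 * a), (g2 * a ^+ 2); split.
- by rewrite normrM ler_pM.
- by rewrite normrM normrX ler_pM// exprn_ge0.
- move=> e; have := h3 (a * e).
  have -> : a * (u + e - q) = a * (u - q) + a * e by ring.
  rewrite normrM [(`|a| * _) ^+ 3]exprMn.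
  have -> : g1 * (a * e) = g1 * a * e by ring.
  have -> : g2 * (a * e) ^+ 2 = g2 * a ^+ 2 * e ^+ 2 by ring.
  move/le_trans; apply; rewrite mulrA; apply: ler_wpM2r; first exact: exprn_ge0.
  exact: ler_wpM2l.
Qed.

Definition pos u : R := Num.max 0 u.

Lemma posP u : (0 <= u /\ pos u = u) \/ (u <= 0 /\ pos u = 0).
Proof.
rewrite /pos; have [u0|/ltW u0] := leP 0 u; first by left.
by right.
Qed.

Lemma pos_ge0 u : 0 <= pos u.
Proof. by rewrite le_max lexx. Qed.

Lemma pos_cube_taylor u e :
  `|pos (u + e) ^+ 3 - pos u ^+ 3 - 3 * pos u ^+ 2 * e - 3 * pos u * e ^+ 2| <= `|e| ^+ 3.
Proof.
rewrite -normrX.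
have cube_le (x y : R) : x <= y -> x ^+ 3 <= y ^+ 3.
  move=> xy; rewrite -subr_ge0 (_ : _ - _ = (y - x) * ((y + x / 2) ^+ 2 + 3 / 4 * x ^+ 2)); last by field.
  by rewrite mulr_ge0 ?subr_ge0// addr_ge0 ?sqr_ge0// mulr_ge0// sqr_ge0.
case: (posP u) => -[u0 ->]; case: (posP (u + e)) => -[v0 ->].
- by rewrite (_ : _ - _ = e ^+ 3)//; ring.
- rewrite (_ : _ - _ = e ^+ 3 - (u + e) ^+ 3); last by ring.
  have h1 : e ^+ 3 <= (u + e) ^+ 3 by apply: cube_le; lra.
  have h2 : (u + e) ^+ 3 <= 0 by rewrite -[leRHS](expr0n _ 3); exact: cube_le.
  by rewrite ler0_norm ?ler0_norm; lra.
- rewrite (_ : _ - _ = (u + e) ^+ 3); last by ring.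
  have h1 : (u + e) ^+ 3 <= e ^+ 3 by apply: cube_le; lra.
  have h2 : 0 <= (u + e) ^+ 3 by exact: exprn_ge0.
  by rewrite ger0_norm ?ger0_norm; lra.
- by rewrite (_ : _ - _ = 0) ?normr0//; ring.
Qed.

(** The cubic B-spline with knots -2, -1, 0, 1, 2 (times 6): it is positive on ]-2, 2[,
    vanishes elsewhere, and has a Lipschitz second derivative. *)
Definition spline u : R := pos (u + 2) ^+ 3 - 4 * pos (u + 1) ^+ 3 + 6 * pos u ^+ 3
  - 4 * pos (u - 1) ^+ 3 + pos (u - 2) ^+ 3.

Lemma spline_pos u : `|u| < 2 -> 0 < spline u.
Proof.
rewrite ltr_norml => /andP[u1 u2]; rewrite /spline.
case: (posP (u + 2)) => -[? ->]; case: (posP (u + 1)) => -[? ->];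
 case: (posP u) => -[? ->]; case: (posP (u - 1)) => -[? ->];
 case: (posP (u - 2)) => -[? ->]; try lra.
- rewrite (_ : _ + _ = (2 - u) ^+ 3); last by ring.
  by rewrite exprn_gt0// subr_gt0.
- rewrite (_ : _ + _ = 1 + 3 * ((1 - u) * (1 + u * (1 - u)))); last by ring.
  have h : 0 <= 1 - u by lra.
  have h' : 0 <= u * (1 - u) by exact: mulr_ge0.
  by rewrite ltr_wpDr// mulr_ge0// mulr_ge0//; lra.
- rewrite (_ : _ + _ = 1 + 3 * ((1 + u) * (1 + (- u) * (1 + u)))); last by ring.
  have h : 0 <= 1 + u by lra.
  have h' : 0 <= - u * (1 + u) by apply: mulr_ge0 => //; lra.
  by rewrite ltr_wpDr// mulr_ge0// mulr_ge0//; lra.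
- rewrite (_ : _ + _ = (u + 2) ^+ 3); last by ring.
  by rewrite exprn_gt0//; lra.
Qed.

Lemma spline_out u : 2 <= `|u| -> spline u = 0.
Proof.
move=> u2; have {u2} : u <= -2 \/ 2 <= u.
  by move: u2; have [u0|u0] := leP 0 u; [rewrite ger0_norm//; right|rewrite ltr0_norm//; left; lra].
rewrite /spline; case: (posP (u + 2)) => -[? ->]; case: (posP (u + 1)) => -[? ->];
 case: (posP u) => -[? ->]; case: (posP (u - 1)) => -[? ->];
 case: (posP (u - 2)) => -[? ->] => -[?|?]; try (exfalso; lra); try ring.
- have -> : u = 2 by lra.
  by ring.
- have -> : u = -2 by lra.
  by ring.
Qed.

Lemma spline_ge0 u : 0 <= spline u.
Proof.
have [u2|u2] := leP 2 `|u|; first by rewrite spline_out.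
by rewrite ltW// spline_pos.
Qed.

Lemma pos_le u b : 0 <= b -> u <= b -> 0 <= pos u <= b.
Proof. by move=> b0 ub; rewrite pos_ge0 /pos ge_max b0. Qed.

Lemma spline_le u : spline u <= 112.
Proof.
have [u2|u2] := leP 2 `|u|; first by rewrite spline_out.
move: u2; rewrite ltr_norml => /andP[u1 u2].
have b0 (v b : R) : 0 <= b -> v <= b -> 0 <= pos v ^+ 3 <= b ^+ 3.
  move=> b0 vb; have /andP[p0 pb] := pos_le b0 vb.
  by rewrite exprn_ge0//= lerXn2r// nnegrE.
(* on [-2, 2], 4 ^ 3 and 6 * 2 ^ 3 bound the two terms with a positive sign *)
have /andP[_ p1] : 0 <= pos (u + 2) ^+ 3 <= 4 ^+ 3 by apply: b0; lra.
have /andP[p2 _] : 0 <= pos (u + 1) ^+ 3 <= 3 ^+ 3 by apply: b0; lra.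
have /andP[_ p3] : 0 <= pos u ^+ 3 <= 2 ^+ 3 by apply: b0; lra.
have /andP[p4 _] : 0 <= pos (u - 1) ^+ 3 <= 1 ^+ 3 by apply: b0; lra.
have /andP[_ p5] : 0 <= pos (u - 2) ^+ 3 <= 0 ^+ 3 by apply: b0; lra.
by rewrite /spline; lra.
Qed.

Lemma spline_smooth : smooth1 spline.
Proof.
have [c [c0 c1]] : exists c : R, 0 <= c /\ 500 <= c by exists 500; split; [exact: ler0n|exact: lexx].
exists c; split => // u; split.
  by rewrite ger0_norm ?spline_ge0// (le_trans (spline_le u))//; lra.
pose D k := pos (u + 2) ^+ k - 4 * pos (u + 1) ^+ k + 6 * pos u ^+ k
  - 4 * pos (u - 1) ^+ k + pos (u - 2) ^+ k.
have Db k : (0 < k < 3)%N -> `|D k| <= 150.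
  move=> /andP[k0 k3]; have [u2|u2] := leP u 2; last first.
    (* no truncation is active to the right of the support *)
    have e (v : R) : 0 <= v -> pos v = v by move=> v0; case: (posP v) => -[? ->]//; lra.
    rewrite /D !e; try lra.
    have {k0 k3} [->|->] : k = 1%N \/ k = 2%N by lia.
      by rewrite (_ : _ + _ = 0) ?normr0//; ring.
    by rewrite (_ : _ + _ = 0) ?normr0//; ring.
  have b0 (v b : R) : 0 <= b -> v <= b -> 0 <= pos v ^+ k <= 1 + b ^+ 2.
    move=> b0 vb; have /andP[p0 pb] := pos_le b0 vb.
    rewrite exprn_ge0//=.
    have {k0 k3} [->|->] : k = 1%N \/ k = 2%N by lia.
      by rewrite expr1; have := sqr_ge0 (b - 1); rewrite sqrrB1 -mulr_natr; nra.
    by rewrite (le_trans (_ : _ <= b ^+ 2)) ?lerDr// lerXn2r// nnegrE.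
  have /andP[q1 p1] : 0 <= pos (u + 2) ^+ k <= 1 + 4 ^+ 2 by apply: b0; lra.
  have /andP[q2 p2] : 0 <= pos (u + 1) ^+ k <= 1 + 3 ^+ 2 by apply: b0; lra.
  have /andP[q3 p3] : 0 <= pos u ^+ k <= 1 + 2 ^+ 2 by apply: b0; lra.
  have /andP[q4 p4] : 0 <= pos (u - 1) ^+ k <= 1 + 1 ^+ 2 by apply: b0; lra.
  have /andP[q5 p5] : 0 <= pos (u - 2) ^+ k <= 1 + 0 ^+ 2 by apply: b0; lra.
  by rewrite /D ler_norml; apply/andP; split; lra.
(* first derivative, and half of the second derivative *)
exists (3 * D 2%N), (3 * D 1%N); split.
- by rewrite normrM ger0_norm//; have := Db 2%N isT; lra.
- by rewrite normrM ger0_norm//; have := Db 1%N isT; lra.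
- move=> e.
  have h1 := pos_cube_taylor (u + 2) e; have h2 := pos_cube_taylor (u + 1) e.
  have h3 := pos_cube_taylor u e; have h4 := pos_cube_taylor (u - 1) e.
  have h5 := pos_cube_taylor (u - 2) e.
  have e3 : 0 <= `|e| ^+ 3 by exact: exprn_ge0.
  rewrite /spline /D !expr1.
  have -> : u + e + 2 = u + 2 + e by ring.
  have -> : u + e + 1 = u + 1 + e by ring.
  have -> : u + e - 1 = u - 1 + e by ring.
  have -> : u + e - 2 = u - 2 + e by ring.
  have := ler_wpM2r e3 c1.
  move: h1 h2 h3 h4 h5; set E := `|e| ^+ 3.
  rewrite !ler_norml => /andP[? ?] /andP[? ?] /andP[? ?] /andP[? ?] /andP[? ?] ?.
  apply/andP; split; lra.
Qed.

End smooth_real.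

Section smooth_vector.
Context {R : realType} {d : nat}.
Notation V := 'rV[R]_d.
Implicit Types (x y : V) (h : V -> R).

Definition expansion h (c : R) x (l : 'I_d -> R) (H : 'I_d -> 'I_d -> R) := forall y,
  [/\ `|lform l y| <= c * `|y|, `|qform H y| <= c * `|y| ^+ 2 &
    `|h (x + y) - h x - lform l y - qform H y| <= c * `|y| ^+ 3].

(** A substitute for bounded derivatives up to order three that is stable by products and
    by rescaling. *)
Definition smooth h := exists c : R, [/\ 0 <= c, forall x, `|h x| <= c &
  forall x, exists l H, expansion h c x l H].

(** Close to x this follows from the expansion, and far from x from the bound on h. *)
Lemma expansion_increment h c x l H y : 0 <= c -> (forall x, `|h x| <= c) ->
  expansion h c x l H ->
  `|h (x + y) - h x| <= 3 * c * `|y| /\ `|h (x + y) - h x - lform l y| <= 3 * c * `|y| ^+ 2.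
Proof.
move=> c0 hc /(_ y)[e1 e2 e3].
set D := h (x + y) - h x in e3 *; set L := lform l y in e1 e3 *.
set Q := qform H y in e2 e3.
have D2 : `|D| <= 2 * c.
  by rewrite (le_trans (ler_normB _ _))// (_ : 2 * c = c + c) ?lerD//; ring.
have y0 : 0 <= `|y| by exact: normr_ge0.
move: y0 e1 e2 e3; set r := `|y| => r0 e1 e2 e3.
have DL : `|D - L| <= c * r ^+ 2 + c * r ^+ 3.
  have -> : D - L = Q + (D - L - Q) by ring.
  by rewrite (le_trans (ler_normD _ _))// lerD.
have [r1|/ltW r1] := leP r 1.
  have r21 : r ^+ 2 <= r by rewrite expr2 ler_piMl.
  have r32 : r ^+ 3 <= r ^+ 2 by rewrite exprSr ler_piMr// exprn_ge0.
  have c32 : c * r ^+ 3 <= c * r ^+ 2 by exact: ler_wpM2l.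
  have c21 : c * r ^+ 2 <= c * r by exact: ler_wpM2l.
  have DD : `|D| <= `|L| + `|D - L|.
    by rewrite -{1}(subrK L D) addrC; exact: ler_normD.
  have cr2 : 0 <= c * r ^+ 2 by rewrite mulr_ge0// exprn_ge0.
  split; lra.
have r2 : r <= r ^+ 2 by rewrite expr2 ler_peMl.
have cr : c <= c * r by rewrite ler_peMr.
have c21 : c * r <= c * r ^+ 2 by exact: ler_wpM2l.
have h2 : `|D - L| <= `|D| + `|L| by exact: ler_normB.
split; lra.
Qed.

Lemma smooth_lipschitz h : smooth h ->
  exists c, 0 <= c /\ forall x y, `|h (x + y) - h x| <= c * `|y|.
Proof.
move=> [c [c0 hc H]]; exists (3 * c); split; first by rewrite mulr_ge0.
by move=> x y; have [l [H' e]] := H x; exact: (expansion_increment y c0 hc e).1.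
Qed.

Lemma lformD l l' y : lform (fun i => l i + l' i) y = lform l y + lform l' y.
Proof. by rewrite /lform -big_split/=; apply: eq_bigr => i _; rewrite mulrDl. Qed.

Lemma lformZ a l y : lform (fun i => a * l i) y = a * lform l y.
Proof. by rewrite /lform mulr_sumr; apply: eq_bigr => i _; rewrite mulrA. Qed.

Lemma qformD H H' y : qform (fun i j => H i j + H' i j) y = qform H y + qform H' y.
Proof.
rewrite /qform -big_split/=; apply: eq_bigr => i _; rewrite -big_split/=.
by apply: eq_bigr => j _; rewrite mulrDl.
Qed.

Lemma qformZ a H y : qform (fun i j => a * H i j) y = a * qform H y.
Proof.
rewrite /qform mulr_sumr; apply: eq_bigr => i _; rewrite mulr_sumr.
by apply: eq_bigr => j _; rewrite -mulrA.
Qed.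

Lemma qform_tensor l l' y : qform (fun i j => l i * l' j) y = lform l y * lform l' y.
Proof.
rewrite /qform /lform mulr_suml; apply: eq_bigr => i _; rewrite mulr_sumr.
by apply: eq_bigr => j _; ring.
Qed.

Lemma smooth_cst a : smooth (cst a).
Proof.
exists `|a|; split => // x; exists (fun=> 0), (fun _ _ => 0) => y.
have -> : lform (fun=> 0) y = 0 by rewrite /lform big1// => i _; rewrite mul0r.
have -> : qform (fun _ _ => 0) y = 0.
  by rewrite /qform big1// => i _; rewrite big1// => j _; rewrite mul0r.
by rewrite /= subrr !subr0 normr0; split; apply: mulr_ge0 => //; exact: exprn_ge0.
Qed.

(** The expansions multiply; the product of the two linear parts contributes to the
    quadratic part. *)
Lemma smoothM h h' : smooth h -> smooth h' -> smooth (fun x => h x * h' x).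
Proof.
move=> [c [c0 hc Hc]] [c' [c0' hc' Hc']].
pose k := 30 * (c * c').
have cc : 0 <= c * c' by exact: mulr_ge0.
exists k; split; first by rewrite mulr_ge0.
  by move=> x; rewrite normrM (le_trans (ler_pM _ _ (hc x) (hc' x)))// /k; lra.
move=> x; have [l [H E]] := Hc x; have [l' [H' E']] := Hc' x.
exists (fun i => h x * l' i + h' x * l i).
exists (fun i j => h x * H' i j + h' x * H i j + l i * l' j) => y.
rewrite lformD !lformZ 2!qformD !qformZ qform_tensor.
have [i1 i2] := expansion_increment y c0 hc E.
have [i1' i2'] := expansion_increment y c0' hc' E'.
have [e1 e2 e3] := E y; have [e1' e2' e3'] := E' y.
have b := hc x; have b' := hc' x.
have y0 : 0 <= `|y| by exact: normr_ge0.
move: i1 i2 i1' i2' e1 e2 e3 e1' e2' e3' b b' y0.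
set r := `|y|; set D := h (x + y) - h x; set D' := h' (x + y) - h' x.
set L := lform l y; set L' := lform l' y; set Q := qform H y; set Q' := qform H' y.
set a := h x; set a' := h' x.
move=> i1 i2 i1' i2' e1 e2 e3 e1' e2' e3' b b' r0.
have r20 : 0 <= r ^+ 2 by exact: exprn_ge0.
have r30 : 0 <= r ^+ 3 by exact: exprn_ge0.
have M u v s t : `|u| <= s -> `|v| <= t -> `|u * v| <= s * t :> R.
  by move=> us vt; rewrite normrM ler_pM.
have cr n : 0 <= c * c' * r ^+ n by rewrite mulr_ge0// exprn_ge0.
split.
- rewrite (le_trans (ler_normD _ _))// (le_trans (lerD (M _ _ _ _ b e1') (M _ _ _ _ b' e1)))//.
  by have := cr 1%N; rewrite expr1 /k; lra.
- rewrite (le_trans (ler_normD _ _))//.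
  rewrite (le_trans (lerD (ler_normD _ _) (lexx _)))//.
  rewrite (le_trans (lerD (lerD (M _ _ _ _ b e2') (M _ _ _ _ b' e2)) (M _ _ _ _ e1 e1')))//.
  by have := cr 2%N; rewrite /k; lra.
- have -> : h (x + y) * h' (x + y) - a * a' - (a * L' + a' * L) - (a * Q' + a' * Q + L * L') =
     a * (D' - L' - Q') + a' * (D - L - Q) + (D * (D' - L') + (D - L) * L').
    by rewrite /D /D' -/a -/a'; ring.
  rewrite (le_trans (ler_normD _ _))//.
  rewrite (le_trans (lerD (ler_normD _ _) (ler_normD _ _)))//.
  rewrite (le_trans (lerD (lerD (M _ _ _ _ b e3') (M _ _ _ _ b' e3))
    (lerD (M _ _ _ _ i1 i2') (M _ _ _ _ i2 e1'))))//.
  have := cr 3%N; rewrite /k.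
  have -> : 3 * c * r * (3 * c' * r ^+ 2) = 9 * (c * c' * r ^+ 3) by ring.
  have -> : 3 * c * r ^+ 2 * (c' * r) = 3 * (c * c' * r ^+ 3) by ring.
  have -> : c * (c' * r ^+ 3) = c * c' * r ^+ 3 by ring.
  have -> : c' * (c * r ^+ 3) = c * c' * r ^+ 3 by ring.
  by lra.
Qed.

Lemma smooth_onem h : smooth h -> smooth (fun x => 1 - h x).
Proof.
move=> [c [c0 hc Hc]]; exists (1 + c); split; first by rewrite addr_ge0.
  by move=> x; rewrite (le_trans (ler_normB _ _))// normr1 lerD2l.
move=> x; have [l [H E]] := Hc x.
exists (fun i => -1 * l i), (fun i j => -1 * H i j) => y; have [e1 e2 e3] := E y.
rewrite lformZ qformZ !mulN1r !normrN; split.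
- by rewrite (le_trans e1)// ler_wpM2r// lerDr.
- by rewrite (le_trans e2)// ler_wpM2r ?exprn_ge0// lerDr.
- have -> : 1 - h (x + y) - (1 - h x) - - lform l y - - qform H y =
    - (h (x + y) - h x - lform l y - qform H y) by ring.
  by rewrite normrN (le_trans e3)// ler_wpM2r ?exprn_ge0// lerDr.
Qed.

Lemma smooth_prod (I : Type) (s : seq I) (h : I -> V -> R) : (forall i, smooth (h i)) ->
  smooth (fun x => \prod_(i <- s) h i x).
Proof.
move=> hs; elim: s => [|i s IH].
  have -> : (fun x => \prod_(i <- [::]) h i x) = cst 1 by apply/funext => x; rewrite big_nil.
  exact: smooth_cst.
have -> : (fun x => \prod_(j <- i :: s) h j x) = (fun x => h i x * \prod_(j <- s) h j x).
  by apply/funext => x; rewrite big_cons.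
exact: smoothM.
Qed.

Lemma smooth_coord g i : smooth1 g -> smooth (fun x => g (x ord0 i)).
Proof.
move=> [c [c0 H]]; exists c; split => // [x|x]; first exact: (H _).1.
have [_ [g1 [g2 [h1 h2 h3]]]] := H (x ord0 i).
exists (fun j => g1 * (j == i)%:R), (fun j k => g2 * ((j == i)%:R * (k == i)%:R)) => y.
have lE : lform (fun j => (j == i)%:R) y = y ord0 i.
  rewrite /lform (bigD1 i)//= eqxx mul1r big1 ?addr0// => j ji.
  by rewrite (negbTE ji) mul0r.
rewrite lformZ qformZ qform_tensor lE; have yi := norm_coord_le y i.
have yi2 : `|y ord0 i| ^+ 2 <= `|y| ^+ 2 by rewrite lerXn2r// nnegrE.
have yi3 : `|y ord0 i| ^+ 3 <= `|y| ^+ 3 by rewrite lerXn2r// nnegrE.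
split.
- by rewrite normrM ler_pM.
- by rewrite -expr2 normrM normrX ler_pM// exprn_ge0.
- rewrite mxE -expr2 (le_trans (h3 _))//; exact: ler_wpM2l.
Qed.

Lemma smooth_continuous h : smooth h -> continuous h.
Proof.
move=> /smooth_lipschitz[c [c0 hc]] x A /nbhs_ballP[e /= e0 eA].
have c1 : 0 < c + 1 by rewrite ltr_wpDl.
apply/nbhs_ballP; exists (e / (c + 1)) => /=; first by rewrite divr_gt0.
move=> y; rewrite -ball_normE/= => xy; apply: eA; rewrite -ball_normE/=.
have -> : y = x + (y - x) by rewrite addrC subrK.
rewrite distrC (le_lt_trans (hc _ _))// (@le_lt_trans _ _ ((c + 1) * `|y - x|))//.
  by apply: ler_wpM2r => //; rewrite lerDl.
by rewrite mulrC -ltr_pdivlMr// distrC.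
Qed.

Lemma smooth_bm h : smooth h -> bm h.
Proof.
move=> hs; split; first exact: (continuous_measurable_rV (smooth_continuous hs)).
by have [c [_ hc _]] := hs; exists c.
Qed.

(** A smooth function seen at scale a has derivatives of order k of size a^-k. *)
Lemma smooth_rescale h : smooth h -> exists c, 0 <= c /\ forall (a : R) (b : V), 0 < a ->
  taylor (c / a ^+ 2) (c / a ^+ 3) (fun x => h (rescale a b x)).
Proof.
move=> [c [c0 hc Hc]]; exists c; split => // a b a0 x.
have [l [H E]] := Hc (rescale a b x).
exists (fun i => a^-1 * l i), (fun i j => a^-1 ^+ 2 * H i j) => y.
have [e1 e2 e3] := E (a^-1 *: y).
have rE : rescale a b (x + y) = rescale a b x + a^-1 *: y.
  by rewrite /rescale -scalerDr addrAC.
have lE : lform (fun i => a^-1 * l i) y = lform l (a^-1 *: y).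
  by apply: eq_bigr => i _; rewrite mxE; ring.
have qE : qform (fun i j => a^-1 ^+ 2 * H i j) y = qform H (a^-1 *: y).
  by apply: eq_bigr => i _; apply: eq_bigr => j _; rewrite !mxE; ring.
have nE k : c * `|a^-1 *: y| ^+ k = c / a ^+ k * `|y| ^+ k.
  by rewrite normrZ gtr0_norm ?invr_gt0// exprMn exprVn mulrA.
by rewrite lE qE rE -!nE; split.
Qed.

End smooth_vector.

(** * Weak convergence tested on smooth functions *)

Section smooth_bumps.
Context {R : realType} {d : nat}.
Notation V := 'rV[R]_d.
Notation idx := ('rV[rat]_d * nat)%type.
Implicit Types (x : V) (qn : idx) (s : seq idx).

Definition box qn := [set x : V | forall i, `|x ord0 i - ratr (qn.1 ord0 i)| < qn.2.+1%:R^-1].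

Definition bump qn x : R :=
  \prod_i (spline (2 * qn.2.+1%:R * (x ord0 i - ratr (qn.1 ord0 i))) * 112^-1).

Lemma smooth_bump qn : smooth (bump qn).
Proof.
apply: smooth_prod => i; apply: smoothM; last exact: smooth_cst.
exact: (smooth_coord i (smooth1_affine _ _ spline_smooth)).
Qed.

Lemma bump_itv qn x : 0 <= bump qn x <= 1.
Proof.
rewrite /bump; apply/andP; split.
  by apply: prodr_ge0 => i _; rewrite mulr_ge0 ?spline_ge0// invr_ge0.
apply: prodr_ile1 => i _; rewrite mulr_ge0 ?spline_ge0 ?invr_ge0//=.
by rewrite ler_pdivrMr ?mul1r ?spline_le.
Qed.

Lemma bump_scaleE n (u : R) : (`|2 * n.+1%:R * u| < 2) = (`|u| < n.+1%:R^-1).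
Proof.
rewrite normrM (ger0_norm (_ : 0 <= 2 * n.+1%:R)) ?mulr_ge0// -mulrA.
by rewrite gtr_pMr// mulrC -ltr_pdivlMr// mul1r.
Qed.

Lemma bump_in qn x : box qn x -> 0 < bump qn x.
Proof.
move=> xb; apply: prodr_gt0 => i _; rewrite mulr_gt0 ?invr_gt0//.
by apply: spline_pos; rewrite bump_scaleE; exact: xb.
Qed.

Lemma bump_out qn x : ~ box qn x -> bump qn x = 0.
Proof.
move=> /existsNP[i /negP]; rewrite -leNgt => xi.
rewrite /bump (bigD1 i)//= spline_out ?mul0r//.
by rewrite leNgt bump_scaleE -leNgt.
Qed.

(** When more and more bumps are taken, each of them repeatedly, this increases to the
    indicator of the union of their supports. *)
Definition hits s x : R := 1 - \prod_(qn <- s) (1 - bump qn x).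

Lemma smooth_hits s : smooth (hits s).
Proof. by apply: smooth_onem; apply: smooth_prod => qn; apply: smooth_onem; exact: smooth_bump. Qed.

Lemma miss_itv s x : 0 <= \prod_(qn <- s) (1 - bump qn x) <= 1.
Proof.
have h qn : 0 <= 1 - bump qn x <= 1 by have := bump_itv qn x; lra.
apply/andP; split; first by apply: prodr_ge0 => qn _; have /andP[] := h qn.
by apply: prodr_ile1 => qn _.
Qed.

Lemma hits_itv s x : 0 <= hits s x <= 1.
Proof. by have := miss_itv s x; rewrite /hits; lra. Qed.

Lemma hits_out (U : set V) s x : (forall qn, qn \in s -> box qn `<=` U) -> ~ U x -> hits s x = 0.
Proof.
move=> sU Ux; rewrite /hits big_seq big1 ?subrr// => qn qs.
by rewrite bump_out ?subr0// => /(sU _ qs).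
Qed.

Lemma box_in_open (U : set V) x : open U -> U x -> exists qn, box qn x /\ box qn `<=` U.
Proof.
move=> oU Ux.
have /nbhs_ballP[e /= e0 xeU] : nbhs x U by exact: open_nbhs_nbhs.
have [n ne] : exists n : nat, n.+1%:R^-1 + n.+1%:R^-1 < e.
  have e20 : 0 < e / 2 by rewrite divr_gt0.
  have [n _ /(_ n (leqnn n)) ne] := near_infty_natSinv_lt (PosNum e20).
  by exists n; rewrite [e]splitr ltrD.
have /choice[q Hq] : forall i, exists q : rat, `|x ord0 i - ratr q| < n.+1%:R^-1.
  move=> i; have [|q] := @rat_in_itvoo R (x ord0 i - n.+1%:R^-1) (x ord0 i + n.+1%:R^-1).
    by rewrite ltrBlDr -addrA ltrDl addr_gt0 // invr_gt0 ltr0n.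
  by rewrite in_itv/= => xq; exists q; rewrite distrC ltr_distl.
exists (\row_i q i, n); split=> [i|y /= yq]; first by rewrite mxE.
apply: xeU; split=> // j i; rewrite (ord1 j); apply: le_lt_trans ne.
rewrite (le_trans (ler_distD (ratr (q i)) _ _))// lerD ?ltW//.
by have := yq i; rewrite mxE distrC.
Qed.

Definition inner_boxes (U : set V) (J : nat) : seq idx :=
  [seq qn <- pmap unpickle (iota 0 J) | `[< box qn `<=` U >]].

Lemma inner_boxes_sub (U : set V) J qn :
  qn \in flatten (nseq J (inner_boxes U J)) -> box qn `<=` U.
Proof. by move=> /flattenP[t /nseqP[-> _]]; rewrite mem_filter => /andP[/asboolP]. Qed.

(** Each box inside U is repeated J times, so that at a point of such a box the product
    of the complements is at most a J-th power of a number below 1. *)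
Lemma hits_cvg (U : set V) x : open U ->
  hits (flatten (nseq J (inner_boxes U J))) x @[J --> \oo] --> (\1_U x : R).
Proof.
move=> oU.
have [Ux|Ux] := pselect (U x); last first.
  rewrite indicE memNset//; apply: cvg_near_cst; apply: nearW => J.
  by apply: hits_out Ux => qn; exact: inner_boxes_sub.
rewrite indicE mem_set// /hits -[X in _ --> X]subr0.
apply: cvgB; first exact: cvg_cst.
have [qn [xb bU]] := box_in_open oU Ux.
have b0 := bump_in xb; have /andP[_ b1] := bump_itv qn x.
have g0 : (1 - bump qn x) ^+ J @[J --> \oo] --> (0 : R).
  by apply: cvg_expr; rewrite ger0_norm ?subr_ge0// gtrBl.
apply: (squeeze_cvgr _ (cvg_cst _) g0).
near=> J; have /andP[-> _ /=] := miss_itv (flatten (nseq J (inner_boxes U J))) x.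
have qJ : qn \in inner_boxes U J.
  rewrite mem_filter asboolT//= mem_pmap; apply/mapP; exists (pickle qn); last by rewrite pickleK.
  by rewrite mem_iota/= add0n; near: J; exact: nbhs_infty_gt.
have hI : \prod_(q <- inner_boxes U J) (1 - bump q x) <= 1 - bump qn x.
  rewrite (perm_big _ (perm_to_rem qJ))/= big_cons ler_piMr ?subr_ge0//.
  by have /andP[] := miss_itv (rem qn (inner_boxes U J)) x.
have /andP[I0 _] := miss_itv (inner_boxes U J) x.
have key j : \prod_(q <- flatten (nseq j (inner_boxes U J))) (1 - bump q x) <= (1 - bump qn x) ^+ j.
  elim: j => [|j IH] /=; first by rewrite big_nil expr0.
  rewrite big_cat/= exprS ler_pM//.
  by have /andP[] := miss_itv (flatten (nseq j (inner_boxes U J))) x.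
exact: key.
Unshelve. all: by end_near. Qed.

Lemma hits_approx (nu : probability V R) (U : set V) e : open U -> 0 < e -> exists s : seq idx,
  (forall x, hits s x <= \1_U x) /\ \int[nu]_x \1_U x - e <= \int[nu]_x hits s x.
Proof.
move=> oU e0; have mU := open_measurable_rV oU.
have bU : bm (\1_U : V -> R) by exact: bm_indic.
pose h J := hits (flatten (nseq J (inner_boxes U J))).
have bh J : bm (h J) by apply: smooth_bm; exact: smooth_hits.
have hle J x : h J x <= \1_U x.
  have [Ux|Ux] := pselect (U x).
    by rewrite indicE mem_set//; have /andP[] := hits_itv (flatten (nseq J (inner_boxes U J))) x.
  by rewrite /h (hits_out _ Ux) ?indicE ?memNset// => qn; exact: inner_boxes_sub.
have cv : (\int[nu]_x (h J x)%:E @[J --> \oo] --> \int[nu]_x (\1_U x)%:E)%E.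
  apply: (@dominated_cvg _ _ _ nu setT measurableT (fun J x => (h J x)%:E)
    (fun x => (\1_U x)%:E) (cst 1%E)) => //.
  - by move=> J; apply/measurable_EFinP; exact: (bh J).1.
  - move=> x _; apply: cvg_EFin; first exact: nearW.
    exact: hits_cvg.
  - exact: (bm_integrable (prob_fin nu) (bm_cst 1)).
  - move=> J x _; rewrite /= lee_fin ger0_norm; first by have /andP[] := hits_itv (flatten (nseq J (inner_boxes U J))) x.
    by have /andP[] := hits_itv (flatten (nseq J (inner_boxes U J))) x.
have {}cv : \int[nu]_x h J x @[J --> \oo] --> \int[nu]_x \1_U x.
  have := fine_cvg (a := \int[nu]_x \1_U x); rewrite /Rintegral; apply.
  by rewrite fineK//; exact: (integrable_fin_num measurableT (bm_integrable (prob_fin nu) bU)).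
have /cvgrPdist_le/(_ e e0) := cv.
case=> J _ /(_ J (leqnn J)) /= hJ.
exists (flatten (nseq J (inner_boxes U J))); split; first exact: hle.
by move: hJ; rewrite -/(h J) ler_norml => /andP[_]; lra.
Qed.

End smooth_bumps.

Section portmanteau.
Context {R : realType} {d : nat}.
Notation V := 'rV[R]_d.
Variables (mu : nat -> {measure set V -> \bar R}) (nu : probability V R).
Hypothesis mu_fin : forall n, (mu n setT < +oo)%E.
Hypothesis mu_mass : fine (mu n setT) @[n --> \oo] --> (1 : R).
Hypothesis mu_hits : forall s, \int[mu n]_x hits s x @[n --> \oo] --> \int[nu]_x hits s x.
Implicit Types f : V -> R.

Lemma continuous_bm f : continuous f -> (exists c, forall x, `|f x| <= c) -> bm f.
Proof. by move=> cf fc; split => //; exact: continuous_measurable_rV. Qed.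

(** Up to 1 / (k + 1), f is the average G of the indicators of its superlevel sets.
    These are open, so that they have lower approximations by the test functions
    hits, whose integrals converge. *)
Lemma weak_liminf f e : continuous f -> (forall x, 0 <= f x <= 1) -> 0 < e ->
  \forall n \near \oo, \int[nu]_x f x - e <= \int[mu n]_x f x.
Proof.
move=> cf f01 e0.
have bf : bm f.
  by apply: bm_itv01 => //; exact: continuous_measurable_rV.
have [k _ /(_ k (leqnn k)) ke] := near_infty_natSinv_lt (PosNum (divr_gt0 e0 (ltr0n R 8))).
rewrite /= in ke; set K := k.+1%:R in ke; have K0 : 0 < K by [].
pose U (i : 'I_k.+1) := [set x | 1 - i.+1%:R / K < f x].
have oU i : open (U i).
  by move/continuousP : cf => /(_ _ (rray_open (1 - i.+1%:R / K))); rewrite preimage_itvoy.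
have mU i := open_measurable_rV (oU i).
have /choice[s Hs] i := hits_approx nu (oU i) (divr_gt0 e0 (ltr0n R 4)).
pose G x := \sum_(i < k.+1) K^-1 * \1_(U i) x.
pose H x := \sum_(i < k.+1) K^-1 * hits (s i) x.
have fG x : `|f x - G x| <= K^-1.
  have g01 : 0 <= 1 - f x <= 1 by have := f01 x; lra.
  have := step_approx k g01; rewrite -/K.
  have -> : G x = 1 - \sum_(i < k.+1) K^-1 * ((i.+1%:R / K <= 1 - f x)%R : bool)%:R.
    have S1 : \sum_(i < k.+1) K^-1 = 1 :> R.
      by rewrite sumr_const card_ord -mulr_natr mulVf// gt_eqF.
    rewrite -[X in _ = X - _]S1 -sumrB; apply: eq_bigr => i _.
    rewrite indicE (_ : (x \in U i) = ~~ (i.+1%:R / K <= 1 - f x)).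
      by case: (i.+1%:R / K <= 1 - f x)%R; rewrite /= ?mulr1 ?mulr0 ?subrr ?subr0.
    rewrite -ltNge; apply/idP/idP; rewrite inE /U/=; set q := i.+1%:R / K; clearbody q => ?; lra.
  by rewrite distrC; set S := \sum_(i < _) _ => h; rewrite (_ : f x - (1 - S) = S - (1 - f x))//; ring.
have bh i : bm (hits (s i)) by apply: smooth_bm; exact: smooth_hits.
have bi i : bm (\1_(U i) : V -> R) by exact: bm_indic.
have bsum (g : 'I_k.+1 -> V -> R) : (forall i, bm (g i)) -> bm (fun x => \sum_(i < k.+1) K^-1 * g i x).
  move=> bg; elim: (index_enum _) => [|i r IH].
    by rewrite (_ : (fun _ => _) = cst 0); [exact: bm_cst|apply/funext => x; rewrite big_nil].
  rewrite (_ : (fun _ => _) = (fun x => K^-1 * g i x + \sum_(j <- r) K^-1 * g j x)).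
    by apply: bmD => //; exact: bmZ.
  by apply/funext => x; rewrite big_cons.
have bG : bm G by exact: bsum.
have bH : bm H by exact: bsum.
have intsum (m : {measure set V -> \bar R}) (g : 'I_k.+1 -> V -> R) : (m setT < +oo)%E ->
    (forall i, bm (g i)) ->
    \int[m]_x (\sum_(i < k.+1) K^-1 * g i x) = \sum_(i < k.+1) K^-1 * \int[m]_x g i x.
  move=> fm bg; rewrite Rint_sum; last by move=> i; apply: (bm_integrable fm); exact: bmZ.
  by apply: eq_bigr => i _; rewrite (RintZ fm).
have JH : \int[mu n]_x H x @[n --> \oo] --> \int[nu]_x H x.
  rewrite (intsum nu _ (prob_fin nu))//.
  rewrite (_ : (fun n => _) = (fun n => \sum_(i < k.+1) K^-1 * \int[mu n]_x hits (s i) x)).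
    elim: (index_enum _) => [|i r IH].
      by under eq_fun do rewrite big_nil; rewrite big_nil; exact: cvg_cst.
    under eq_fun do rewrite big_cons; rewrite big_cons.
    by apply: cvgD IH; apply: cvgMr; exact: mu_hits.
  by apply/funext => n; rewrite (intsum (mu n)).
have HG x : H x <= G x.
  by apply: ler_sum => i _; apply: ler_wpM2l; [rewrite invr_ge0 ltW|exact: (Hs i).1].
have JHG : \int[nu]_x G x - e / 4 <= \int[nu]_x H x.
  rewrite (intsum nu _ (prob_fin nu))// (intsum nu _ (prob_fin nu))//.
  have -> : e / 4 = \sum_(i < k.+1) K^-1 * (e / 4).
    by rewrite sumr_const card_ord -[RHS]mulr_natl -/K mulVKf// gt_eqF.
  rewrite -sumrB; apply: ler_sum => i _; rewrite -mulrBr.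
  by apply: ler_wpM2l; [rewrite invr_ge0 ltW|exact: (Hs i).2].
have JfG : `|\int[nu]_x f x - \int[nu]_x G x| <= K^-1 by exact: Rint_prob_dist.
have e40 : 0 < e / 4 by rewrite divr_gt0.
near=> n.
have h1 : `|\int[nu]_x H x - \int[mu n]_x H x| <= e / 4.
  by near: n; move/cvgrPdist_le : JH; exact.
have h2 : fine (mu n setT) <= 2.
  have : `|1 - fine (mu n setT)| <= 1 by near: n; move/cvgrPdist_le : mu_mass; exact.
  by rewrite ler_norml => /andP[]; lra.
have bfK : bm (fun x => f x + K^-1) by apply: bmD => //; exact: bm_cst.
have h3 : \int[mu n]_x H x <= \int[mu n]_x f x + K^-1 * fine (mu n setT).
  rewrite -(Rint_cst (mu n)) -(RintD (mu_fin n) bf (bm_cst K^-1)).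
  apply: (Rint_le (mu_fin n)) => // x; rewrite (le_trans (HG x))//=.
  by move: (fG x); rewrite ler_norml => /andP[h _]; move: h; rewrite lerNl opprB lerBlDr addrC.
have h4 : K^-1 * fine (mu n setT) <= K^-1 * 2 by apply: ler_wpM2l => //; rewrite invr_ge0 ltW.
have {h3 h4} h5 := le_trans h3 (lerD (lexx _) h4).
move: h1 JfG JHG h5 ke; rewrite !ler_norml; clear -k.
set k1 := K^-1; set If := Rintegral nu _ f; set Ig := Rintegral nu _ G.
set Ih := Rintegral nu _ H; set Jf := Rintegral _ _ f; set Jh := Rintegral _ _ H.
clearbody k1 If Ig Ih Jf Jh => /andP[? ?] /andP[? ?] ? ? ?; lra.
Unshelve. all: by end_near. Qed.

(** Lower bounds for f and for 1 - f together give convergence. *)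
Lemma weak_cvg_smooth : weak_cvg mu nu.
Proof.
have lim01 f : continuous f -> (forall x, 0 <= f x <= 1) ->
    \int[mu n]_x f x @[n --> \oo] --> \int[nu]_x f x.
  move=> cf f01.
  have bf : bm f.
    by apply: bm_itv01 => //; exact: continuous_measurable_rV.
  apply/cvgrPdist_le => e e0; have e20 : 0 < e / 2 by rewrite divr_gt0.
  have c1f : continuous (fun x => 1 - f x).
    by move=> x; apply: (@continuousB _ R^o V (cst 1) f x); [exact: cst_continuous|exact: cf].
  have f01' x : 0 <= 1 - f x <= 1 by have := f01 x; lra.
  have h1 := weak_liminf cf f01 e0; have h2 := weak_liminf c1f f01' e20.
  near=> n; rewrite ler_norml.
  have g1 : \int[nu]_x f x - e <= \int[mu n]_x f x by near: n.
  have g2 : \int[nu]_x (1 - f x) - e / 2 <= \int[mu n]_x (1 - f x) by near: n.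
  have g3 : `|1 - fine (mu n setT)| <= e / 2 by near: n; move/cvgrPdist_le : mu_mass; exact.
  move: g2; rewrite (RintB (mu_fin n) (bm_cst 1) bf) (RintB (prob_fin nu) (bm_cst 1) bf).
  rewrite Rint_prob_cst Rint_cst mul1r.
  move: g3; rewrite ler_norml => /andP[? ?] ?.
  by apply/andP; split; lra.
move=> f cf [c [_ fc]].
pose B := `|c| + 1.
have B0 : 0 < B by rewrite ltr_wpDl.
have fB x : `|f x| <= B.
  by apply: fc => //; rewrite /B ltr_pwDr// ler_norm.
have bf : bm f by apply: continuous_bm => //; exists B.
pose g x := (2 * B)^-1 * (f x + B).
have B20 : 0 < 2 * B by rewrite mulr_gt0.
have cg : continuous g.
  move=> x; apply: (@continuousM R V (cst (2 * B)^-1) (fun x => f x + B) x); first exact: cst_continuous.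
  by apply: (@continuousD _ R^o V f (cst B) x); [exact: cf|exact: cst_continuous].
have g01 x : 0 <= g x <= 1.
  have := fB x; rewrite ler_norml => /andP[? ?].
  rewrite /g mulrC ler_pdivrMr// mul1r; apply/andP; split; last by lra.
  by rewrite divr_ge0 ?(ltW B20)//; lra.
have bg : bm g by apply: bmZ; apply: bmD => //; exact: bm_cst.
have fE (m : {measure set V -> \bar R}) : (m setT < +oo)%E -> \int[m]_x f x = 2 * B * \int[m]_x g x - B * fine (m setT).
  move=> fm; rewrite -(RintZ fm _ bg) -Rint_cst -(RintB fm (bmZ _ bg) (bm_cst B)).
  by apply: eq_Rintegral => x _; rewrite /g /=; field; rewrite gt_eqF.
rewrite (int_bm_fin (prob_fin nu) bf).
rewrite (_ : (fun n => _) = (fun n => (\int[mu n]_x f x)%:E)); last first.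
  by apply/funext => n; rewrite (int_bm_fin (mu_fin n) bf).
apply: cvg_EFin; first exact: nearW.
rewrite [X in _ --> X](fE nu (prob_fin nu)).
rewrite (_ : _ \o _ = (fun n => 2 * B * \int[mu n]_x g x - B * fine (mu n setT))); last first.
  by apply/funext => n /=; rewrite fE.
have -> : fine (nu setT) = 1 by rewrite probability_setT.
by apply: cvgB; apply: cvgMr; [exact: lim01|exact: mu_mass].
Unshelve. all: by end_near. Qed.

End portmanteau.

(** * The time scale of the restart *)

Section time_scale.
Context {R : realType}.
Implicit Types (n k : nat) (x t : R).

Definition lg n : nat := trunc_log 2 n.
(** The restart time N is chosen between two constraints: it is large compared to
    ln n, so that exp (- c N) is summable for every c, and it is a power of ln n,
    so that the colours drawn up to time N are close to their starting point on
    the scale sqrt (ln n). *)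
Definition restart n : nat := (lg n ^ 2)%N.
Definition qroot n : R := Num.sqrt (Num.sqrt (lg n)%:R).
Definition scale n : R := Num.sqrt (ln n%:R).

Lemma qroot_ge0 n : 0 <= qroot n.
Proof. exact: sqrtr_ge0. Qed.

Lemma qroot4 n : qroot n ^+ 4 = (lg n)%:R.
Proof. by rewrite (exprM _ 2 2) sqr_sqrtr ?sqrtr_ge0// sqr_sqrtr. Qed.

Lemma lg_ge k n : (2 ^ k <= n)%N -> (k <= lg n)%N.
Proof. by move=> kn; rewrite /lg -[k in (k <= _)%N](@trunc_expnK 2)// leq_trunc_log. Qed.

Lemma lg_bounds n : (0 < n)%N -> (2 ^ lg n <= n)%N /\ (n.+1 <= 2 ^ (lg n).+1)%N.
Proof. by move=> n0; split; [exact: trunc_logP|exact: trunc_log_ltn]. Qed.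

Lemma qroot_large (B : R) : \forall n \near \oo, B <= qroot n.
Proof.
have [k Bk] : exists k : nat, `|B| <= k%:R.
  by exists (Num.truncn `|B|).+1; rewrite ltW// truncnS_gt.
exists (2 ^ (k ^ 4))%N => // n /= /lg_ge kn.
rewrite (le_trans (ler_norm B))// (le_trans Bk)//.
rewrite -(@ler_pXn2r _ 4)// ?nnegrE ?qroot_ge0// qroot4 -natrX ler_nat.
exact: kn.
Qed.

Lemma lg_gt0_near : \forall n \near \oo, (0 < lg n)%N.
Proof. by exists 2%N => // n /= n2; apply: (@lg_ge 1). Qed.

Lemma ln2_bounds : 2^-1 <= ln (2 : R) <= 1.
Proof.
apply/andP; split.
  have h : (2 : R)^-1 = 1 + - 2^-1 by field.
  have : expR (- 2^-1) >= (2:R)^-1 by rewrite {1}h expR_ge1Dx.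
  rewrite expRN lef_pV2 ?posrE ?expR_gt0// => h2.
  by rewrite -(expRK (2^-1)) ler_ln ?posrE ?expR_gt0.
rewrite -[leRHS](expRK 1) ler_ln ?posrE ?expR_gt0//.
exact: (expR_ge1Dx (1 : R)).
Qed.

Lemma ln_lg n : (0 < n)%N -> (lg n)%:R / 2 <= ln (n%:R : R) <= (lg n).+1%:R.
Proof.
move=> n0; have [h1 h2] := lg_bounds n0; have /andP[l1 l2] := ln2_bounds.
have n0' : 0 < n%:R :> R by rewrite ltr0n.
have lnX k : ln ((2 ^ k)%:R : R) = k%:R * ln 2.
  by rewrite natrX lnXn// mulr_natl.
apply/andP; split.
  apply: (@le_trans _ _ ((lg n)%:R * ln 2)); first by rewrite ler_wpM2l.
  by rewrite -lnX ler_ln ?posrE ?ltr0n ?expn_gt0// ler_nat.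
apply: (@le_trans _ _ ((lg n).+1%:R * ln 2)); last by rewrite ler_piMr.
by rewrite -lnX ler_ln ?posrE ?ltr0n ?expn_gt0// ler_nat ltnW.
Qed.

Lemma scale_ge n : (0 < n)%N -> qroot n ^+ 2 / 2 <= scale n.
Proof.
move=> n0; have /andP[h _] := ln_lg n0.
have q0 : 0 <= qroot n ^+ 2 / 2 by rewrite divr_ge0// exprn_ge0// qroot_ge0.
rewrite -(ger0_norm q0) -sqrtr_sqr ler_wsqrtr// (le_trans _ h)// -qroot4.
have -> : (qroot n ^+ 2 / 2) ^+ 2 = qroot n ^+ 4 / 4 by field.
have := exprn_ge0 4 (qroot_ge0 n); lra.
Qed.

Lemma scale_sqr n : (0 < n)%N -> scale n ^+ 2 = ln n%:R.
Proof. by move=> n0; rewrite sqr_sqrtr// ln_ge0// ler1n. Qed.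

(** ** Eighth roots *)

(** The expected distance of the colours from the origin is bounded by a small power of
    the time. The eighth root of the restart time is of order (ln n)^(1/4), hence
    negligible with respect to sqrt (ln n). *)
Definition root8 x : R := Num.sqrt (Num.sqrt (Num.sqrt x)).

Lemma root8_ge0 x : 0 <= root8 x.
Proof. exact: sqrtr_ge0. Qed.

Lemma root8_exp x : 0 <= x -> root8 x ^+ 8 = x.
Proof.
move=> x0; rewrite (exprM _ 2 4) sqr_sqrtr ?sqrtr_ge0// (exprM _ 2 2) sqr_sqrtr ?sqrtr_ge0//.
by rewrite sqr_sqrtr.
Qed.

Lemma root8_inj_le x y : 0 <= x -> 0 <= y -> x <= y ^+ 8 -> root8 x <= y.
Proof.
by move=> x0 y0 xy; rewrite -(@ler_pXn2r _ 8)// ?nnegrE ?root8_ge0// root8_exp.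
Qed.

Lemma root8_ge1 x : 1 <= x -> 1 <= root8 x.
Proof. by move=> x1; rewrite -[leLHS]sqrtr1 ler_wsqrtr// -[leLHS]sqrtr1 ler_wsqrtr// -[leLHS]sqrtr1 ler_wsqrtr. Qed.

Lemma ln_root8 x : 1 <= x -> ln x <= 8 * root8 x.
Proof.
move=> x1; have x0 : 0 <= x by apply: le_trans x1.
have r0 : 0 < root8 x by apply: lt_le_trans (root8_ge1 x1).
by rewrite -{1}(root8_exp x0) lnXn// -[leLHS]mulr_natl ler_wpM2l// ltW// ln_sublinear.
Qed.

Lemma root8_restart (c : R) n : 1 <= c -> (0 < lg n)%N ->
  root8 (c + (restart n)%:R) <= 2 * c * qroot n.
Proof.
move=> c1 l0; have c0 : 0 <= c by apply: le_trans c1.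
apply: root8_inj_le; [by rewrite addr_ge0|by rewrite mulr_ge0 ?qroot_ge0// mulr_ge0|].
have -> : (2 * c * qroot n) ^+ 8 = 2 ^+ 8 * c ^+ 8 * (qroot n ^+ 4) ^+ 2 by ring.
rewrite qroot4 /restart natrX; set L := (lg n)%:R.
have L1 : 1 <= L ^+ 2 :> R by rewrite expr_ge1// ?ler1n.
have c8 : c <= c ^+ 8 by rewrite ler_eXnr.
have c81 : 1 <= c ^+ 8 by apply: le_trans c8.
have h : 2 * c ^+ 8 * L ^+ 2 <= 2 ^+ 8 * c ^+ 8 * L ^+ 2.
  apply: ler_wpM2r; first by apply: le_trans L1.
  apply: ler_wpM2r; first by apply: le_trans c81.
  by rewrite -natrX ler_nat.
apply: le_trans h; have := ler_pM ler01 ler01 c81 L1; nra.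
Qed.

(** On [0, 1], sqrt (1 + t) is at least 1 + t/3; this is used three times. *)
Lemma root8_growth t : 0 <= t <= 1 -> 1 + t / 27 <= root8 (1 + t).
Proof.
have h s : 0 <= s <= 1 -> 1 + s / 3 <= Num.sqrt (1 + s).
  move=> /andP[s0 s1].
  have p : 0 <= 1 + s / 3 by lra.
  rewrite -(ger0_norm p) -sqrtr_sqr ler_wsqrtr//; nra.
move=> /andP[t0 t1].
have h1 : 1 + t / 3 <= Num.sqrt (1 + t) by apply: h; rewrite t0.
have h2 : 1 + t / 9 <= Num.sqrt (1 + t / 3).
  by rewrite (_ : t / 9 = t / 3 / 3); [apply: h; lra|field].
have h3 : 1 + t / 27 <= Num.sqrt (1 + t / 9).
  by rewrite (_ : t / 27 = t / 9 / 3); [apply: h; lra|field].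
by rewrite (le_trans h3)// ler_wsqrtr// (le_trans h2)// ler_wsqrtr.
Qed.

Lemma root8M x y : 0 <= x -> root8 (x * y) = root8 x * root8 y.
Proof. by move=> x0; rewrite /root8 !sqrtrM ?sqrtr_ge0. Qed.

(** A lazy step of rate q multiplies the expected distance, in suitable units, by at
    most 1 + q / 27; the growth of the eighth root absorbs this factor. *)
Lemma root8_step k (q : R) : 0 <= q <= k.+1%:R^-1 ->
  root8 k.+1%:R * (1 + q / 27) <= root8 k.+2%:R.
Proof.
move=> /andP[q0 qk]; have k0 : 0 < k.+1%:R :> R by [].
have -> : k.+2%:R = k.+1%:R * (1 + k.+1%:R^-1) :> R.
  by rewrite mulrDr mulr1 mulfV ?gt_eqF// natr1.
rewrite root8M ?ler0n//; apply: ler_wpM2l; first exact: root8_ge0.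
apply: (@le_trans _ _ (1 + k.+1%:R^-1 / 27)); first by rewrite lerD2l ler_pM2r.
by apply: root8_growth; rewrite invr_ge0 ltW//= invf_le1// ler1n.
Qed.

(** ** Harmonic sums *)

Lemma ln_step x : 0 < x -> (x + 1)^-1 <= ln (x + 1) - ln x <= x^-1.
Proof.
move=> x0; have x1 : 0 < x + 1 by rewrite addr_gt0.
rewrite -ln_div ?posrE//; apply/andP; split; last first.
  have -> : (x + 1) / x = 1 + x^-1 by field; rewrite gt_eqF.
  rewrite -[leRHS]expRK ler_ln ?posrE ?expR_gt0 ?addr_gt0 ?invr_gt0//.
  exact: expR_ge1Dx.
have h := expR_ge1Dx (- (x + 1)^-1).
have e : 1 + - (x + 1)^-1 = x / (x + 1) by field; rewrite gt_eqF.
rewrite e expRN in h.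
rewrite -(expRK (x + 1)^-1) ler_ln ?posrE ?expR_gt0 ?divr_gt0//.
rewrite -[leLHS]invrK -[leRHS]invrK lef_pV2 ?posrE ?invr_gt0 ?expR_gt0 ?divr_gt0//.
by rewrite invf_div.
Qed.

Lemma harmonic_bounds (al : R) N j : 0 < al ->
  ln (al + (N + j).+1%:R) - ln (al + N.+1%:R) <= \sum_(i < j) (al + (N + i).+1%:R)^-1
    <= ln (al + (N + j)%:R) - ln (al + N%:R).
Proof.
move=> al0; elim: j => [|j /andP[IH1 IH2]].
  by rewrite big_ord0 addn0 !subrr lexx.
rewrite big_ord_recr/= addnS.
have x0 : 0 < al + (N + j)%:R by rewrite ltr_wpDr.
have x1 : 0 < al + (N + j).+1%:R by rewrite ltr_wpDr.
have /andP[h1 _] := ln_step x0; have /andP[_ h2] := ln_step x1.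
rewrite -addrA natr1 in h1; rewrite -addrA natr1 in h2.
by apply/andP; split; lra.
Qed.

(** The number of steps that the lazy walk makes between the restart and time n is
    ln n up to a smaller order than its standard deviation sqrt (ln n). *)
Lemma clock_error (al : R) : 0 < al -> exists C, 0 <= C /\ \forall n \near \oo,
  [/\ (restart n <= n)%N, (0 < lg n)%N &
  `|\sum_(i < n - restart n) (al + (restart n + i).+1%:R)^-1 - ln n%:R| <= C * qroot n].
Proof.
move=> al0; exists (al + 16 * (al + 1)); split; first by lra.
near=> n.
have l4 : (4 <= lg n)%N by near: n; exists (2 ^ 4)%N => // n /= ; exact: lg_ge.
have n0 : (0 < n)%N by near: n; exact: nbhs_infty_gt.
have l0 : (0 < lg n)%N by apply: leq_trans l4.
have [h1 _] := lg_bounds n0.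
have Nn : (restart n <= n)%N.
  apply: leq_trans h1; rewrite /restart.
  elim: (lg n) l4 => // l IH; rewrite leq_eqVlt => /orP[/eqP <-//|l4].
  have {}IH := IH l4; have : (l.+1 ^ 2 <= 2 * l ^ 2)%N by rewrite !expnS !expn0; nia.
  by move/leq_trans; apply; rewrite [in leqRHS]expnS leq_mul.
split => //.
have := harmonic_bounds (restart n) (n - restart n) al0; rewrite subnKC//.
set P := \sum_(i < _) _ => /andP[P1 P2].
have n0' : 0 < n%:R :> R by rewrite ltr0n.
have N1 : (1 <= restart n)%N by rewrite /restart expn_gt0 l0.
have N1' : 1 <= (restart n)%:R :> R by rewrite ler1n.
have q1 : 1 <= qroot n.
  by rewrite /qroot -[leLHS]sqrtr1 ler_wsqrtr// -[leLHS]sqrtr1 ler_wsqrtr// ler1n.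
have a1 : ln (al + n%:R) <= ln n%:R + al.
  have -> : al + n%:R = n%:R * (1 + al / n%:R) by field; rewrite gt_eqF.
  have p : 0 < 1 + al / n%:R by rewrite addr_gt0// divr_gt0.
  rewrite lnM ?posrE// lerD2l.
  apply: (@le_trans _ _ (al / n%:R)).
    rewrite -[leRHS]expRK ler_ln ?posrE ?expR_gt0//; exact: expR_ge1Dx.
  rewrite ler_pdivrMr//; apply: ler_peMr; first exact: ltW.
  by rewrite ler1n.
have a2 : ln n%:R <= ln (al + n.+1%:R).
  rewrite ler_ln ?posrE ?addr_gt0//.
  by rewrite -natr1 addrCA lerDl addr_ge0// ltW.
have a3 : 0 <= ln (al + (restart n)%:R) by apply: ln_ge0; rewrite ler_wpDl// ltW.
have a4 : ln (al + (restart n).+1%:R) <= 16 * (al + 1) * qroot n.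
  have c1 : 1 <= al + 1 by rewrite lerDr ltW.
  have h := root8_restart c1 l0.
  have e : al + (restart n).+1%:R = al + 1 + (restart n)%:R by rewrite -natr1 -addrA [1 + _]addrC.
  rewrite e (le_trans (ln_root8 _))//; first by rewrite ler_wpDr.
  by have := ler_wpM2l (ler0n R 8) h; lra.
have a5 : al <= al * qroot n by rewrite ler_peMr// ltW.
have a6 : 0 <= 16 * (al + 1) * qroot n by rewrite !mulr_ge0 ?qroot_ge0// addr_ge0// ltW.
rewrite ler_norml mulrDl; apply/andP; split; lra.
Unshelve. all: by end_near. Qed.

End time_scale.

(** * The walk seen from the restart time *)

Section lazy_walk.
Context {R : realType} {d : nat} {dO : measure_display} {O : measurableType dO}.
Notation V := 'rV[R]_d.
Variables (Q : probability O R) (X : O -> V) (m : V) (G2 : 'I_d -> 'I_d -> R) (k3 : R).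
Hypothesis mQ : moments Q X (fun i => m ord0 i) G2 k3.
Variables (vs : seq V) (k3' : R).
Notation nu := (gaussv vs).
Hypothesis mnu : moments nu id (fun=> 0) G2 k3'.
Variable al : R.
Hypothesis al0 : 0 < al.
Implicit Types (f h : V -> R) (x y z : V) (n k j : nat).

Let mX : measurable_fun setT X. Proof. exact: mom_meas mQ. Qed.

Notation lazy := (lazy Q X).

Definition rate k : R := (al + k.+1%:R)^-1.

Lemma rate_bounds k : 0 < rate k <= k.+1%:R^-1.
Proof.
have k0 : 0 < k.+1%:R :> R by [].
have a0 : 0 < al + k.+1%:R by rewrite addr_gt0.
by rewrite invr_gt0 a0 lef_pV2 ?posrE// lerDr ltW.
Qed.

Lemma rate01 k : 0 <= rate k <= 1.
Proof.
have /andP[r0 r1] := rate_bounds k; rewrite ltW//= (le_trans r1)// invf_le1//.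
by rewrite ler1n.
Qed.

Lemma lazy_norm p f c x : 0 <= p <= 1 -> bm f -> (forall y, `|f y| <= c) -> `|lazy p f x| <= c.
Proof.
move=> /andP[p0 p1] bf fc.
have h : `|Kop Q X f x| <= c.
  by apply: Rint_prob_norm => [|w]; [exact: bm_shift|exact: fc].
rewrite (le_trans (ler_normD _ _))// !normrM (ger0_norm p0) ger0_norm ?subr_ge0//.
have -> : c = (1 - p) * c + p * c by ring.
by rewrite lerD// ler_wpM2l// subr_ge0.
Qed.

Lemma lazy_iter_norm k j f c x : bm f -> (forall y, `|f y| <= c) ->
  `|lazy_iter Q X rate k j f x| <= c.
Proof.
move=> bf fc; elim: j k x => [|j IH] k x /=; first exact: fc.
apply: lazy_norm => //; [exact: rate01|exact: (bm_lazy_iter mQ)].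
Qed.

Lemma lazy_shift p f x y : lazy p f (x + y) = lazy p (fun z => f (z + y)) x.
Proof.
have e : Kop Q X f (x + y) = Kop Q X (fun z => f (z + y)) x.
  by apply: eq_Rintegral => w _; rewrite addrAC.
by congr (_ + _ * _).
Qed.

Lemma bm_shift_cst f y : bm f -> bm (fun z => f (z + y)).
Proof.
move=> bf; apply: (bm_comp _ bf); apply: measurable_addrV; first exact: measurable_id.
exact: measurable_cst.
Qed.

(** The walk is translation invariant, so that its iterates have the moduli of
    continuity of the initial function. *)
Lemma lazy_iter_modulus k j f y e x : bm f -> (forall x, `|f (x + y) - f x| <= e) ->
  `|lazy_iter Q X rate k j f (x + y) - lazy_iter Q X rate k j f x| <= e.
Proof.
move=> bf fe; elim: j k x => [|j IH] k x /=; first exact: fe.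
have b := bm_lazy_iter mQ rate k.+1 j bf.
rewrite lazy_shift; apply: (lazy_dist mQ) => //; first exact: rate01.
exact: bm_shift_cst.
Qed.

(** Up to the difference between the clock p and a^2, the Gaussian step of length p
    is the Gaussian law at scale a around the drift. *)
Lemma gop_clock h c p a : smooth h -> 0 <= c -> (forall x y, `|h (x + y) - h x| <= c * `|y|) ->
  0 <= p -> 1 <= a ->
  `|gop m vs p (fun x => h (rescale a (a ^+ 2 *: m) x)) 0 - \int[nu]_z h z| <=
  c * (`|p - a ^+ 2| / a) * (`|m| + (1 + k3')).
Proof.
move=> sh c0 hc p0 a1; have a0 : 0 < a by apply: lt_le_trans a1.
have bh := smooth_bm sh.
have [i1 e1] := moments_norm mnu.
have ic := bm_integrable (prob_fin nu) (bm_cst `|m|).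
set D := `|p - a ^+ 2| / a.
have D0 : 0 <= D by rewrite divr_ge0// ltW.
pose F z := h (rescale a (a ^+ 2 *: m) (0 + (p *: m + Num.sqrt p *: z))).
have bF : bm F.
  have b1 : bm (fun x => h (rescale a (a ^+ 2 *: m) x)).
    exact: (bm_comp (measurable_rescale _ _) bh).
  exact: (bm_shift 0 (measurable_drift m p) b1).
have FE z : `|F z - h z| <= c * D * (`|m| + `|z|).
  have -> : F z = h (z + (((p - a ^+ 2) / a) *: m + (Num.sqrt p / a - 1) *: z)).
    congr h; apply/rowP => i; rewrite !mxE; field.
    by rewrite gt_eqF.
  rewrite (le_trans (hc _ _))// -mulrA; apply: ler_wpM2l => //.
  rewrite (le_trans (ler_normD _ _))// !normrZ.
  rewrite normfV (gtr0_norm a0) mulrDr lerD2l.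
  apply: ler_wpM2r => //.
  have s0 : 0 <= Num.sqrt p by exact: sqrtr_ge0.
  have -> : Num.sqrt p / a - 1 = (p - a ^+ 2) / (a * (Num.sqrt p + a)).
    rewrite -{2}(sqr_sqrtr p0); field.
    by rewrite !gt_eqF// ltr_wpDl.
  rewrite normrM normfV (ger0_norm (_ : 0 <= a * _)); last by rewrite mulr_ge0 ?addr_ge0// ltW.
  apply: ler_wpM2l => //; rewrite lef_pV2 ?posrE// ?mulr_gt0 ?ltr_wpDl//.
  apply: ler_peMr; first exact: ltW.
  by rewrite (le_trans a1)// lerDr.
have ii := integrable_scale (c * D) (integrable_addr ic i1).
have -> : gop m vs p (fun x => h (rescale a (a ^+ 2 *: m) x)) 0 - \int[nu]_z h z = \int[nu]_z (F z - h z).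
  by rewrite (RintB (prob_fin nu) bF bh).
have iFh := bm_integrable (prob_fin nu) (bmB bF bh).
rewrite (le_trans (le_normr_Rintegral _ iFh))//.
apply: (@le_trans _ _ (\int[nu]_z (c * D * (`|m| + `|z|)))).
  apply: le_Rintegral => //; exact: integrable_norm iFh.
rewrite (RintegralZl _ measurableT (integrable_addr ic i1)) (RintegralD measurableT ic i1).
rewrite Rint_prob_cst; apply: ler_wpM2l; first exact: mulr_ge0.
by rewrite lerD2l.
Qed.

(** The test function seen at time n on the right scale; expected h n k is the function of
    a colour of time k whose averages form the martingale that ends with the observed
    average at time n. *)
Definition observed h n x : R := h (rescale (scale n) (ln n%:R *: m) x).
Definition expected h n : nat -> V -> R := fun k => lazy_iter Q X rate k (n - k) (observed h n).

(** On the scale sqrt (ln n) the third-order errors have a sum of order (ln n)^(-1/2), and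
    the distance from the clock to ln n is small compared to the scale. *)
Lemma restart_limit h : smooth h -> exists B, 0 <= B /\
  \forall n \near \oo, `|expected h n (restart n) 0 - \int[nu]_z h z| <= B / qroot n.
Proof.
move=> sh.
have [c [c0 hc]] := smooth_lipschitz sh.
have [c' [c'0 ht]] := smooth_rescale sh.
have [Cc [Cc0 nC]] := clock_error al0.
have bh := smooth_bm sh.
have k30 : 0 <= k3.
  by apply: le_trans (mom_3 mQ); apply: Rintegral_ge0 => w _; rewrite exprn_ge0.
have k30' : 0 <= k3'.
  by apply: le_trans (mom_3 mnu); apply: Rintegral_ge0 => w _; rewrite exprn_ge0.
set L := lind_const m k3 k3'.
have L0 : 0 <= L by rewrite !addr_ge0// mulr_ge0// addr_ge0// exprn_ge0.
pose m1 := `|m| + (1 + k3').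
have m10 : 0 <= m1 by rewrite !addr_ge0.
exists (3 * L * c' * (1 + 2 * Cc) + 2 * c * Cc * m1); split.
  by rewrite addr_ge0// !mulr_ge0// addr_ge0// mulr_ge0.
near=> n.
have n0 : (0 < n)%N by near: n; exact: nbhs_infty_gt.
have r2 : 2 <= qroot n :> R by near: n; exact: qroot_large.
have [Nn l0] : [/\ (restart n <= n)%N, (0 < lg n)%N &
  `|\sum_(i < n - restart n) rate (restart n + i) - ln n%:R| <= Cc * qroot n].
  by near: n.
set P := \sum_(i < _) _ => PE.
have P0 : 0 <= P by apply: sumr_ge0 => i _; have /andP[] := rate01 (restart n + i).
have ha := scale_ge n0 (R := R).
rewrite -(scale_sqr n0) in PE.
set a := scale n in PE ha *; set r := qroot n in r2 PE ha *.
have r0 : 0 < r by lra.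
have ra : r <= a by nra.
have a1 : 1 <= a by lra.
have a0 : 0 < a by lra.
have Pa : P <= (1 + 2 * Cc) * a ^+ 2.
  have : P <= a ^+ 2 + Cc * r by move: PE; rewrite ler_norml => /andP[_]; lra.
  have : Cc * r <= Cc * a ^+ 2 by apply: ler_wpM2l => //; nra.
  have : 0 <= Cc * a ^+ 2 by rewrite mulr_ge0// sqr_ge0.
  clearbody a P r; nra.
rewrite /expected.
have bo : bm (observed h n) by exact: (bm_comp (measurable_rescale _ _) bh).
have q2 : 0 <= c' / a ^+ 2 by rewrite divr_ge0// sqr_ge0.
have q3 : 0 <= c' / a ^+ 3 by rewrite divr_ge0// exprn_ge0// ltW.
have e1 := lazy_iter_gop mQ mnu (restart n) (n - restart n) 0 rate01 q2 q3 bo (ht a _ a0).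
rewrite -/L -/P in e1.
have e2 := gop_clock sh c0 hc P0 a1.
have aE : (fun x => h (rescale a (a ^+ 2 *: m) x)) = observed h n by rewrite /observed scale_sqr.
rewrite aE in e2.
rewrite (le_trans (ler_distD (gop m vs P (observed h n) 0) _ _))// mulrDl lerD//.
  apply: (le_trans e1).
  have N0 : 0 < (restart n)%:R :> R by rewrite ltr0n /restart expn_gt0 l0.
  have Nr : (restart n)%:R^-1 <= r^-1.
    rewrite lef_pV2 ?posrE// /restart natrX -qroot4 -/r.
    have r1 : 1 <= r by lra.
    by rewrite -exprM; exact: ler_eXnr.
  apply: (@le_trans _ _ (\sum_(i < n - restart n)
      (L * (c' / a ^+ 3 + c' / a ^+ 2 * r^-1)) * rate (restart n + i))).
    apply: ler_sum => i _; rewrite -[leRHS]mulrA; apply: ler_wpM2l => //.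
    set q := rate _; have /andP[q0 qk] := rate_bounds (restart n + i).
    rewrite -/q in q0 qk.
    have qr : q <= r^-1.
      rewrite (le_trans qk)// (le_trans _ Nr)// lef_pV2 ?posrE//.
      by rewrite ler_nat leqW// leq_addr.
    have -> : c' / a ^+ 3 * q + c' / a ^+ 2 * q ^+ 2 = (c' / a ^+ 3 + c' / a ^+ 2 * q) * q by ring.
    apply: ler_wpM2r; first exact: ltW.
    by apply: lerD => //; exact: (ler_wpM2l q2 qr).
  rewrite -mulr_sumr -/P.
  apply: (@le_trans _ _ (L * (c' / a ^+ 3 + c' / a ^+ 2 * r^-1) * ((1 + 2 * Cc) * a ^+ 2))).
    apply: ler_wpM2l => //; rewrite mulr_ge0// addr_ge0// mulr_ge0// invr_ge0 ltW//.
  have -> : L * (c' / a ^+ 3 + c' / a ^+ 2 * r^-1) * ((1 + 2 * Cc) * a ^+ 2) =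
     L * c' * (1 + 2 * Cc) * (a^-1 + r^-1).
    by field; rewrite !gt_eqF.
  have -> : 3 * L * c' * (1 + 2 * Cc) / r = L * c' * (1 + 2 * Cc) * (3 * r^-1) by ring.
  apply: ler_wpM2l; first by rewrite !mulr_ge0// addr_ge0// mulr_ge0.
  have : a^-1 <= r^-1 by rewrite lef_pV2.
  have : 0 <= r^-1 by rewrite invr_ge0 ltW.
  lra.
apply: (le_trans e2); rewrite -/m1.
have -> : 2 * c * Cc * m1 / r = c * (2 * Cc / r) * m1 by ring.
apply: ler_wpM2r => //; apply: ler_wpM2l => //.
rewrite ler_pdivrMr// (le_trans PE)//.
have -> : 2 * Cc / r * a = Cc * (2 * a / r) by ring.
apply: ler_wpM2l => //; rewrite ler_pdivlMr//.
by move: ha; lra.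
Unshelve. all: by end_near. Qed.

End lazy_walk.

(** * The position at the restart time *)

Section escape.
Context {R : realType} {d : nat} {dO : measure_display} {O : measurableType dO}.
Notation V := 'rV[R]_d.
Variables (Q : probability O R) (X : O -> V).
Hypothesis mX : measurable_fun setT X.
Hypothesis iX : Q.-integrable setT (EFin \o (fun w => `|X w|)).
Implicit Types (x : V) (k n : nat) (t q : R).

Definition step_size : R := 27 * (\int[Q]_w `|X w| + 1).

Lemma mean_norm_ge0 : 0 <= \int[Q]_w `|X w|.
Proof. by apply: Rintegral_ge0 => w _. Qed.

Lemma step_size_gt0 : 0 < step_size.
Proof. by have := mean_norm_ge0; rewrite /step_size; lra. Qed.

(** The expected norm of the lazy walk grows at most like a small power of the time;
    truncated at 1 and divided by this power, the norm is a supermartingale. *)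
Definition escape t k x : R :=
  Num.min 1 ((1 + `|x| / step_size) / (t * root8 k.+1%:R)).

Lemma escape_den_gt0 t k : 0 < t -> 0 < t * root8 (k.+1%:R : R).
Proof. by move=> t0; rewrite mulr_gt0// (lt_le_trans _ (root8_ge1 _))// ler1n. Qed.

Lemma escape_itv t k x : 0 < t -> 0 <= escape t k x <= 1.
Proof.
move=> t0; rewrite /escape ge_min lexx le_min ler01/= andbT.
rewrite divr_ge0 ?(ltW (escape_den_gt0 k t0))// addr_ge0// divr_ge0//.
exact: (ltW step_size_gt0).
Qed.

Lemma bm_escape t k : 0 < t -> bm (escape t k).
Proof.
move=> t0; apply: bm_itv01 => [|x]; last exact: escape_itv.
apply: measurable_minr; first exact: measurable_cst.
apply: measurable_funM; last exact: measurable_cst.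
apply: measurable_funD; first exact: measurable_cst.
by apply: measurable_funM; [exact: measurable_norm_rV|exact: measurable_cst].
Qed.

Lemma lazy_escape t k q x : 0 < t -> 0 <= q <= k.+1%:R^-1 ->
  lazy Q X q (escape t k.+1) x <= escape t k x.
Proof.
move=> t0 qk; have /andP[q0 q1] := qk.
have q11 : q <= 1 by rewrite (le_trans q1)// invf_le1// ler1n.
have s0 := step_size_gt0; have E0 := mean_norm_ge0.
have b := bm_shift x mX (bm_escape k.+1 t0).
have d1 := escape_den_gt0 k t0; have d2 := escape_den_gt0 k.+1 t0.
rewrite {2}/escape le_min; apply/andP; split.
  have K1 : Kop Q X (escape t k.+1) x <= 1.
    rewrite -[leRHS](Rint_prob_cst Q 1); apply: Rint_le => //; first exact: prob_fin.
      exact: bm_cst.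
    by move=> w; have /andP[] := escape_itv k.+1 (x + X w) t0.
  have /andP[_ e1] := escape_itv k.+1 x t0.
  rewrite /lazy; nra.
have e1 y : escape t k.+1 y <= (1 + `|y| / step_size) / (t * root8 k.+2%:R).
  by rewrite /escape ge_min lexx orbT.
have ic := bm_integrable (prob_fin Q) (bm_cst (1 + `|x| / step_size)).
have i2 := integrable_scale step_size^-1 iX.
have ics := integrable_addr ic i2.
have K2 : Kop Q X (escape t k.+1) x <= (1 + `|x| / step_size + 27^-1) / (t * root8 k.+2%:R).
  apply: (@le_trans _ _ (\int[Q]_w ((t * root8 k.+2%:R)^-1 * (1 + `|x| / step_size + step_size^-1 * `|X w|)))).
    apply: le_Rintegral => //.
    - exact: (bm_integrable (prob_fin Q) b).
    - exact: integrable_scale.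
    - move=> w _; rewrite (le_trans (e1 _))// mulrC; apply: ler_wpM2l; first by rewrite invr_ge0 ltW.
      rewrite -addrA lerD2l [step_size^-1 * _]mulrC -mulrDl; apply: ler_wpM2r; first by rewrite invr_ge0 ltW.
      exact: ler_normD.
  rewrite (RintegralZl _ measurableT ics) (RintegralD measurableT ic i2) Rint_prob_cst.
  rewrite (RintegralZl _ measurableT iX) mulrC; apply: ler_wpM2r; first by rewrite invr_ge0 ltW.
  rewrite lerD2l mulrC ler_pdivrMr// /step_size; lra.
have A0 : 0 <= `|x| / step_size by rewrite divr_ge0// ltW.
have {}e1 := e1 x.
have g := root8_step qk.
rewrite /lazy.
set A := `|x| / step_size in A0 K2 e1 *.
set D2 := t * root8 k.+2%:R in d2 K2 e1 *.
apply: (@le_trans _ _ ((1 + A + q / 27) / D2)).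
  apply: (@le_trans _ _ ((1 - q) * ((1 + A) / D2) + q * ((1 + A + 27^-1) / D2))).
    by apply: lerD; apply: ler_wpM2l => //; rewrite subr_ge0.
  by rewrite le_eqVlt; apply/orP; left; apply/eqP; field; rewrite gt_eqF.
apply: (@le_trans _ _ ((1 + A) * (1 + q / 27) / D2)).
  apply: ler_wpM2r; first by rewrite invr_ge0 ltW.
  have : 0 <= A * (q / 27) by rewrite mulr_ge0// divr_ge0.
  lra.
rewrite ler_pdivrMr// -[leRHS]mulrA; apply: ler_wpM2l; first by rewrite addr_ge0.
rewrite [leRHS]mulrC ler_pdivlMr// /D2 mulrC -mulrA; apply: ler_wpM2l => //.
exact: ltW.
Qed.

(** At the restart time the eighth root is of order qroot n, while the scale is at least
    half of the square of qroot n. *)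
Lemma escape_restart t : 0 < t -> \forall n \near \oo, forall x,
  Num.min 1 (`|x| / scale n) <= escape t (restart n) x.
Proof.
move=> t0; near=> n => x.
have n0 : (0 < n)%N by near: n; exact: nbhs_infty_gt.
have l0 : (0 < lg n)%N by near: n; exact: lg_gt0_near.
have rn : 1 + 4 * step_size * t <= qroot n by near: n; exact: qroot_large.
have ha := scale_ge n0 (R := R).
have hr := root8_restart (lexx (1 : R)) l0.
have s0 := step_size_gt0.
have d0 := escape_den_gt0 (restart n) t0.
have e1 : (restart n).+1%:R = 1 + (restart n)%:R :> R by rewrite -natr1 addrC.
have st : 0 < step_size * t by exact: mulr_gt0.
have rn' : 4 * (step_size * t) <= qroot n by move: rn; rewrite -mulrA; lra.
have a0 : 0 < scale n :> R by nra.
rewrite /escape le_min ge_min lexx/= ge_min; apply/orP; right.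
have xs : 0 <= `|x| by [].
rewrite ler_pdivrMr// mulrAC ler_pdivlMr//.
have key : step_size * (t * root8 (restart n).+1%:R) <= scale n.
  rewrite mulrA e1; apply: (@le_trans _ _ (step_size * t * (2 * 1 * qroot n))).
    by apply: ler_wpM2l => //; exact: ltW.
  by nra.
apply: (@le_trans _ _ (`|x| / step_size * scale n)); last first.
  by apply: ler_wpM2r; [exact: ltW|rewrite lerDr].
rewrite -[leRHS]mulrA; apply: ler_wpM2l => //.
by rewrite [leRHS]mulrC ler_pdivlMr// mulrC.
Unshelve. all: by end_near. Qed.

Lemma escape_cvg0 (mu : {finite_measure set V -> \bar R}) :
  (\int[mu]_x escape i.+1%:R 0 x) @[i --> \oo] --> (0 : R).
Proof.
have tp i : 0 < i.+1%:R :> R by [].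
have mu_fin : (mu setT < +oo)%E by rewrite ltey_eq fin_num_measure.
have b i : bm (escape i.+1%:R 0) by exact: bm_escape.
have pw x : escape i.+1%:R 0 x @[i --> \oo] --> (0 : R).
  apply/cvgrPdist_le => e e0; near=> i.
  have /andP[e1 _] := escape_itv 0 x (tp i).
  rewrite sub0r normrN ger0_norm// /escape ge_min; apply/orP; right.
  have r1 : root8 1 = 1 :> R by rewrite /root8 !sqrtr1.
  rewrite r1 mulr1 ler_pdivrMr// [leRHS]mulrC -ler_pdivrMr//.
  near: i; set B := (_ / e); exists (Num.truncn `|B|).+1 => // i /= iB.
  rewrite (le_trans (ler_norm B))// ltW// (lt_le_trans (truncnS_gt _))// ler_nat.
  exact: leqW.
have cv : (\int[mu]_x (escape i.+1%:R 0 x)%:E @[i --> \oo] --> \int[mu]_x (cst 0 x)%:E)%E.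
  apply: (@dominated_cvg _ _ _ mu setT measurableT (fun i x => (escape i.+1%:R 0 x)%:E)
    (fun x => (cst 0 x)%:E) (cst 1%E)) => //.
  - by move=> i; apply/measurable_EFinP; exact: (b i).1.
  - move=> x _; apply: cvg_EFin; first exact: nearW.
    exact: pw.
  - exact: (bm_integrable mu_fin (bm_cst 1)).
  - move=> i x _; rewrite /= lee_fin; have /andP[e0 e1] := escape_itv 0 x (tp i).
    by rewrite ger0_norm.
have := fine_cvg (a := (0 : R)); rewrite /Rintegral; apply.
by move: cv; rewrite /= integral0.
Unshelve. all: by end_near. Qed.

End escape.

(** * Almost sure events *)

Section almost_sure.
Context {R : realType} {dW : measure_display} {Omega : measurableType dW}.
Variable P : probability Omega R.

Lemma sum_inv_sqr n : \sum_(i < n) (i.+1%:R ^+ 2)^-1 <= 2 :> R.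
Proof.
suff h : \sum_(i < n) (i.+1%:R ^+ 2)^-1 <= 2 - n%:R^-1 :> R.
  by rewrite (le_trans h)// gerBl invr_ge0.
elim: n => [|n IH]; first by rewrite big_ord0 invr0 subr0.
rewrite big_ord_recr/=; case: n IH => [_|n IH].
  by rewrite big_ord0 add0r expr1n invr1; lra.
apply: (le_trans (lerD IH (lexx _))).
rewrite -addrA lerD2l.
have x0 : 0 < n.+1%:R :> R by [].
have -> : n.+2%:R = n.+1%:R + 1 :> R by rewrite natr1.
move: x0; set x := n.+1%:R => x0.
rewrite -subr_ge0 (_ : _ - _ = (x * (x + 1) ^+ 2)^-1); last first.
  by field; rewrite !gt_eqF// addr_gt0.
by rewrite invr_ge0 mulr_ge0 ?exprn_ge0 ?addr_ge0// ltW.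
Qed.

Lemma borel_cantelli (F : nat -> set Omega) B : (forall n, measurable (F n)) ->
  (forall n, P (F n) <= (B / n.+1%:R ^+ 2)%:E)%E ->
  {ae P, forall w, \forall n \near \oo, ~ F n w}.
Proof.
move=> mF PF.
have B0 : 0 <= B.
  by have := le_trans (measure_ge0 P (F 0%N)) (PF 0%N); rewrite lee_fin expr1n divr1.
have fin : (\sum_(n <oo) P (F n) < +oo)%E.
  apply: (@le_lt_trans _ _ (B * 2)%:E); last exact: ltry.
  apply: lime_le.
    by apply: is_cvg_nneseries => n _ _; exact: measure_ge0.
  apply: nearW => n; rewrite big_mkord.
  apply: (@le_trans _ _ (\sum_(i < n) (B / i.+1%:R ^+ 2)%:E)%E).
    by apply: lee_sum => i _; exact: PF.
  rewrite sumEFin lee_fin -mulr_sumr; apply: ler_wpM2l => //.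
  exact: sum_inv_sqr.
exists (lim_sup_set F); split.
- by apply: bigcap_measurable => // n _; apply: bigcup_measurable => k _.
- exact: lim_sup_set_cvg0.
- move=> w /= h n _; apply: contrapT => nF; apply: h.
  exists n => // k /= nk Fk; apply: nF; exists k => //.
Qed.

(** The restart time is about the square of log n, so that the left-hand side decays
    faster than any power of n; the constant comes from 2 l <= c l^2 + 1 / c. *)
Lemma subgaussian_restart (c : R) n : 0 < c -> (0 < n)%N ->
  expR (- (c * (restart n)%:R)) <= expR (2 + c^-1) / n.+1%:R ^+ 2.
Proof.
move=> c0 n0; have [_ h] := lg_bounds n0.
rewrite ler_pdivlMr ?exprn_gt0//.
set l := (lg n)%:R : R.
have nl : n.+1%:R <= expR (l + 1) :> R.
  apply: (@le_trans _ _ ((2 ^ (lg n).+1)%:R)); first by rewrite ler_nat.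
  rewrite natrX /l natr1.
  rewrite -[X in expR X]mulr1 expRM_natl.
  rewrite lerXn2r// ?nnegrE ?expR_ge0//.
  exact: (expR_ge1Dx (1 : R)).
have n2 : n.+1%:R ^+ 2 <= expR (2 * (l + 1)) :> R.
  by rewrite expRM_natl lerXn2r// nnegrE ?expR_ge0.
apply: (@le_trans _ _ (expR (- (c * (restart n)%:R)) * expR (2 * (l + 1)))).
  by apply: ler_wpM2l => //; exact: expR_ge0.
rewrite -expRD ler_expR /restart natrX -/l.
have : 0 <= c * (l - c^-1) ^+ 2 by rewrite mulr_ge0 ?sqr_ge0// ltW.
have -> : c * (l - c^-1) ^+ 2 = c * l ^+ 2 - 2 * l + c^-1 by field; rewrite gt_eqF.
lra.
Qed.

End almost_sure.

(** * The random walk Polya process *)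

Section walk_polya.
Context {R : realType} {d : nat} {dO : measure_display} {O : measurableType dO}.
Notation V := 'rV[R]_d.
Variables (Q : probability O R) (Delta : {RV Q >-> V}).
Hypothesis hDelta : exp_moments Delta.
Variables (vs : seq V) (k3 : R).
Notation nu := (gaussv vs).
Hypothesis mnu : moments nu id (fun=> 0)
  (fun i j => \int[Q]_w (Delta w ord0 i * Delta w ord0 j)) k3.
Variables (M0 : {finite_measure set V -> \bar R}) (dW : measure_display).
Variables (Omega : measurableType dW) (P : probability Omega R).
Variables (C : nat -> {RV P >-> V}) (M : nat -> Omega -> {measure set V -> \bar R}).
Hypothesis HM : is_mvpp M0 (walk_kernel Delta) C M.
Hypothesis M0pos : (0 < M0 [set: V])%E.
Implicit Types (h f : V -> R) (x : V) (w : Omega) (n k : nat).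

Let m := mean_rv Delta.
Let al := fine (M0 setT).
Let K : R.-pker V ~> V := walk_kernel Delta.

Notation mass := (mass M0).
Notation avg := (avg M0 M).
Notation observed := (observed m).
Notation expected := (expected Q Delta m al).

Let al0 : 0 < al. Proof. exact: mass0_gt0 M0pos. Qed.

Let mQ : moments Q Delta (fun i => m ord0 i)
  (fun i j => \int[Q]_w (Delta w ord0 i * Delta w ord0 j)) (\int[Q]_w (`|Delta w| ^+ 3)).
Proof.
have := increment_moments hDelta; congr (moments _ _ _ _ _).
by apply/funext => i; rewrite /m mean_rvE.
Qed.

Lemma Kint_walk f x : bm f -> Kint K f x = Kop Q Delta f x.
Proof.
move=> bf; exact: (@image_integral_bm _ _ _ _ _ Q (K x) (shift_rv Delta x)
  (measurable_shift_rv Delta x) (fun _ _ => erefl) f (prob_fin Q) bf).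
Qed.

Lemma mstep_walk n f : bm f -> mstep M0 K n f = lazy Q Delta (rate al n) f.
Proof. by move=> bf; apply/funext => x; rewrite /mstep Kint_walk. Qed.

Section test_function.
Variable h : V -> R.
Hypothesis sh : smooth h.
Hypothesis h01 : forall x, 0 <= h x <= 1.

Lemma bm_observed n : bm (observed h n).
Proof. exact: (bm_comp (measurable_rescale _ _) (smooth_bm sh)). Qed.

Lemma bm_expected n k : bm (expected h n k).
Proof. exact: (bm_lazy_iter mQ _ _ _ (bm_observed n)). Qed.

Lemma expected_norm n k x : `|expected h n k x| <= 1.
Proof.
apply: (lazy_iter_norm mQ al0); first exact: bm_observed.
by move=> y; have /andP[h0 h1] := h01 (rescale (scale n) (ln n%:R *: m) y); rewrite ger0_norm.
Qed.

Lemma expected_step n k : (k < n)%N -> expected h n k = mstep M0 K k (expected h n k.+1).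
Proof.
move=> kn; rewrite mstep_walk; last exact: bm_expected.
by rewrite /expected -subnSK.
Qed.

Lemma expected_end n : expected h n n = observed h n.
Proof. by rewrite /expected subnn. Qed.

(** The exponential tail at the restart time is summable over n: although the
    martingale changes with n, the averages at time n are almost surely
    asymptotic to those at the restart time. *)
Lemma restart_fluctuation : {ae P, forall w, forall e, 0 < e -> \forall n \near \oo,
  `|avg n (observed h n) w - avg (restart n) (expected h n (restart n)) w| <= e}.
Proof.
pose D n w := `|avg n (observed h n) w - avg (restart n) (expected h n (restart n)) w|.
pose F i n := if (restart n <= n)%N && (0 < lg n)%N
  then [set w | i.+1%:R^-1 <= D n w] else set0.
have mF i n : measurable (F i n).
  rewrite /F; case: ifP => // _.
  have bD : bm (fun w => avg n (observed h n) w - avg (restart n) (expected h n (restart n)) w).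
    apply: bmB; apply: (hist_bm HM); apply: (bm_avg HM (leqnn _)).
      exact: bm_observed.
    exact: bm_expected.
  have mD : measurable_fun setT (D n) by apply: measurableT_comp => //; exact: bD.1.
  exact: measurable_superlevel.
have PF i n : (P (F i n) <= (2 * expR (2 + (i.+1%:R^-1 ^+ 2 / 32)^-1) / n.+1%:R ^+ 2)%:E)%E.
  rewrite /F; case: ifP => [/andP[Nn l0]|_]; last first.
    by rewrite measure0 lee_fin divr_ge0 ?mulr_ge0 ?expR_ge0// exprn_ge0.
  have N0 : (0 < restart n)%N by rewrite /restart expn_gt0 l0.
  have n0 : (0 < n)%N by apply: leq_trans Nn.
  have i0 : 0 < i.+1%:R :> R by [].
  have i01 : 0 <= (i.+1%:R^-1 : R) <= 1.
    by apply/andP; split; [rewrite invr_ge0 ltW|rewrite invf_le1// ler1n].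
  have := avg_tail HM M0pos (j := (n - restart n)%N) N0 i01 (bm_expected n) (expected_norm n).
  rewrite subnKC// expected_end => H; apply: (le_trans (H _)).
    by move=> k /andP[_ kn]; exact: expected_step.
  rewrite lee_fin -[leRHS]mulrA; apply: ler_wpM2l => //.
  rewrite mulrAC; by apply: subgaussian_restart.
have H : {ae P, forall w, forall i, \forall n \near \oo, ~ F i n w}.
  by apply/ae_foralln => i; exact: (borel_cantelli (mF i) (PF i)).
have nC := clock_error al0.
apply: filterS H => w H e e0.
pose i := Num.truncn e^-1.
have ie : i.+1%:R^-1 <= e.
  by rewrite invf_ple ?posrE// ltW// truncnS_gt.
case: nC => C0 [_ nC]; near=> n.
have [Nn l0 _] : [/\ (restart n <= n)%N, (0 < lg n)%N &
    `|\sum_(i0 < n - restart n) (al + (restart n + i0).+1%:R)^-1 - ln n%:R| <= C0 * qroot n].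
  by near: n.
have : ~ F i n w by near: n; exact: H.
rewrite /F Nn l0/= => /negP; rewrite -ltNge => /ltW Dn.
exact: (le_trans Dn).
Unshelve. all: by end_near. Qed.

End test_function.

Lemma norm_integrable : Q.-integrable setT (EFin \o (fun o => `|Delta o|)).
Proof. exact: (moments_norm mQ).1. Qed.

Notation escape := (escape Q Delta).

(** By the maximal inequality the exceptional event of level i has probability at most
    a multiple of the initial average of the i-th function escape, which tends to 0. *)
Lemma no_escape : {ae P, forall w, forall e, 0 < e ->
  exists i : nat, forall k, avg k (escape i.+1%:R k) w < e}.
Proof.
have tp i : 0 < i.+1%:R :> R by [].
have be i k : bm (escape i.+1%:R k) by exact: bm_escape.
pose c i := (\int[M0]_x escape i.+1%:R 0 x) / mass 0.
have c_cvg : c i @[i --> \oo] --> (0 : R).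
  rewrite -[X in _ --> X](mul0r (mass 0)^-1); apply: cvgMl.
  exact: escape_cvg0.
have avg0 i w : avg 0 (escape i.+1%:R 0) w <= c i.
  rewrite le_eqVlt; apply/orP; left; apply/eqP; congr (fine _ / _).
  apply: eq_measure_integral => A mA _; exact: (mvpp_init HM).
pose A i j := [set w | forall k, avg k (escape i.+1%:R k) w < j.+1%:R^-1].
have PA i j : measurable (A i j) /\ (P (~` A i j) <= (c i * j.+1%:R)%:E)%E.
  have [||||m1 m2] := maximal_inequality HM M0pos (u := fun k => escape i.+1%:R k) (lam := j.+1%:R^-1) _ _ _ _ (avg0 i).
  - by move=> k; exact: be.
  - by move=> k x; have /andP[] := escape_itv Q Delta k x (tp i).
  - move=> k x; rewrite mstep_walk//.
    apply: (lazy_escape (mX Delta) norm_integrable) => //.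
    by have /andP[r0 r1] := rate_bounds al0 k; rewrite ltW.
  - by rewrite invr_gt0.
  - by split => //; rewrite -[X in (c i * X)%R]invrK.
have H : {ae P, forall w, forall j, exists i, A i j w}.
  apply/ae_foralln => j; exists (\bigcap_i ~` A i j); split.
  - by apply: bigcap_measurable => // i _; apply: measurableC; exact: (PA i j).1.
  - have mB : measurable (\bigcap_i ~` A i j).
      by apply: bigcap_measurable => // i _; apply: measurableC; exact: (PA i j).1.
    have Pc i : fine (P (\bigcap_i ~` A i j)) <= c i * j.+1%:R.
      rewrite -lee_fin fineK ?fin_num_measure//.
      apply: (le_trans _ (PA i j).2); apply: le_measure.
      + by rewrite inE.
      + by rewrite inE; apply: measurableC; exact: (PA i j).1.
      + by move=> w /(_ i I).
    have c0 : c i * j.+1%:R @[i --> \oo] --> (0 : R).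
      by rewrite -[X in _ --> X](mul0r (j.+1%:R : R)); exact: cvgMl.
    apply/eqP; rewrite eq_le measure_ge0 andbT -[leLHS]fineK ?fin_num_measure// lee_fin.
    by apply: (cvgr_to_ge c0); exact: nearW.
  - move=> w /= nA i _ iA; apply: nA; exists i; exact: iA.
apply: filterS H => w H e e0.
pose j := Num.truncn e^-1.
have [i iA] := H j; exists i => k; apply: (lt_le_trans (iA k)).
by rewrite invf_ple ?posrE// ltW// truncnS_gt.
Qed.

(** The averages are close to those of the expected function at the restart time, hence,
    by its modulus of continuity, to its value at the origin. *)
Lemma observed_cvg h : smooth h -> (forall x, 0 <= h x <= 1) ->
  {ae P, forall w, avg n (observed h n) w @[n --> \oo] --> \int[nu]_z h z}.
Proof.
move=> sh h01.
have [c [c0 hc]] := smooth_lipschitz sh.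
have [B [B0 hB]] := restart_limit mQ mnu al0 sh.
have := no_escape; apply: filterS2 (restart_fluctuation sh h01) => w H1 H2.
apply/cvgrPdist_le => e e0.
have e3 : 0 < e / 3 by rewrite divr_gt0.
have c1 : 0 < 1 + c by rewrite ltr_pwDl.
have [i Hi] := H2 (e / 3 / (1 + c)) (divr_gt0 e3 c1).
have ti : 0 < i.+1%:R :> R by [].
have hE := escape_restart Q Delta ti.
near=> n.
have n0 : (0 < n)%N by near: n; exact: nbhs_infty_gt.
have r1 : 1 + B / (e / 3) <= qroot n by near: n; exact: qroot_large.
have a0 : 0 < scale n :> R.
  have := scale_ge n0 (R := R).
  have : 0 <= B / (e / 3) by rewrite divr_ge0// ltW.
  by nra.
have f1 : `|avg n (observed h n) w - avg (restart n) (expected h n (restart n)) w| <= e / 3.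
  by near: n; exact: H1.
have f2 : `|expected h n (restart n) 0 - \int[nu]_z h z| <= e / 3.
  apply: (@le_trans _ _ (B / qroot n)); first by near: n.
  have r0 : 0 < qroot n :> R.
    have : 0 <= B / (e / 3) by rewrite divr_ge0// ltW.
    by lra.
  rewrite ler_pdivrMr// mulrC -ler_pdivrMr//; lra.
have hEn x : Num.min 1 (`|x| / scale n) <= escape i.+1%:R (restart n) x.
  by move: x; near: n.
set N := restart n in f1 f2 hEn.
have f3 : `|avg N (expected h n N) w - expected h n N 0| <= e / 3.
  have be := bm_expected sh n N.
  have bE : bm (escape i.+1%:R N) by exact: bm_escape.
  have ex x : `|expected h n N x - expected h n N 0| <= (1 + c) * escape i.+1%:R N x.
    apply: (@le_trans _ _ ((1 + c) * Num.min 1 (`|x| / scale n))); last first.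
      apply: ler_wpM2l; first exact: ltW.
      exact: hEn.
    rewrite -{1}[x]add0r; apply: (lazy_iter_modulus mQ al0) => [|y]; first exact: bm_observed.
    have u1 : `|observed h n (y + x) - observed h n y| <= 1.
      have /andP[? ?] := h01 (rescale (scale n) (ln n%:R *: m) (y + x)).
      have /andP[? ?] := h01 (rescale (scale n) (ln n%:R *: m) y).
      by rewrite ler_norml /observed; lra.
    have u2 : `|observed h n (y + x) - observed h n y| <= c * (`|x| / scale n).
      rewrite /observed.
      have -> : rescale (scale n) (ln n%:R *: m) (y + x) =
          rescale (scale n) (ln n%:R *: m) y + (scale n)^-1 *: x.
        by rewrite /rescale addrAC scalerDr.
      by rewrite (le_trans (hc _ _))// normrZ normfV (gtr0_norm a0) [_^-1 * _]mulrC.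
    have xa : 0 <= `|x| / scale n by rewrite divr_ge0// ltW.
    have [x1|x1] := leP 1 (`|x| / scale n).
      by rewrite mulr1 (le_trans u1)// lerDl.
    by rewrite (le_trans u2)// mulrDl mul1r lerDr.
  have bcs : bm (fun x => (1 + c) * escape i.+1%:R N x) by exact: bmZ.
  have bd : bm (fun x => expected h n N x - cst (expected h n N 0) x).
    by apply: bmB => //; exact: bm_cst.
  have -> : avg N (expected h n N) w - expected h n N 0 =
      avg N (fun x => expected h n N x - cst (expected h n N 0) x) w.
    by rewrite (avgB HM) ?(avg_cst HM M0pos)//; exact: bm_cst.
  have Hn : avg N (fun x => (1 + c) * escape i.+1%:R N x) w <= e / 3.
    by rewrite (avgZ HM)// mulrC -ler_pdivlMr// ltW.
  rewrite ler_norml; apply/andP; split.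
    rewrite lerNl -(avgN HM)//; apply: le_trans Hn; apply: (avg_le HM M0pos) => // [|x].
      exact: bmN.
    exact: (le_trans (ler_norm _) (eq_ind_r (fun z => z <= _) (ex x) (normrN _))).
  apply: le_trans Hn; apply: (avg_le HM M0pos) => // x.
  exact: (le_trans (ler_norm _) (ex x)).
rewrite distrC.
have -> : avg n (observed h n) w - \int[nu]_z h z =
   (avg n (observed h n) w - avg N (expected h n N) w) +
   (avg N (expected h n N) w - expected h n N 0) + (expected h n N 0 - \int[nu]_z h z) by ring.
have -> : e = e / 3 + e / 3 + e / 3 by field.
by rewrite (le_trans (ler_normD _ _))// lerD// (le_trans (ler_normD _ _))// lerD.
Unshelve. all: by end_near. Qed.

End walk_polya.

(** * Convergence of the rescaled process *)

Section rescaled_process.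
Context {R : realType} {d : nat}.
Notation V := 'rV[R]_d.

Lemma integral_rescaled (mu : {measure set V -> \bar R}) (c : {nonneg R}) a (b : V) h :
  (mu setT < +oo)%E -> bm h -> (forall x, 0 <= h x) ->
  Rintegral (Theta a b (mscale c mu)) setT h = c%:num * \int[mu]_x h (rescale a b x).
Proof.
move=> mu_fin bh h0.
have cfin : (mscale c mu setT < +oo)%E by rewrite /mscale/= lte_mul_pinfty.
rewrite (@image_integral_bm _ _ _ _ _ (mscale c mu) (Theta a b (mscale c mu)) (rescale a b)
  (measurable_rescale a b) (fun _ _ => erefl) h cfin bh).
have br : bm (fun x => h (rescale a b x)) by exact: (bm_comp (measurable_rescale _ _) bh).
rewrite /Rintegral ge0_integral_mscale//; last 2 first.
- by apply/measurable_EFinP; exact: br.1.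
- by move=> x _; rewrite lee_fin.
by rewrite (int_bm_fin mu_fin br).
Qed.

End rescaled_process.

Theorem theorem6 (R : realType) (d : nat) (hd : (0 < d)%N)
    (dO : measure_display) (O : measurableType dO) (Q : probability O R)
    (Delta : {RV Q >-> 'rV[R]_d}) (hDelta : exp_moments Delta) :
  let m := mean_rv Delta in
  exists nu : probability 'rV[R]_d R,
    is_gaussian nu 0 (cov_mx Delta + m^T *m m) /\
    forall (M0 : {finite_measure set 'rV[R]_d -> \bar R}),
      (0 < M0 [set: 'rV[R]_d])%E ->
      forall (dW : measure_display) (Omega : measurableType dW)
        (P : probability Omega R) (C : nat -> {RV P >-> 'rV[R]_d})
        (M : nat -> Omega -> {measure set 'rV[R]_d -> \bar R}),
        is_mvpp M0 (walk_kernel Delta) C M ->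
        {ae P, forall w,
          weak_cvg (fun n : nat =>
            Theta (Num.sqrt (ln n%:R)) (ln n%:R *: m)
              (mscale (n%:R^-1)%:nng (M n w))) nu}.
Proof.
move=> m; have [vs [k3 [gvs mnu]]] := gaussian_same_second_moments hDelta.
exists (gaussv vs); split => // M0 M0pos dW Omega P C M HM.
have mass_cvg : n%:R^-1 * mass M0 n @[n --> \oo] --> (1 : R).
  rewrite -cvg_shiftS/=.
  have -> : (fun n => n.+1%:R^-1 * mass M0 n.+1) = (fun n => n.+1%:R^-1 * fine (M0 setT) + 1).
    by apply/funext => n; rewrite /mass mulrDr mulVf// pnatr_eq0.
  have h0 : n.+1%:R^-1 * fine (M0 setT) @[n --> \oo] --> 0 * fine (M0 setT).
    by apply: cvgMl; exact: cvg_harmonic.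
  have := cvgD h0 (cvg_cst (1 : R)); rewrite mul0r add0r; exact.
have H : {ae P, forall w, forall J : nat, forall s, unpickle J = Some s ->
    avg M0 M n (observed m (hits s) n) w @[n --> \oo] --> \int[gaussv vs]_z hits s z}.
  apply/ae_foralln => J.
  case E : (unpickle J) => [s|]; last by apply: aeW.
  have := observed_cvg hDelta mnu HM M0pos (smooth_hits s) (hits_itv s).
  by apply: filterS => w cw s' [<-].
apply: filterS H => w H.
have fin n : (M n w setT < +oo)%E by exact: (M_fin HM).
apply: weak_cvg_smooth.
- by move=> n; rewrite /Theta /pushforward /mscale/= preimage_setT lte_mul_pinfty.
- have <- : (fun n => n%:R^-1 * mass M0 n) = (fun n => fine (Theta (Num.sqrt (ln n%:R)) (ln n%:R *: m)
              (mscale (n%:R^-1)%:nng (M n w)) setT)).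
    apply/funext => n; rewrite /Theta /pushforward /mscale/= preimage_setT.
    have e : M n w setT = (mass M0 n)%:E by exact: (mvpp_mass HM).
    by rewrite [X in fine (_ * X)%E]e -EFinM.
  exact: mass_cvg.
- move=> s.
  have -> : (fun n => Rintegral (Theta (Num.sqrt (ln n%:R)) (ln n%:R *: m)
              (mscale (n%:R^-1)%:nng (M n w))) setT (hits s)) =
     (fun n => (n%:R^-1 * mass M0 n) * avg M0 M n (observed m (hits s) n) w).
    apply/funext => n; rewrite integral_rescaled//=; last 2 first.
      exact/smooth_bm/smooth_hits.
      by move=> x; have /andP[] := hits_itv s x.
    by rewrite /avg -mulrA [mass _ _ * _]mulrC divfK// gt_eqF// mass_gt0.
  have cw := H (pickle s) s (pickleK s).
  have := cvgM mass_cvg cw; rewrite mul1r; exact.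
Qed.
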